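(* Let $p\in(0,1)$ and $\alpha\in[0,1]$, and let $(X_n)_{n\ge 0}$ be the $p$-rotor walk on $\mathbb{Z}$ with $(\alpha,0)$-random initial configuration. Let $\mathcal{B}$ be a standard Brownian motion started at $0$ and $\mathcal{M}(t)=\sup_{s\le t}\mathcal{B}(s)$. Then, as $n\to\infty$, the rescaled linearly interpolated walk $\left\{\frac{X(nt)}{\sqrt n},\ t\ge0\right\}$ converges weakly in $\mathcal{C}[0,\infty)$ to $$\left\{\sqrt{\tfrac{1-p}{p}}\,\big(\mathcal{B}(t)+\lambda\,\mathcal{M}(t)\big),\ t\ge0\right\},\qquad\text{where}\quad \lambda=\lambda_{p,\alpha}=\frac{\alpha(2p-1)}{\alpha(1-p)+p(1-\alpha)}.$$
   Context: The $p$-rotor walk. For $p\in[0,1]$ the $p$-rotor walk is the first component of the Markov chain $(X_n,\rho_n)_{n\ge0}$ on $\mathbb{Z}\times\{-1,+1\}^{\mathbb{Z}}$ with $X_0=0$, a (random) initial rotor configuration $\rho_0$, and dynamics: let $B_0,B_1,\ldots$ be i.i.d., independent of $\rho_0$, with $P(B_n=1)=p=1-P(B_n=-1)$; set $\rho_{n+1}(x)=\rho_n(x)$ for $x\ne X_n$, $\rho_{n+1}(X_n)=B_n\rho_n(X_n)$, and $X_{n+1}=X_n+\rho_{n+1}(X_n)$. The $(\alpha,0)$-random initial configuration ($\alpha\in[0,1]$): the variables $(\rho_0(x))_{x\in\mathbb{Z}}$ are independent; for $x<0$, $\rho_0(x)=+1$ with probability $1$; for $x=0$, $\rho_0(0)=\pm1$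 with probability $1/2$ each; for $x>0$, $\rho_0(x)=+1$ with probability $\alpha$ and $-1$ with probability $1-\alpha$. Linear interpolation: for a discrete-time process $(X_n)$ and real $t\ge0$, $X(t)=X_{\lfloor t\rfloor}+(t-\lfloor t\rfloor)(X_{\lfloor t\rfloor+1}-X_{\lfloor t\rfloor})$. Weak convergence in $\mathcal{C}[0,\infty)$ means that for every $0<T<\infty$ the restrictions to $[0,T]$ converge weakly in $\mathcal{C}[0,T]$ equipped with the supremum norm. *)

(* Defs.v *)
From HB Require Import structures.
From mathcomp Require Import all_boot all_order all_algebra finmap.
From mathcomp Require Import all_classical all_reals all_analysis.

Set Implicit Arguments.
Unset Strict Implicit.
Unset Printing Implicit Defensive.

Import Order.TTheory GRing.Theory Num.Theory.
Import numFieldNormedType.Exports.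

Local Open Scope classical_set_scope.
Local Open Scope ring_scope.

(* The library puts the discrete sigma-algebra on bool and nat, not on int. *)
HB.instance Definition _ := isPointed.Build int 0.
HB.instance Definition _ := @isMeasurable.Build default_measure_display
  int (@discrete_measurable int) (@discrete_measurable0 int)
  (@discrete_measurableC int) (@discrete_measurableU int).

Section Independence.
Context {R : realType} {d : measure_display} {Omega : measurableType d}
  (P : probability Omega R).
Context {d' : measure_display} {S : measurableType d'}.

Definition mutually_independent {I : choiceType} (X : I -> Omega -> S) : Prop :=
  forall (J : {fset I}) (A : I -> set S), (forall i, measurable (A i)) ->
    P (\bigcap_(i in [set` J]) (X i @^-1` A i)) =
    (\prod_(i <- J) P (X i @^-1` A i))%E.

Definition sigma_generated {I : Type} (X : I -> Omega -> S) : set (set Omega) :=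
  <<s \bigcup_i preimage_set_system setT (X i) measurable >>.

Definition independent_families {I K : Type}
    (X : I -> Omega -> S) (Y : K -> Omega -> S) : Prop :=
  forall E F : set Omega, sigma_generated X E -> sigma_generated Y F ->
    P (E `&` F) = (P E * P F)%E.

End Independence.

Section RotorWalk.

(* The pair (X_n, rho_n), driven by the configuration rho0 and the signs b. *)
Fixpoint rotor_chain (rho0 : int -> int) (b : nat -> int) (n : nat) :
    int * (int -> int) :=
  if n is m.+1 then
    let: (x, rho) := rotor_chain rho0 b m in
    let rho' := fun y => if y == x then b m * rho x else rho y in
    (x + rho' x, rho')
  else (0, rho0).

Definition rotor_walk (rho0 : int -> int) (b : nat -> int) (n : nat) : int :=
  (rotor_chain rho0 b n).1.

Context {R : realType} {d : measure_display} {Omega : measurableType d}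
  (P : probability Omega R).

Definition sign_law (q : R) (X : {RV P >-> int}) : Prop :=
  [/\ forall w, X w = 1 \/ X w = -1,
      P [set w | X w = 1] = q%:E &
      P [set w | X w = -1] = (1 - q)%:E].

Definition alpha_0_random_configuration (alpha : R)
    (rho0 : int -> {RV P >-> int}) : Prop :=
  [/\ mutually_independent P (fun x => rho0 x : Omega -> int),
      forall x, x < 0 -> sign_law 1 (rho0 x),
      sign_law (1 / 2) (rho0 0) &
      forall x, 0 < x -> sign_law alpha (rho0 x)].

Definition iid_signs (p : R) (b : nat -> {RV P >-> int}) : Prop :=
  mutually_independent P (fun n => b n : Omega -> int) /\
  forall n, sign_law p (b n).

Definition rotor_walk_process (rho0 : int -> {RV P >-> int})
    (b : nat -> {RV P >-> int}) (n : nat) (w : Omega) : int :=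
  rotor_walk (fun x => rho0 x w) (fun m => b m w) n.

Definition is_rotor_walk (p alpha : R) (X : nat -> Omega -> int) : Prop :=
  exists (rho0 : int -> {RV P >-> int}) (b : nat -> {RV P >-> int}),
    [/\ alpha_0_random_configuration alpha rho0,
        iid_signs p b,
        independent_families P (fun x => rho0 x : Omega -> int)
                               (fun n => b n : Omega -> int) &
        X = rotor_walk_process rho0 b].

End RotorWalk.

(* Meant for t >= 0, where Num.truncn is the floor. *)
Definition interpolation {R : realType} (x : nat -> R) (t : R) : R :=
  let k := Num.truncn t in x k + (t - k%:R) * (x k.+1 - x k).

Section BrownianMotion.
Context {R : realType} {d : measure_display} {Omega : measurableType d}
  (P : probability Omega R).

(* Standard Brownian motion started at 0; only times t >= 0 are constrained.
   normal_prob takes the standard deviation, and its value at deviation 0 is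
   not a Dirac mass, hence s < t below. *)
Definition brownian_motion (B : R -> {RV P >-> R}) : Prop :=
  [/\ forall w, B 0 w = 0,
      forall w, {within `[0, +oo[, continuous (fun t => B t w)},
      forall (n : nat) (t : nat -> R), 0 <= t 0%N ->
        {homo t : i j / (i <= j)%N >-> i <= j} ->
        mutually_independent P
          (fun (i : 'I_n) (w : Omega) => B (t i.+1) w - B (t i) w) &
      forall s t : R, 0 <= s -> s < t ->
        forall A : set R, measurable A ->
          pushforward P (B t \- B s) A = normal_prob 0 (Num.sqrt (t - s)) A].

Definition running_sup (B : R -> Omega -> R) (t : R) (w : Omega) : R :=
  sup [set B s w | s in `[0, t]].

End BrownianMotion.

(* C[0,T] inside the space of all functions R -> R with the topology of uniform
   convergence on [0,T]; two functions agreeing on [0,T] are indistinguishable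
   there. *)
Definition C0T {R : realType} (T : R) : set {uniform` `[0, T]%classic -> R} :=
  [set f | {within `[0, T], continuous (f : R -> R)}].
Arguments C0T {R} T _.

Definition bounded_continuous_on_C0T {R : realType} (T : R)
    (Phi : {uniform` `[0, T]%classic -> R} -> R) : Prop :=
  {within C0T T, continuous Phi} /\
  exists M : R, forall f, C0T T f -> `|Phi f| <= M.

Section WeakConvergence.
Context {R : realType}.
Context {d : measure_display} {Omega : measurableType d}
  (P : probability Omega R)
  {d' : measure_display} {Omega' : measurableType d'}
  (Q : probability Omega' R).

(* Meant for processes with measurable coordinates and continuous paths; since
   C[0,T] is separable, Phi composed with such a process is measurable. *)
Definition weak_cvg_C0T (T : R) (Y : nat -> R -> Omega -> R)
    (Z : R -> Omega' -> R) : Prop :=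
  forall Phi : {uniform` `[0, T]%classic -> R} -> R,
    bounded_continuous_on_C0T Phi ->
    ('E_P[fun w => Phi (fun t => Y n t w)] @[n --> \oo] -->
     'E_Q[fun w => Phi (fun t => Z t w)])%E.

Definition weak_cvg_C0oo (Y : nat -> R -> Omega -> R)
    (Z : R -> Omega' -> R) : Prop :=
  forall T : R, 0 < T -> weak_cvg_C0T T Y Z.

End WeakConvergence.

(* Main.v *)
From HB Require Import structures.
Require Import Defs.
From mathcomp Require Import all_boot all_order all_algebra finmap.
From mathcomp Require Import all_classical all_reals all_analysis.
From mathcomp Require Import measurable_realfun zify ring lra.
Set Implicit Arguments.
Unset Strict Implicit.
Unset Printing Implicit Defensive.
Import Order.TTheory GRing.Theory Num.Theory.
Import numFieldNormedType.Exports.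
Local Open Scope classical_set_scope.
Local Open Scope ring_scope.

(** Let X be the walk, S its running maximum, eta_k the rotor that the walker
meets at time k, and e = 2 p - 1 the mean of the signs b_k.

The trajectory has a simple structure. The rotors to the left of the walker
all point right; those between the walker and the maximum point left; those
beyond the maximum have not been touched (rotors_invariant). Hence the rotor
met at time k+1 is the opposite of the last step, unless that step reached a
new level, and summation gives the exact identity (sum_rotor_at)

  eta_0 + ... + eta_n = rho0 0 - X_n + sum of 1 + rho0 x over 1 <= x <= S_n.

The last sum is 2 alpha S_n up to the fluctuation of independent signs. On the
other hand X_(k+1) - X_k = b_k eta_k, so that X_n = N_n + e (eta_0 + ... +
eta_(n-1)), where N is the martingale with increments (b_k - e) eta_k. As
eta_k ^ 2 = 1, the conditional variance of each increment is exactly 1 - e ^ 2.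
Eliminating the sum of the rotors yields, with W = N / (2 p) and
kappa = alpha e / p,

  X_n - kappa S_n = W_n + o(sqrt n)                          (decomposition).

Taking running maxima, (1 - kappa) S_n is close to max W, and then X_n is close
to W_n + lambda max W, because lambda = kappa / (1 - kappa)
(walk_near_perturb). The map w |-> w + lambda sup w is Lipschitz for the uniform
norm, so what remains is a functional central limit theorem: W, rescaled,
converges to sigma B with sigma ^ 2 = (1 - e ^ 2) / (2 p) ^ 2 = (1 - p) / p.

For that theorem, every bounded continuous functional is an increasing limit of
bounded Lipschitz ones (portmanteau). Up to a small error in expectation, a
Lipschitz functional depends only on the increments over a mesh of m intervals:
for Brownian motion because its paths are continuous (brownian_mesh_cvg), for
the walk because of a maximal inequality with fourth moments (walk_error). The
increments of W over the mesh are exchanged for those of sigma B one after the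
other (increments_cvg), and inside one mesh interval by the method of Lindeberg
(block_replacement): the steps of the martingale are replaced one at a time by
short increments of B itself, the mean and the variance agree, and third moments
control the error. The smoothness that this requires is obtained by averaging
the test function twice over short intervals (smoothing).

The walk depends on independent variables with two values. A quantity that is a
function of finitely many of them is automatically measurable, and independence
from another variable is an elementary statement about it (determined_indep).
The same facts for finitely many increments of B follow by rounding them to
finitely many values (lip_bm, lip_integrate_out). *)

(** * Continuous paths *)

(** On a compact interval continuity is uniform, and a modulus that is common to
all times is what survives taking suprema. *)
Definition ucont {R : realType} (T : R) (f : R -> R) :=
  forall e, 0 < e -> exists2 d, 0 < d &
    forall s t, 0 <= s <= T -> 0 <= t <= T -> `|s - t| < d -> `|f s - f t| < e.

(** A covering of the compact interval turns the moduli of continuity at the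
single points into one modulus. *)
Lemma C0T_ucont {R : realType} (T : R) (f : R -> R) : @C0T R T f <-> ucont T f.
Proof.
split=> [/subspace_continuousP cf e e0|uf].
  have [d d0 H] : exists2 d, 0 < d & forall x, x \in `[0, T] ->
      (forall y, 0 <= y <= T -> `|x - y| < d -> `|f x - f y| < e).
    have /compact_near_coveringP/near_covering_withinP cT :=
      @segment_compact R 0 T.
    have := cT R (0:R)^'+ (fun d x => forall y, 0 <= y <= T -> `|x - y| < d ->
      `|f x - f y| < e).
    have FF : Filter (0:R)^'+ by apply: at_right_proper_filter.
    move=> /(_ FF) [].
      move=> x xT.
      have h2 : 0 < e / 2 by rewrite divr_gt0.
      have /cvgrPdist_lt/(_ _ h2) [r /= r0 rP] := cf x xT.
      have hx := rP x (ballxx _ r0) xT.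
      exists (ball x (r / 2), [set d | 0 < d < r / 2]) => /=.
        split; first by apply: nbhsx_ballx; rewrite divr_gt0.
        exists (r / 2); first by rewrite /= divr_gt0.
        by move=> z /=; rewrite sub0r normrN => + z0; rewrite gtr0_norm// z0.
      move=> -[x' d] [/= xx' /andP[d0 dr] x'T y yT x'y].
      rewrite /ball /= in xx'.
      have h1 : `|f x - f x'| < e / 2.
        apply: (rP x') => //; rewrite /ball /=; apply: lt_le_trans xx' _.
        by lra.
      have h3 : `|f x - f y| < e / 2.
        apply: (rP y); last by rewrite /= in_itv.
        rewrite /ball /= -(subrKA x' x) (splitr r) (le_lt_trans (ler_normD _ _))//.
        rewrite ltrD//; apply: lt_trans x'y dr.
      rewrite -(subrKA (f x)) (splitr e) (le_lt_trans (ler_normD _ _))//.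
      by rewrite ltrD// distrC.
    move=> r /= r0 rP.
    exists (r / 2); first by rewrite divr_gt0.
    move=> x xT; apply: (rP (r / 2)) => //=.
      by rewrite sub0r normrN gtr0_norm ?divr_gt0//; lra.
    by rewrite divr_gt0.
  by exists d => // s t sT tT st; apply: H.
apply/subspace_continuousP => x xT; apply/cvgrPdist_lt => e e0.
have [d d0 dP] := uf e e0.
exists d => //= y; rewrite /ball /= => xy yT.
by apply: dP => //; move: xT yT; rewrite /= ?in_itv.
Qed.

Section Paths.
Context {R : realType}.
Implicit Types (T : R) (f g w x : R -> R).

Lemma ucont_bounded T f : 0 <= T -> ucont T f ->
  exists M, forall t, 0 <= t <= T -> `|f t| <= M.
Proof.
move=> T0 /C0T_ucont cf.
have [a aT fa] := EVT_max T0 cf; have [b bT fb] := EVT_min T0 cf.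
exists (`|f a| + `|f b|) => t tT.
have tT' : t \in `[0, T] by rewrite in_itv.
have := fa _ tT'; have := fb _ tT' => h1 h2.
rewrite ler_norml; have := ler_norm (f a); have := lerNnormlW (lexx `|f b|).
have := normr_ge0 (f a); have := normr_ge0 (f b); lra.
Qed.

Lemma ucontD T f g : ucont T f -> ucont T g -> ucont T (fun t => f t + g t).
Proof.
move=> uf ug e e0; have e2 : 0 < e / 2 by rewrite divr_gt0.
have [d d0 df] := uf _ e2; have [d' d'0 dg] := ug _ e2.
exists (Num.min d d'); first by rewrite lt_min d0.
move=> s t sT tT; rewrite lt_min => /andP[st st'].
rewrite opprD addrACA (splitr e) (le_lt_trans (ler_normD _ _))//.
by rewrite ltrD ?df ?dg.
Qed.

Lemma ucontZ T c f : ucont T f -> ucont T (fun t => c * f t).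
Proof.
move=> uf e e0; have e2 : 0 < e / (`|c| + 1).
  by rewrite divr_gt0// ltr_wpDl.
have [d d0 df] := uf _ e2; exists d => // s t sT tT st.
rewrite -mulrBr normrM (@le_lt_trans _ _ ((`|c| + 1) * `|f s - f t|))//.
  by rewrite ler_wpM2r// lerDl.
by rewrite mulrC -ltr_pdivlMr ?df// ltr_wpDl.
Qed.

(** running_sup, for a single path. *)
Definition rsup w t := sup [set w s | s in `[0, t]].

Definition perturb (lam : R) w t := w t + lam * rsup w t.

Lemma rsup_le w t M : 0 <= t -> (forall s, 0 <= s <= t -> w s <= M) ->
  rsup w t <= M.
Proof.
move=> t0 h; apply: ge_sup; first by exists (w 0), 0; rewrite //= in_itv /= lexx.
by move=> _ [s /= + <-]; rewrite in_itv; exact: h.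
Qed.

Definition bounded_on T w := exists M, forall t, 0 <= t <= T -> `|w t| <= M.

Lemma rsup_ub T w t s : bounded_on T w -> t <= T -> 0 <= s <= t ->
  w s <= rsup w t.
Proof.
move=> [M bM] tT st; apply: ub_le_sup; last by exists s; rewrite //= in_itv.
exists M => _ [u /= + <-]; rewrite in_itv /= => /andP[u0 ut].
by apply: le_trans (ler_norm _) _; apply: bM; rewrite u0 (le_trans ut).
Qed.

Lemma rsup_lip T w w' e t : bounded_on T w -> bounded_on T w' ->
  0 <= t <= T -> (forall s, 0 <= s <= T -> `|w s - w' s| <= e) ->
  `|rsup w t - rsup w' t| <= e.
Proof.
move=> bw bw' /andP[t0 tT] h.
have h' s : 0 <= s <= t -> `|w s - w' s| <= e.
  by move=> /andP[s0 st]; apply: h; rewrite s0 (le_trans st).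
rewrite ler_distl; apply/andP; split.
  rewrite lerBlDr; apply: rsup_le => // s st.
  have := h' _ st; rewrite ler_norml => /andP[h1 h2].
  have := rsup_ub bw tT st; lra.
apply: rsup_le => // s st.
have := h' _ st; rewrite ler_norml => /andP[h1 h2].
have := rsup_ub bw' tT st; lra.
Qed.

(** Between two times s < t the supremum grows by at most the oscillation of w on
[s, t]. *)
Lemma rsup_ucont T w : 0 <= T -> ucont T w -> ucont T (rsup w).
Proof.
move=> T0 uw e e0; have e2 : 0 < e / 2 by rewrite divr_gt0.
have bw := ucont_bounded T0 uw.
have [d d0 dw] := uw _ e2; exists d => //.
suff H s t : 0 <= s <= T -> 0 <= t <= T -> s <= t -> t - s < d ->
    `|rsup w s - rsup w t| < e.
  move=> s t sT tT; have [st|/ltW ts] := leP s t.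
    by rewrite distrC ger0_norm ?subr_ge0//; exact: H.
  by rewrite ger0_norm ?subr_ge0// => h; rewrite distrC; exact: H.
move=> sT tT st tsd; have /andP[s0 sT'] := sT; have /andP[t0 tT'] := tT.
rewrite distrC ger0_norm; last first.
  rewrite subr_ge0; apply: rsup_le => // u /andP[u0 us].
  by apply: (rsup_ub bw) => //; rewrite u0 (le_trans us).
rewrite ltrBlDr; apply: (@le_lt_trans _ _ (e / 2 + rsup w s)); last by lra.
apply: rsup_le => // u /andP[u0 ut].
have [us|su] := leP u s.
  by have := rsup_ub bw sT' (_ : 0 <= u <= s); rewrite u0 us => /(_ isT); lra.
have : `|w u - w s| < e / 2.
  by apply: dw; rewrite ?u0 ?(le_trans ut)// gtr0_norm ?subr_gt0//; lra.
rewrite ltr_norml; have := rsup_ub bw sT' (_ : 0 <= s <= s).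
by rewrite s0 lexx => /(_ isT); lra.
Qed.

Lemma perturb_ucont T lam w : 0 <= T -> ucont T w -> ucont T (perturb lam w).
Proof. by move=> T0 uw; apply: ucontD => //; apply/ucontZ/rsup_ucont. Qed.

(** This continuity transfers the limit of the martingale to the walk. *)
Lemma perturb_lip T lam w w' e t : bounded_on T w -> bounded_on T w' ->
  0 <= t <= T -> (forall s, 0 <= s <= T -> `|w s - w' s| <= e) ->
  `|perturb lam w t - perturb lam w' t| <= (1 + `|lam|) * e.
Proof.
move=> bw bw' tT h; rewrite /perturb opprD addrACA -mulrBr mulrDl mul1r.
apply: le_trans (ler_normD _ _) _; rewrite lerD ?h//.
by rewrite normrM ler_wpM2l// (rsup_lip bw bw').
Qed.

Lemma rsupZ T w c t : bounded_on T w -> 0 <= c -> 0 <= t <= T ->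
  rsup (fun s => c * w s) t = c * rsup w t.
Proof.
move=> bw c0 /andP[t0 tT]; have [M bM] := bw.
have bcw : bounded_on T (fun s => c * w s).
  by exists (c * M) => s sT; rewrite normrM ger0_norm// ler_wpM2l// bM.
apply/eqP; rewrite eq_le; apply/andP; split.
  apply: rsup_le => // s st; rewrite ler_wpM2l//; exact: (rsup_ub bw).
have [->|cn0] := eqVneq c 0.
  rewrite mul0r; apply: le_trans (@rsup_ub T _ t 0 _ _ _); rewrite ?mul0r ?lexx//.
  by exists 0 => s _; rewrite mul0r normr0.
have c0' : 0 < c by rewrite lt_def cn0.
rewrite mulrC -ler_pdivlMr//; apply: rsup_le => // s st.
rewrite ler_pdivlMr// mulrC; exact: (rsup_ub bcw).
Qed.

(** ** Linear interpolation *)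

Implicit Types y : nat -> R.

(** The contribution of one unit interval to an interpolation: a ramp from 0 to 1. *)
Definition clamp (u : R) := Num.min (Num.max u 0) 1.

Lemma clamp_lip (u v : R) : `|clamp u - clamp v| <= `|u - v|.
Proof.
rewrite /clamp ler_norml.
have := ler_norm (u - v); have := ler_norm (v - u); rewrite (distrC v u).
move=> h1 h2; case: (leP u 0) => ?; case: (leP v 0) => ?;
  repeat match goal with |- context [Num.min ?a 1] => case: (leP a 1) => ? end;
  lra.
Qed.

(** As a sum of ramps an interpolation is visibly Lipschitz. *)
Lemma interpolation_clamp y (t : R) N : 0 <= t -> t < N%:R ->
  interpolation y t =
  y 0%N + \sum_(i < N) (y i.+1 - y i) * clamp (t - i%:R).
Proof.
move=> t0 tN; rewrite /interpolation; set k := Num.truncn t.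
have /andP[kt tk] := truncn_itv t0; rewrite -/k in kt tk.
have kN : (k < N)%N by rewrite -(ltr_nat R) (le_lt_trans kt).
rewrite -(big_mkord xpredT (fun i => (y i.+1 - y i) * clamp (t - i%:R))).
rewrite (big_cat_nat (leq0n k) (ltnW kN))//= (big_ltn kN).
have -> : \sum_(k.+1 <= i < N) (y i.+1 - y i) * clamp (t - i%:R) = 0.
  rewrite big_nat_cond big1// => i /andP[/andP[ki _] _].
  rewrite /clamp (_ : Num.max _ _ = 0) ?min_l ?mulr0//.
  apply/max_idPr; rewrite subr_le0; apply: le_trans (ltW tk) _.
  by rewrite ler_nat.
rewrite addr0 addrA [clamp (t - k%:R)](_ : _ = t - k%:R); last first.
  rewrite /clamp (max_idPl _) ?subr_ge0// (min_idPl _)//.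
  by move: tk; rewrite -natr1; lra.
rewrite mulrC; congr (_ + _).
rewrite (@eq_big_nat _ _ _ 0 k _ (fun i => y i.+1 - y i)).
  by rewrite telescope_sumr// addrC subrK.
move=> i /andP[_ ik]; rewrite (_ : clamp _ = 1) ?mulr1//.
have : (i.+1%:R : R) <= k%:R by rewrite ler_nat.
rewrite -natr1 => h; rewrite /clamp (max_idPl _); last by lra.
by rewrite (min_idPr _)//; lra.
Qed.

Lemma interpolation_ucont y (a T : R) : 0 <= a -> 0 <= T ->
  ucont T (fun t => interpolation y (a * t)).
Proof.
move=> a0 T0 e e0.
pose N := (Num.truncn (a * T)).+1.
have N_gt t : 0 <= t <= T -> 0 <= a * t /\ a * t < N%:R.
  move=> /andP[t0 tT]; split; first exact: mulr_ge0.
  have := truncn_itv (mulr_ge0 a0 T0) => /andP[_]; apply: le_lt_trans.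
  by rewrite ler_wpM2l.
pose C := \sum_(i < N) `|y i.+1 - y i|.
have C0 : 0 <= C by apply: sumr_ge0.
exists (e / (C * a + 1)); first by rewrite divr_gt0// ltr_wpDl// mulr_ge0.
move=> s t /N_gt[s0 sN] /N_gt[t0 tN] st.
rewrite (interpolation_clamp y s0 sN) (interpolation_clamp y t0 tN).
rewrite opprD addrACA subrr add0r -sumrB.
apply: (@le_lt_trans _ _ ((C * a + 1) * `|s - t|)); last first.
  by rewrite mulrC -ltr_pdivlMr// ltr_wpDl// mulr_ge0.
apply: le_trans (ler_norm_sum _ _ _) _.
apply: (@le_trans _ _ (C * a * `|s - t|)); last by rewrite ler_wpM2r// lerDl.
rewrite /C -mulrA mulr_suml; apply: ler_sum => i _.
rewrite -mulrBr normrM ler_wpM2l//; apply: le_trans (clamp_lip _ _) _.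
by rewrite opprD addrACA subrr addr0 -mulrBr normrM (ger0_norm a0).
Qed.

(** The path with increments x over the mesh of size T / m, linear in between.
The partial sums stop at m because the interpolation at time T reads the value
with index m.+1. *)
Definition mesh_path T m (x : nat -> R) (t : R) :=
  interpolation (fun i => \sum_(j < minn i m) x j) (m%:R / T * t).

Lemma mesh_path_ucont T m (x : nat -> R) : 0 <= T -> ucont T (mesh_path T m x).
Proof. by move=> T0; apply: interpolation_ucont => //; rewrite divr_ge0. Qed.

Lemma mesh_path_lip T m (x y : nat -> R) e t : 0 < T -> 0 <= t ->
  (forall j, (j < m)%N -> `|x j - y j| <= e) ->
  `|mesh_path T m x t - mesh_path T m y t| <= m%:R * e.
Proof.
move=> T0 t0 h; rewrite /mesh_path /interpolation.
have mt0 : 0 <= m%:R / T * t by rewrite mulr_ge0// divr_ge0// ltW.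
have := truncn_itv mt0; set k := Num.truncn _; set th := m%:R / T * t - k%:R => kt.
have th01 : 0 <= th <= 1 by move: kt; rewrite -natr1 /th; lra.
have H i : `|\sum_(j < minn i m) x j - \sum_(j < minn i m) y j| <= m%:R * e.
  rewrite -sumrB; apply: le_trans (ler_norm_sum _ _ _) _.
  have [->|m0] := eqVneq m 0%N.
    by rewrite minn0 big_ord0 mul0r.
  have e0 : 0 <= e by apply: le_trans (h 0%N _); rewrite ?lt0n.
  apply: (@le_trans _ _ (\sum_(j < minn i m) e)).
    by apply: ler_sum => j _; apply: h; apply: leq_trans (ltn_ord j) (geq_minr _ _).
  by rewrite sumr_const card_ord -[leLHS]mulr_natl ler_wpM2r// ler_nat geq_minr.
move: (H k) (H k.+1); rewrite !ler_norml => /andP[h1 h2] /andP[h3 h4].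
apply/andP; split; nra.
Qed.

(** On each mesh interval both the path and its interpolation are close to the
value of the path at the left end. *)
Lemma mesh_path_approx T m w e : 0 < T -> (0 < m)%N -> w 0 = 0 ->
  (forall i t, (i < m)%N -> i%:R * T / m%:R <= t <= i.+1%:R * T / m%:R ->
     `|w t - w (i%:R * T / m%:R)| <= e) ->
  forall t, 0 <= t <= T ->
  `|w t - mesh_path T m (fun j => w (j.+1%:R * T / m%:R) - w (j%:R * T / m%:R)) t|
     <= 2 * e.
Proof.
move=> T0 m0 w0 h t /andP[t0 tT]; rewrite /mesh_path /interpolation.
have mR : 0 < m%:R :> R by rewrite ltr0n.
have mt0 : 0 <= m%:R / T * t by rewrite mulr_ge0// divr_ge0// ltW.
have := truncn_itv mt0; set k := Num.truncn _; set th := m%:R / T * t - k%:R => kt.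
have th01 : 0 <= th <= 1 by move: kt; rewrite -natr1 /th; lra.
have km : (k <= m)%N.
  rewrite -(ler_nat R); case/andP: kt => kt _; apply: le_trans kt _.
  by rewrite -mulrA ler_piMr ?ler0n// mulrC ler_pdivrMr// mul1r.
have S i : (i <= m)%N -> \sum_(j < minn i m)
   (w (j.+1%:R * T / m%:R) - w (j%:R * T / m%:R)) = w (i%:R * T / m%:R).
  move=> im; rewrite (minn_idPl im).
  rewrite -(big_mkord xpredT (fun j => w (j.+1%:R * T / m%:R) - w (j%:R * T / m%:R))).
  by rewrite telescope_sumr// !mul0r w0 subr0.
have e0 : 0 <= e.
  apply: le_trans (normr_ge0 _) (h 0%N 0 m0 _).
  by rewrite !mul0r lexx/= mul1r divr_ge0// ltW.
rewrite S//.
have [km'|mk] := ltnP k m; last first.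
  have {}mk : k = m by apply/eqP; rewrite eqn_leq km.
  have tT' : t = T.
    apply/eqP; rewrite eq_le tT /=; move/andP: kt => [kt _].
    by move: kt; rewrite mk -mulrA ler_pMr// mulrC ler_pdivlMr// mul1r.
  rewrite (_ : minn k.+1 m = minn k m); last by rewrite mk minnn; exact/minn_idPr.
  rewrite S// subrr mulr0 addr0 mk (_ : m%:R * T / m%:R = T).
    by rewrite tT' subrr normr0 mulr_ge0.
  by rewrite mulrC mulKf ?gt_eqF.
rewrite S//.
have tk : k%:R * T / m%:R <= t <= k.+1%:R * T / m%:R.
  rewrite ler_pdivrMr// ler_pdivlMr//.
  move: kt; have -> : m%:R / T * t = t * m%:R / T by rewrite mulrAC (mulrC t).
  by rewrite ler_pdivlMr// ltr_pdivrMr// => /andP[-> /ltW].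
have := h k t km' tk.
have /(h k _ km') : k%:R * T / m%:R <= k.+1%:R * T / m%:R <= k.+1%:R * T / m%:R.
  by rewrite lexx andbT (le_trans (andP tk).1 (andP tk).2).
rewrite !ler_norml => /andP[h1 h2] /andP[h3 h4].
apply/andP; split; nra.
Qed.

Lemma mesh_path_cvg T w e : 0 < T -> w 0 = 0 -> ucont T w -> 0 < e ->
  exists m0, forall m, (m0 <= m)%N -> forall t, 0 <= t <= T ->
  `|w t - mesh_path T m (fun j => w (j.+1%:R * T / m%:R) - w (j%:R * T / m%:R)) t|
     <= e.
Proof.
move=> T0 w0 uw e0; have e2 : 0 < e / 2 by rewrite divr_gt0.
have [d d0 dw] := uw _ e2.
exists (Num.truncn (T / d)).+1 => m mm t tT.
have m0 : (0 < m)%N by apply: leq_trans mm.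
have mR : 0 < m%:R :> R by rewrite ltr0n.
rewrite [leRHS](_ : e = 2 * (e / 2)); last by rewrite mulrC divfK.
apply: mesh_path_approx => // i s im /andP[si si'].
have Tm : T / m%:R < d.
  rewrite ltr_pdivrMr// mulrC -ltr_pdivrMr//.
  have /andP[_ h] := truncn_itv (ltW (divr_gt0 T0 d0)).
  by apply: lt_le_trans h _; rewrite ler_nat.
have i0 : 0 <= i%:R * T / m%:R by rewrite !mulr_ge0// ?invr_ge0 ltW.
have i1T : i.+1%:R * T / m%:R <= T.
  by rewrite mulrAC ler_piMl ?(ltW T0)// ler_pdivrMr// mul1r ler_nat.
apply/ltW/dw; last first.
- rewrite ger0_norm ?subr_ge0//; apply: le_lt_trans Tm.
  by move: si'; rewrite -natr1 mulrDl mul1r mulrDl; lra.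
- by rewrite i0 /=; lra.
- by apply/andP; split; lra.
Qed.

End Paths.

(** * Expectations of bounded random variables *)

Section Expectation.
Context {R : realType} {d : measure_display} {S : measurableType d}
  (P : probability S R).
Implicit Types Z Y : S -> R.

Definition bm Z := measurable_fun setT Z /\ exists M, forall w, `|Z w| <= M.

Definition Ex Z : R := (\int[P]_w Z w)%R.

Definition integ Z := P.-integrable setT (EFin \o Z).

Lemma bm_integ Z : bm Z -> integ Z.
Proof.
move=> [mZ [M bM]]; apply: (@le_integrable _ _ _ _ _ measurableT _ (EFin \o cst M)).
- exact/measurable_EFinP.
- by move=> w _ /=; rewrite lee_fin (le_trans (bM w))// ler_norm.
- exact: finite_measure_integrable_cst.
Qed.

Lemma bm_cst c : bm (fun=> c).
Proof. by split; [exact: measurable_cst|exists `|c|]. Qed.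

Lemma bmD Z Y : bm Z -> bm Y -> bm (fun w => Z w + Y w).
Proof.
move=> [mZ [M bZ]] [mY [N bY]]; split; first exact: measurable_funD.
by exists (M + N) => w; rewrite (le_trans (ler_normD _ _))// lerD.
Qed.

Lemma bmM Z Y : bm Z -> bm Y -> bm (fun w => Z w * Y w).
Proof.
move=> [mZ [M bZ]] [mY [N bY]]; split; first exact: measurable_funM.
by exists (M * N) => w; rewrite normrM ler_pM.
Qed.

Lemma bmZ c Z : bm Z -> bm (fun w => c * Z w).
Proof. by apply: bmM; exact: bm_cst. Qed.

Lemma bmB Z Y : bm Z -> bm Y -> bm (fun w => Z w - Y w).
Proof.
move=> bZ bY; have := bmD bZ (bmZ (-1) bY).
by under eq_fun do rewrite mulN1r.
Qed.

Lemma bm_sum n (F : nat -> S -> R) : (forall i, (i < n)%N -> bm (F i)) ->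
  bm (fun w => \sum_(i < n) F i w).
Proof.
elim: n => [|n IH] h.
  by under eq_fun do rewrite big_ord0; exact: bm_cst.
under eq_fun do rewrite big_ord_recr /=.
by apply: bmD; [apply: IH => i ni; apply: h; apply: leqW|exact: h].
Qed.

(** Dominated convergence; it also yields the measurability of functionals that
are only known as limits. *)
Lemma bm_cvg (F : nat -> S -> R) Z (M : R) : (forall n, bm (F n)) ->
  (forall n w, `|F n w| <= M) -> (forall w, F n w @[n --> \oo] --> Z w) ->
  bm Z /\ Ex (F n) @[n --> \oo] --> Ex Z.
Proof.
move=> mF bF cF.
have mZ : measurable_fun setT Z.
  by apply: (measurable_fun_cvg (h := F)) => [n|w _]; [case: (mF n)|exact: cF].
have bZ w : `|Z w| <= M.
  have h : `|F x w| @[x --> \oo] --> `|Z w| by apply: cvg_norm; exact: cF.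
  rewrite -(cvg_lim _ h)//.
  by apply: limr_le; [exact: cvgP _ h|exact: nearW].
have bmZ' : bm Z by split => //; exists M.
split => //.
rewrite /Ex /Rintegral.
have := @dominated_convergence _ _ _ P setT measurableT
  (fun n => EFin \o F n) (EFin \o Z) (EFin \o cst M).
move=> /(_ _ _ _ _ _)[].
- by move=> n; apply/measurable_EFinP; case: (mF n).
- exact/measurable_EFinP.
- by apply/aeW => w _; apply/cvg_EFin; [exact: nearW|exact: cF].
- exact: finite_measure_integrable_cst.
- by apply/aeW => w n _ /=; rewrite lee_fin.
move=> _ _ h; apply: fine_cvg; rewrite fineK//.
apply: integrable_fin_num => //; exact: bm_integ.
Qed.

Lemma Ex_cst c : Ex (fun=> c) = c.
Proof.
by rewrite /Ex Rintegral_cst// [X in fine X](probability_setT P) mulr1.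
Qed.

Lemma ExD Z Y : integ Z -> integ Y -> Ex (fun w => Z w + Y w) = Ex Z + Ex Y.
Proof. by move=> bZ bY; rewrite /Ex RintegralD. Qed.

Lemma ExB Z Y : integ Z -> integ Y -> Ex (fun w => Z w - Y w) = Ex Z - Ex Y.
Proof. by move=> bZ bY; rewrite /Ex RintegralB. Qed.

Lemma ExZ c Z : integ Z -> Ex (fun w => c * Z w) = c * Ex Z.
Proof. by move=> bZ; rewrite /Ex RintegralZl. Qed.

Lemma Ex_le Z Y : integ Z -> integ Y -> (forall w, Z w <= Y w) -> Ex Z <= Ex Y.
Proof. by move=> bZ bY h; apply: le_Rintegral => // w _; exact: h. Qed.

Lemma integD Z Y : integ Z -> integ Y -> integ (fun w => Z w + Y w).
Proof. by move=> iZ iY; exact: (integrableD measurableT iZ iY). Qed.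

Lemma integB Z Y : integ Z -> integ Y -> integ (fun w => Z w - Y w).
Proof. by move=> iZ iY; exact: (integrableB measurableT iZ iY). Qed.

Lemma integZ c Z : integ Z -> integ (fun w => c * Z w).
Proof. by move=> iZ; exact: (integrableZl measurableT c iZ). Qed.

Lemma integ_cst c : integ (fun=> c).
Proof. exact/bm_integ/bm_cst. Qed.

Lemma Ex_norm Z Y : integ Z -> integ Y -> (forall w, `|Z w| <= Y w) ->
  `|Ex Z| <= Ex Y.
Proof.
move=> iZ iY h; rewrite ler_norml; apply/andP; split.
  rewrite -mulN1r -ExZ//; apply: Ex_le => //; first exact: integZ.
  by move=> w; rewrite mulN1r lerNl; have := h w; rewrite ler_norml; lra.
by apply: Ex_le => // w; have := h w; rewrite ler_norml; lra.
Qed.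

Lemma Ex_dist Z Y e : integ Z -> integ Y -> (forall w, `|Z w - Y w| <= e) ->
  `|Ex Z - Ex Y| <= e.
Proof.
move=> iZ iY h; rewrite -ExB// -[leRHS]Ex_cst; apply: Ex_norm => //.
  exact: integB.
exact: integ_cst.
Qed.

Lemma Ex_sum n (F : nat -> S -> R) : (forall i, (i < n)%N -> bm (F i)) ->
  Ex (fun w => \sum_(i < n) F i w) = \sum_(i < n) Ex (F i).
Proof.
elim: n => [|n IH] h.
  by under eq_fun do rewrite big_ord0; rewrite Ex_cst big_ord0.
under eq_fun do rewrite big_ord_recr /=.
have h' i : (i < n)%N -> bm (F i) by move=> ni; apply: h; apply: leqW.
rewrite ExD; [|exact/bm_integ/bm_sum|exact/bm_integ/h].
by rewrite IH// big_ord_recr.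
Qed.

Lemma expectation_Ex Z : bm Z -> ('E_P[Z] = (Ex Z)%:E)%E.
Proof.
move=> bZ; rewrite unlock /Ex /Rintegral fineK//.
by apply: integrable_fin_num => //; exact: bm_integ.
Qed.

End Expectation.

(** * Reduction to bounded Lipschitz functionals *)

Section Portmanteau.
Context {R : realType} (T : R) (T0 : 0 < T).
Implicit Types (f g : R -> R) (Phi Psi : (R -> R) -> R).

Definition close (e : R) f g := forall t, 0 <= t <= T -> `|f t - g t| <= e.

Definition bounded_lip (M L : R) Psi :=
  (forall f, ucont T f -> `|Psi f| <= M) /\
  (forall f g e, ucont T f -> ucont T g -> close e f g ->
     `|Psi f - Psi g| <= L * e).

(** The infimal convolution of Phi with k times the uniform distance: for k >= 0,
the largest k-Lipschitz functional below Phi. *)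
Definition inf_conv Phi (k : R) f :=
  inf [set r | exists g e, [/\ ucont T g, close e f g & r = Phi g + k * e]].

Lemma close_ge0 e f g : close e f g -> 0 <= e.
Proof. by move=> h; apply: le_trans (normr_ge0 _) (h 0 _); rewrite lexx ltW. Qed.

Lemma close_refl f : close 0 f f.
Proof. by move=> t _; rewrite subrr normr0. Qed.

Lemma bounded_lip_invariant M L Psi f g : bounded_lip M L Psi ->
  ucont T f -> ucont T g -> close 0 f g -> Psi f = Psi g.
Proof.
move=> [_ lip] uf ug /(lip _ _ _ uf ug); rewrite mulr0 normr_le0 subr_eq0.
by move=> /eqP.
Qed.

(** Functionals are defined on all functions on the line; this is why their
values depend only on the restriction of a path to [0, T]. *)
Lemma continuous_invariant Phi : (forall f, ucont T f -> forall e, 0 < e ->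
    exists2 d, 0 < d & forall g, ucont T g -> close d f g -> `|Phi f - Phi g| < e) ->
  forall f g, ucont T f -> ucont T g -> close 0 f g -> Phi f = Phi g.
Proof.
move=> cPhi f g uf ug fg; apply/eqP; rewrite -subr_eq0 -normr_le0.
apply/ler_addgt0Pr => e e0; rewrite add0r; have [d d0 h] := cPhi f uf e e0.
by apply/ltW/h => // t tT; apply: le_trans (fg t tT) (ltW d0).
Qed.

Section InfConv.
Variables (Phi : (R -> R) -> R) (M : R).
Hypothesis bPhi : forall f, ucont T f -> `|Phi f| <= M.

Lemma inf_conv_has_inf k f : 0 <= k -> ucont T f ->
  has_inf [set r | exists g e, [/\ ucont T g, close e f g & r = Phi g + k * e]].
Proof.
move=> k0 uf; split.
  by exists (Phi f), f, 0; split => //; [exact: close_refl|rewrite mulr0 addr0].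
exists (- M) => _ [g [e [ug /close_ge0 e0 ->]]].
have := bPhi ug; rewrite ler_norml => /andP[h _].
by rewrite (le_trans h)// lerDl mulr_ge0.
Qed.

Lemma inf_conv_le k f g e : 0 <= k -> ucont T f -> ucont T g -> close e f g ->
  inf_conv Phi k f <= Phi g + k * e.
Proof.
move=> k0 uf ug h; apply: ge_inf; last by exists g, e.
by case: (inf_conv_has_inf k0 uf).
Qed.

Lemma inf_conv_ge k f c : 0 <= k -> ucont T f ->
  (forall g e, ucont T g -> close e f g -> c <= Phi g + k * e) ->
  c <= inf_conv Phi k f.
Proof.
move=> k0 uf h; apply: lb_le_inf; first by case: (inf_conv_has_inf k0 uf).
by move=> _ [g [e [ug fg ->]]]; exact: h.
Qed.

Lemma inf_conv_le_self k f : 0 <= k -> ucont T f -> inf_conv Phi k f <= Phi f.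
Proof.
move=> k0 uf; have := inf_conv_le k0 uf uf (@close_refl f).
by rewrite mulr0 addr0.
Qed.

Lemma inf_conv_bounded_lip k : 0 <= k -> bounded_lip M k (inf_conv Phi k).
Proof.
move=> k0; split=> [f uf|].
  rewrite ler_norml; have := bPhi uf; rewrite ler_norml => /andP[_ h].
  rewrite (le_trans (inf_conv_le_self k0 uf) h) andbT.
  apply: inf_conv_ge => // g e ug /close_ge0 e0.
  have := bPhi ug; rewrite ler_norml => /andP[h1 _].
  by rewrite (le_trans h1)// lerDl mulr_ge0.
have H f g e : ucont T f -> ucont T g -> close e f g ->
    inf_conv Phi k f <= inf_conv Phi k g + k * e.
  move=> uf ug fg; rewrite -lerBlDr; apply: inf_conv_ge => // h e' uh gh.
  rewrite lerBlDr -addrA -mulrDr; apply: inf_conv_le => // t tT.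
  rewrite -(subrKA (g t)) (le_trans (ler_normD _ _))// addrC lerD//; first exact: gh.
  exact: fg.
move=> f g e uf ug fg; rewrite ler_norml; apply/andP; split.
  rewrite lerBrDl lerBlDr; apply: H => // t tT; rewrite distrC; exact: fg.
by rewrite lerBlDr addrC; exact: H.
Qed.

(** A path at distance more than d from f costs at least n d, which for large n
exceeds the oscillation 2 M of Phi; so only paths near f compete, and Phi is
continuous at f. *)
Lemma inf_conv_cvg f : ucont T f ->
  (forall e, 0 < e -> exists2 d, 0 < d &
    forall g, ucont T g -> close d f g -> `|Phi f - Phi g| < e) ->
  inf_conv Phi n%:R f @[n --> \oo] --> Phi f.
Proof.
move=> uf cPhi; apply/cvgrPdist_le => e e0.
have [d d0 dP] := cPhi e e0.
near=> n.
have h1 := inf_conv_le_self (ler0n R n) uf.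
rewrite ger0_norm ?subr_ge0// lerBlDr addrC -lerBlDr.
apply: inf_conv_ge => // g a ug fg.
have a0 := close_ge0 fg.
have [ad|da] := leP a d.
  have : `|Phi f - Phi g| < e by apply: dP => // t tT; apply: le_trans (fg t tT) ad.
  rewrite ltr_norml => /andP[h2 h3].
  have := mulr_ge0 (ler0n R n) a0; lra.
have := bPhi uf; have := bPhi ug; rewrite !ler_norml => /andP[h2 h3] /andP[h4 h5].
have : 2 * M <= n%:R * a.
  apply: (@le_trans _ _ (n%:R * d)); last by rewrite ler_wpM2l// ltW.
  by rewrite -ler_pdivrMr//; near: n; exact: nbhs_infty_ger.
lra.
Unshelve. all: by end_near. Qed.

End InfConv.

Lemma bounded_continuousP (Phi : {uniform` `[0, T]%classic -> R} -> R) f e :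
  bounded_continuous_on_C0T Phi -> ucont T f -> 0 < e ->
  exists2 d, 0 < d &
    forall g, ucont T g -> close d f g -> `|Phi f - Phi g| < e.
Proof.
move=> [/subspace_continuousP cPhi _] /C0T_ucont uf e0.
have /cvgrPdist_lt/(_ _ e0) /= h := cPhi f uf.
have [E [entE EP]] := (uniform_nbhs (f : {uniform` `[0, T]%classic -> R}) _).1 h.
have [r r0 rE] : exists2 r : R, 0 < r & forall x y, `|x - y| < r -> E (x, y).
  move: entE; rewrite -entourage_ballE => -[r /= r0 rE]; exists r => // x y xy.
  exact: (rE (x, y)).
exists (r / 2); first by rewrite divr_gt0.
move=> g /C0T_ucont ug fg; apply: EP => //= t; rewrite /= in_itv => tT.
apply: rE; apply: le_lt_trans (fg t tT) _; lra.
Qed.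

Context {d : measure_display} {Omega : measurableType d} (P : probability Omega R)
  {d' : measure_display} {Omega' : measurableType d'} (Q : probability Omega' R).

(** Bounded Lipschitz functionals suffice for weak convergence: those below Phi that
increase to Phi bound the lower limit of the expectations of Phi, and those
below - Phi bound the upper limit. The measurability of Phi along the limit
process comes with the dominated convergence of these minorants. *)
Lemma portmanteau (Y : nat -> R -> Omega -> R) (Z : R -> Omega' -> R) :
  (forall n w, ucont T (fun t => Y n t w)) ->
  (forall w, ucont T (fun t => Z t w)) ->
  (forall n Phi, (exists M, forall f, ucont T f -> `|Phi f| <= M) ->
     (forall f g, ucont T f -> ucont T g -> close 0 f g -> Phi f = Phi g) ->
     bm (fun w => Phi (fun t => Y n t w))) ->
  (forall M L Psi, bounded_lip M L Psi ->
     bm (fun w => Psi (fun t => Z t w)) /\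
     Ex P (fun w => Psi (fun t => Y n t w)) @[n --> \oo] -->
     Ex Q (fun w => Psi (fun t => Z t w))) ->
  weak_cvg_C0T P Q T Y Z.
Proof.
move=> uY uZ mY lipYZ Phi bcPhi.
have [M bM] : exists M, forall f, ucont T f -> `|Phi f| <= M.
  by case: bcPhi => _ [M h]; exists M => f /C0T_ucont; exact: h.
(* One-sided bound for a functional; it is applied to Phi and to -Phi. *)
have key (F : (R -> R) -> R) : (forall f, ucont T f -> `|F f| <= M) ->
    (forall f, ucont T f -> forall e, 0 < e -> exists2 d, 0 < d &
      forall g, ucont T g -> close d f g -> `|F f - F g| < e) ->
    bm (fun w => F (fun t => Z t w)) /\
    forall e, 0 < e -> \forall n \near \oo,
      Ex Q (fun w => F (fun t => Z t w)) - e <= Ex P (fun w => F (fun t => Y n t w)).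
  move=> bF cF; pose G k w := inf_conv F k%:R (fun t => Z t w).
  have [bFZ cG] : bm (fun w => F (fun t => Z t w)) /\
      Ex Q (G k) @[k --> \oo] --> Ex Q (fun w => F (fun t => Z t w)).
    apply: (@bm_cvg _ _ _ _ _ _ M) => [k|k w|w].
    - by have [] := lipYZ _ _ _ (inf_conv_bounded_lip bF (ler0n R k)).
    - by have [h _] := inf_conv_bounded_lip bF (ler0n R k); exact: h.
    - by apply: (inf_conv_cvg bF (uZ w)); exact: cF.
  split => // e e0; have e2 : 0 < e / 2 by rewrite divr_gt0.
  have /cvgrPdist_lt/(_ _ e2) [k _ /(_ k (leqnn k)) /= hk] := cG.
  have lipk := inf_conv_bounded_lip bF (ler0n R k).
  have invk := bounded_lip_invariant lipk.
  have [_ /cvgrPdist_lt/(_ _ e2)] := lipYZ _ _ _ lipk.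
  apply: filterS => n /=.
  have : Ex P (fun w => inf_conv F k%:R (fun t => Y n t w)) <=
         Ex P (fun w => F (fun t => Y n t w)).
    apply: Ex_le.
    - by apply/bm_integ/mY => //; exists M; case: lipk.
    - by apply/bm_integ/mY; [exists M|exact: continuous_invariant cF].
    - by move=> w; apply: (inf_conv_le_self bF).
  move: hk; rewrite /G !ltr_norml; lra.
have [bPZ lo] := key Phi bM (fun f uf e e0 => bounded_continuousP bcPhi uf e0).
have [_ hi] := key (fun f => - Phi f) (fun f uf =>
  eq_ind_r (fun x => x <= M) (bM f uf) (normrN (Phi f))) (fun f uf e e0 =>
  let: ex_intro2 d d0 h := bounded_continuousP bcPhi uf e0 in
  ex_intro2 _ _ d d0 (fun g ug fg =>
   eq_ind_r (fun x => x < e) (h g ug fg) (etrans (congr1 Num.norm (esym (opprD _ _))) (normrN _)))).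
rewrite (expectation_Ex _ bPZ).
have invPhi : forall f g, ucont T f -> ucont T g -> close 0 f g -> Phi f = Phi g.
  by apply: continuous_invariant => f uf e e0; exact: bounded_continuousP bcPhi uf e0.
under eq_cvg => n do rewrite (expectation_Ex _ (mY n Phi (ex_intro _ M bM) invPhi)).
apply/cvg_EFin; first exact: nearW.
apply/cvgrPdist_le => e e0; near=> n.
have h1 : Ex Q (fun w => Phi (fun t => Z t w)) - e <= Ex P (fun w => Phi (fun t => Y n t w)).
  by near: n; exact: lo.
have : Ex Q (fun w => - Phi (fun t => Z t w)) - e <= Ex P (fun w => - Phi (fun t => Y n t w)).
  by near: n; exact: hi.
have N d0 (S : measurableType d0) (P0 : probability S R) (V : S -> R) : bm V ->
    Ex P0 (fun w => - V w) = - Ex P0 V.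
  by move=> /(@bm_integ _ _ _ P0) iV; under eq_fun do rewrite -mulN1r; rewrite ExZ// mulN1r.
rewrite !N//; last by apply: mY => //; exists M.
by rewrite ler_norml; move: h1 => /=; lra.
Unshelve. all: by end_near. Qed.

End Portmanteau.

(** * Functions of finitely many independent integer variables *)

Section Determined.
Context {R : realType} {d : measure_display} {Omega : measurableType d}
  (P : probability Omega R) {I : choiceType} (V : I -> Omega -> int) (N : nat).
Hypothesis mV : forall i, measurable_fun setT (V i).
Hypothesis bV : forall i w, (`|V i w| <= N)%N.

(** Z is a function of the variables V i with i in r. *)
Definition determined {U : Type} (r : seq I) (Z : Omega -> U) :=
  forall w w', {in r, forall i, V i w = V i w'} -> Z w = Z w'.

Lemma determined_sub {U : Type} (r r' : seq I) (Z : Omega -> U) :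
  {subset r <= r'} -> determined r Z -> determined r' Z.
Proof. by move=> rr' dZ w w' h; apply: dZ => i /rr'; exact: h. Qed.

Lemma determined_comp {U W : Type} r (Z : Omega -> U) (h : U -> W) :
  determined r Z -> determined r (fun w => h (Z w)).
Proof. by move=> dZ w w' /dZ ->. Qed.

Lemma measurable_level i z : measurable [set w | V i w = z].
Proof.
by rewrite -[X in measurable X]setTI; exact: (mV i measurableT (Y := [set z])).
Qed.

(** All integers of absolute value at most N. *)
Definition value (k : 'I_(N.*2.+1)) : int := k%:Z - N%:Z.

Lemma sum_values (h : int -> R) z : (`|z| <= N)%N ->
  \sum_k (z == value k)%:R * h (value k) = h z.
Proof.
move=> zN.
have kN : (`|(z + N%:Z)%R| < N.*2.+1)%N by lia.
rewrite (bigD1 (Ordinal kN))//= big1 ?addr0.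
  have -> : value (Ordinal kN) = z by rewrite /value /=; lia.
  by rewrite eqxx mul1r.
move=> k kk; case: eqP => [zk|_]; last by rewrite mul0r.
by case/eqP: kk; apply/val_inj => /=; rewrite zk /value; lia.
Qed.

Definition atom (r : seq I) (a : I -> int) := [set w | {in r, forall i, V i w = a i}].

Lemma atomE r a : atom r a = \bigcap_(i in [set` r]) [set w | V i w = a i].
Proof. by apply/seteqP; split=> w /= h i ir; exact: h. Qed.

Lemma measurable_atom r a : measurable (atom r a).
Proof.
rewrite atomE; apply: fin_bigcap_measurable; first exact: finite_seq.
by move=> i _; exact: measurable_level.
Qed.

(** Sum over the value of one more variable. *)
Lemma atom_split r a i w : i \notin r ->
  \1_(atom r a) w = \sum_k \1_(atom (i :: r) (fun j => if j == i then value k else a j)) w :> R.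
Proof.
move=> ir; rewrite -[LHS](sum_values (fun=> \1_(atom r a) w) (bV i w)).
apply: eq_bigr => k _; rewrite !indicE -natrM mulnb; congr (nat_of_bool _)%:R.
apply/idP/idP.
  move=> /andP[/eqP ik /set_mem h]; apply/mem_set => j.
  by rewrite inE; case: eqP => [->|_] //= jr; exact: h.
move=> /set_mem h; apply/andP; split.
  by have := h i (mem_head _ _); rewrite eqxx => ->.
apply/mem_set => j jr; have := h j; rewrite inE jr orbT => /(_ isT).
by case: eqP jr ir => // -> ->.
Qed.

(** After splitting over the values of all the variables in r, Z is constant on
each piece. *)
Lemma determined_bm r (Z : Omega -> R) : determined r Z -> bm Z.
Proof.
suff H s q a (W : Omega -> R) : uniq (s ++ q) -> determined (s ++ q) W ->
    bm (fun w => W w * \1_(atom q a) w).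
  move=> dZ; have := H (undup r) [::] (fun=> 0) Z.
  rewrite cats0 undup_uniq => /(_ isT).
  have dZ' : determined (undup r) Z.
    by apply: determined_sub dZ => i; rewrite mem_undup.
  move=> /(_ dZ'); have -> : atom [::] (fun=> 0) = setT by apply/seteqP; split.
  by under eq_fun do rewrite indicT mulr1.
elim: s q a W => [|i s IH] q a W.
  move=> _ dW; have [[w0 h0]|h0] := pselect (exists w, atom q a w).
    have -> : (fun w => W w * \1_(atom q a) w) = (fun w => W w0 * \1_(atom q a) w).
      apply/funext => w; rewrite indicE; case: (boolP (w \in _)) => h; last by rewrite !mulr0.
      by congr (_ * _); apply: dW => j jq; rewrite (h0 j jq); apply: set_mem h _ _.
    apply: bmM; first exact: bm_cst.
    split; first exact/measurable_indic/measurable_atom.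
    by exists 1 => w; rewrite indicE ger0_norm// lern1 leq_b1.
  have -> : (fun w => W w * \1_(atom q a) w) = (fun w => 0).
    apply/funext => w; rewrite indicE memNset ?mulr0// => h; apply: h0.
    by exists w.
  exact: bm_cst.
move=> /= /andP[isq usq] dW.
have iq : i \notin q by move: isq; rewrite mem_cat negb_or => /andP[].
under eq_fun do rewrite (atom_split _ _ iq) mulr_sumr.
have := @bm_sum _ _ _ N.*2.+1 (fun k w =>
   W w * \1_(atom (i :: q) (fun j => if j == i then k%:Z - N%:Z else a j)) w).
apply => k _; apply: IH; first by rewrite (perm_uniq (_ : perm_eq _ (i :: s ++ q)))
  /= ?isq// perm_catC /= perm_cons perm_catC.
by apply: determined_sub dW => j; rewrite !mem_cat !inE mem_cat orbCA.
Qed.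

Hypothesis indepV : mutually_independent P V.

Lemma atom_indep q a i z : i \notin q ->
  P (atom q a `&` [set w | V i w = z]) = (P (atom q a) * P [set w | V i w = z])%E.
Proof.
move=> iq; pose A j : set int := [set if j == i then z else a j].
have mA j : measurable (A j) by [].
have := indepV [fset j in q]%fset mA; have := indepV [fset j in i :: q]%fset mA.
rewrite (big_fsetD1 i) /=; last by rewrite !inE eqxx.
have -> : ([fset j in i :: q] `\ i = [fset j in q])%fset.
  apply/fsetP => j; rewrite !inE; case: (j =P i) => //= ->.
  by rewrite (negbTE iq).
have -> : V i @^-1` A i = [set w | V i w = z].
  by apply/seteqP; split=> w; rewrite /A /= eqxx.
have -> : \bigcap_(j in [set` [fset j in q]%fset]) V j @^-1` A j = atom q a.
  apply/seteqP; split=> w h j.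
    move=> jq; have := h j; rewrite /= !inE jq => /(_ isT); rewrite /A /=.
    by case: eqP jq iq => // -> ->.
  rewrite /= !inE => jq; rewrite /A /=; case: eqP jq iq => [-> ->//|_ jq _].
  exact: h.
have -> : \bigcap_(j in [set` [fset j in i :: q]%fset]) V j @^-1` A j =
    atom q a `&` [set w | V i w = z].
  apply/seteqP; split=> w h.
    split=> [j jq|].
      have := h j; rewrite /= !inE jq orbT => /(_ isT); rewrite /A /=.
      by case: eqP jq iq => // -> ->.
    by have := h i; rewrite /= !inE eqxx => /(_ isT); rewrite /A /= eqxx.
  move=> j; rewrite /= !inE /A /=; case: eqP => [-> _|_ /= jq].
    by case: h.
  by case: h => + _; apply.
by move=> -> ->; rewrite muleC.
Qed.

Lemma Ex_indic A : measurable A -> Ex P \1_A = fine (P A).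
Proof. by move=> mA; rewrite /Ex /Rintegral integral_indic// setIT. Qed.

(** After the same splitting as for determined_bm the claim is the independence of
two events. *)
Lemma determined_level_indep r i z (Z : Omega -> R) : determined r Z -> i \notin r ->
  Ex P (fun w => Z w * (V i w == z)%:R) = Ex P Z * Ex P (fun w => (V i w == z)%:R).
Proof.
pose E := [set w | V i w = z].
have eE w : (V i w == z)%:R = \1_E w :> R.
  by rewrite indicE; congr (nat_of_bool _)%:R; apply/eqP/idP; rewrite inE.
have mE : measurable E by exact: measurable_level.
have bmE : bm (\1_E : Omega -> R).
  split; first exact/measurable_indic.
  by exists 1 => w; rewrite indicE ger0_norm// lern1 leq_b1.
under [in LHS]eq_fun do rewrite eE; under [X in _ * Ex P X]eq_fun do rewrite eE.
suff H s q a (W : Omega -> R) : uniq (s ++ q) -> determined (s ++ q) W -> i \notin s ++ q ->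
    Ex P (fun w => W w * \1_(atom q a) w * \1_E w) =
    Ex P (fun w => W w * \1_(atom q a) w) * Ex P \1_E.
  move=> dZ ir; have := H (undup r) [::] (fun=> 0) Z.
  rewrite cats0 undup_uniq mem_undup ir => /(_ isT).
  have dZ' : determined (undup r) Z.
    by apply: determined_sub dZ => j; rewrite mem_undup.
  move=> /(_ dZ' isT); have -> : atom [::] (fun=> 0) = setT by apply/seteqP; split.
  under eq_fun do rewrite indicT mulr1.
  by under [X in _ = Ex P X * _]eq_fun do rewrite indicT mulr1.
have bmA q' a' : bm (\1_(atom q' a') : Omega -> R).
  split; first exact/measurable_indic/measurable_atom.
  by exists 1 => w; rewrite indicE ger0_norm// lern1 leq_b1.
elim: s q a W => [|j s IH] q a W.
  move=> _ dW iq; have [[w0 h0]|h0] := pselect (exists w, atom q a w).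
    have E1 : (fun w => W w * \1_(atom q a) w) = (fun w => W w0 * \1_(atom q a) w).
      apply/funext => w; rewrite indicE; case: (boolP (w \in _)) => h; last by rewrite !mulr0.
      by congr (_ * _); apply: dW => j jq; rewrite (h0 j jq); apply: set_mem h _ _.
    have -> : (fun w => W w * \1_(atom q a) w * \1_E w) =
        (fun w => W w0 * \1_(atom q a `&` E) w).
      apply/funext => w; rewrite [W w * _](congr1 (fun f => f w) E1) -mulrA.
      by rewrite indicI.
    have mqE : measurable (atom q a `&` E).
      by apply: measurableI => //; exact: measurable_atom.
    have bqE : bm (\1_(atom q a `&` E) : Omega -> R) by rewrite indicI; exact: bmM.
    rewrite E1 (ExZ _ (bm_integ P (bmA q a))) (ExZ _ (bm_integ P bqE)).
    rewrite !Ex_indic//; last exact: measurable_atom.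
    by rewrite atom_indep// fineM ?mulrA//; apply: fin_num_measure => //;
      exact: measurable_atom.
  have A0 w : \1_(atom q a) w = 0 :> R.
    by rewrite indicE memNset// => h; apply: h0; exists w.
  under eq_fun do rewrite A0 mulr0 mul0r.
  under [X in _ = Ex P X * _]eq_fun do rewrite A0 mulr0.
  by rewrite Ex_cst mul0r.
move=> /= /andP[jsq usq] dW ijsq.
have jq : j \notin q by move: jsq; rewrite mem_cat negb_or => /andP[].
pose b k : I -> int := fun l => if l == j then k%:Z - N%:Z else a l.
have IH' k : Ex P (fun w => W w * \1_(atom (j :: q) (b k)) w * \1_E w) =
    Ex P (fun w => W w * \1_(atom (j :: q) (b k)) w) * Ex P \1_E.
  apply: IH.
  - by rewrite (perm_uniq (_ : perm_eq _ (j :: s ++ q)))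
      /= ?jsq// perm_catC /= perm_cons perm_catC.
  - by apply: determined_sub dW => l; rewrite !mem_cat !inE mem_cat orbCA.
  - by move: ijsq; rewrite !mem_cat !inE mem_cat orbCA.
have bW k : bm (fun w => W w * \1_(atom (j :: q) (b k)) w).
  by apply: bmM => //; exact: determined_bm dW.
under eq_fun do rewrite (atom_split _ _ jq) mulr_sumr mulr_suml.
under [X in _ = Ex P X * _]eq_fun do rewrite (atom_split _ _ jq) mulr_sumr.
rewrite (Ex_sum _ (F := fun k w => W w * \1_(atom (j :: q) (b k)) w))//.
rewrite (Ex_sum _ (F := fun k w => W w * \1_(atom (j :: q) (b k)) w * \1_E w)).
  by rewrite mulr_suml; apply: eq_bigr => k _; exact: IH'.
by move=> k _; exact: bmM.
Qed.

(** Fubini for the variable V i, which is independent of those that determine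
the dependence of F on its first argument. *)
Lemma determined_indep r i (F : Omega -> int -> R) :
  (forall z, determined r (F^~ z)) -> i \notin r ->
  Ex P (fun w => F w (V i w)) = Ex P (fun w => Ex P (fun w' => F w (V i w'))).
Proof.
move=> dF ir.
have bL z : bm (fun w => (V i w == z)%:R : R).
  by apply: (@determined_bm [:: i]) => w w' h; rewrite (h i (mem_head _ _)).
have E (u w : Omega) : F u (V i w) = \sum_(k < N.*2.+1)
    F u (k%:Z - N%:Z) * (V i w == k%:Z - N%:Z)%:R.
  rewrite -(sum_values (F u) (bV i w)); apply: eq_bigr => k _.
  by rewrite mulrC.
under eq_fun do rewrite E.
have E' w : Ex P (fun w' => F w (V i w')) = \sum_(k < N.*2.+1)
    F w (k%:Z - N%:Z) * Ex P (fun x => (V i x == k%:Z - N%:Z)%:R).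
  under eq_fun do rewrite E.
  rewrite (Ex_sum _ (F := fun k w' => F w (k%:Z - N%:Z) * (V i w' == k%:Z - N%:Z)%:R)).
    by apply: eq_bigr => k _; rewrite ExZ//; exact: bm_integ.
  by move=> k _; apply: bmZ.
under [in RHS]eq_fun do rewrite E'.
rewrite (Ex_sum _ (F := fun k w => F w (k%:Z - N%:Z) * (V i w == k%:Z - N%:Z)%:R)); last first.
  by move=> k _; apply: bmM => //; exact: determined_bm (dF _).
rewrite (Ex_sum _ (F := fun k w => F w (k%:Z - N%:Z) * Ex P (fun x => (V i x == k%:Z - N%:Z)%:R))); last first.
  by move=> k _; apply: bmM; [exact: determined_bm (dF _)|exact: bm_cst].
apply: eq_bigr => k _; rewrite (determined_level_indep _ (dF _) ir).
under [in RHS]eq_fun do rewrite mulrC.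
by rewrite ExZ 1?mulrC//; apply/bm_integ/(determined_bm (dF _)).
Qed.

End Determined.

(** * Functions of finitely many independent real variables *)

Section RealVariables.
Context {R : realType}.

Definition upd {U : Type} (u : nat -> U) (j : nat) (y : U) (i : nat) : U :=
  if i == j then y else u i.

(** Phi depends on the first n coordinates only, and is Lipschitz in them for the
maximum norm. *)
Definition lip_on n (L : R) (Phi : (nat -> R) -> R) := forall u v e,
  0 <= e -> (forall i, (i < n)%N -> `|u i - v i| <= e) -> `|Phi u - Phi v| <= L * e.

(** The integer part of K.+1 times y, replaced by 0 when it is too large, so
that only finitely many values occur. *)
Definition quantize (K : nat) (y : R) : int :=
  let z := Num.floor (K.+1%:R * y) in if (`|z| <= K.+1 ^ 2)%N then z else 0.

Lemma quantize_bound K y : (`|quantize K y| <= K.+1 ^ 2)%N.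
Proof. by rewrite /quantize; case: ifP. Qed.

Lemma measurable_quantize K (A : set int) : measurable (quantize K @^-1` A).
Proof.
have -> : quantize K @^-1` A = \bigcup_(z in [set z : int | A
    (if (`|z| <= K.+1 ^ 2)%N then z else 0)])
    ((fun y => K.+1%:R * y) @^-1` `[z%:~R, (z + 1)%:~R[).
  apply/seteqP; split => y /=.
    move=> h; exists (Num.floor (K.+1%:R * y)) => //=.
    by rewrite in_itv /= Num.Theory.floor_itv.
  move=> [z /= Az]; rewrite in_itv /= => /Num.Theory.floor_def zy.
  by rewrite /quantize zy.
rewrite bigcup_mkcond; apply: countable_bigcupT_measurable => // z.
case: ifP => // _.
rewrite -[X in measurable X]setTI.
have : measurable_fun setT (fun y : R => K.+1%:R * y).
  by apply: measurable_funM => //; exact: measurable_cst.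
by apply => //; exact: measurable_itv.
Qed.

Lemma quantize_cvg (y : R) : (quantize K y)%:~R / K.+1%:R @[K --> \oo] --> y.
Proof.
apply/cvgrPdist_le => e e0; near=> K.
have K0 : 0 < K.+1%:R :> R by rewrite ltr0n.
have /andP[f1 f2] := Num.Theory.floor_itv (K.+1%:R * y).
have yK : `|y| + 1 <= K.+1%:R.
  rewrite -natr1 lerD2r; near: K; exact: nbhs_infty_ger.
have K1 : 1 <= K.+1%:R :> R by rewrite ler1n.
have -> : quantize K y = Num.floor (K.+1%:R * y).
  rewrite /quantize; case: ifP => // /negbT/negP; case.
  rewrite -(ler_nat R) natrX natr_absz intr_norm.
  have : `|K.+1%:R * y| <= K.+1%:R * `|y| by rewrite normrM ger0_norm// ltW.
  rewrite !ler_norml => /andP[h1 h2].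
  have := normr_ge0 y; move: f1 f2; rewrite intrD => f1 f2 y0.
  by apply/andP; split; nra.
have eK : e^-1 <= K.+1%:R.
  by rewrite (@le_trans _ _ K%:R) ?ler_nat//; near: K; exact: nbhs_infty_ger.
rewrite ler_norml; apply/andP; split.
  rewrite lerBrDl lerBlDr ler_pdivrMr//; nra.
rewrite lerBlDl -lerBlDr ler_pdivlMr//.
have : 1 <= e * K.+1%:R by rewrite -ler_pdivrMl// mulr1.
by move: f2; rewrite intrD; nra.
Unshelve. all: by end_near. Qed.

Context {d : measure_display} {Omega : measurableType d} (P : probability Omega R).

Section Fixed.
Variables (n : nat) (x : nat -> Omega -> R) (Phi : (nat -> R) -> R) (L M : R).
Hypothesis mx : forall i, (i < n)%N -> measurable_fun setT (x i).
Hypothesis lipPhi : lip_on n L Phi.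
Hypothesis bPhi : forall u, `|Phi u| <= M.

Let V K (i : 'I_n) w := quantize K (x i w).
Let a K w (i : nat) : R := if insub i is Some i' then (V K i' w)%:~R / K.+1%:R else 0.

Let mV K (i : 'I_n) : measurable_fun setT (V K i).
Proof.
move=> _ A _; rewrite setTI /V (_ : _ @^-1` _ = x i @^-1` (quantize K @^-1` A))//.
rewrite -[X in measurable X]setTI; apply: (mx (ltn_ord i)) => //.
exact: measurable_quantize.
Qed.

Let bV K (i : 'I_n) w : (`|V K i w| <= K.+1 ^ 2)%N.
Proof. exact: quantize_bound. Qed.

Let lip_cvg (u : nat -> nat -> R) v :
  (forall i, (i < n)%N -> u K i @[K --> \oo] --> v i) ->
  Phi (u K) @[K --> \oo] --> Phi v.
Proof.
move=> h; apply/cvgrPdist_le => e e0.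
have e1 : 0 < e / (`|L| + 1) by rewrite divr_gt0// ltr_wpDl.
have H : \forall K \near \oo, forall i : 'I_n, `|v i - u K i| <= e / (`|L| + 1).
  by apply: filter_forall => i; have /cvgrPdist_le/(_ _ e1) := h i (ltn_ord i).
near=> K; apply: (@le_trans _ _ (L * (e / (`|L| + 1)))).
  apply: lipPhi; first exact: ltW.
  by move=> i ni; apply: (near H K _ (Ordinal ni)).
rewrite mulrA ler_pdivrMr ?ltr_wpDl// mulrC ler_wpM2l ?(ltW e0)//.
by rewrite (le_trans (ler_norm _))// lerDl.
Unshelve. all: by end_near. Qed.

Let a_cvg w i : (i < n)%N -> a K w i @[K --> \oo] --> x i w.
Proof. by move=> ni; rewrite /a insubT; exact: quantize_cvg. Qed.

Let det_a K (r : seq 'I_n) i : (forall ni : (i < n)%N, Ordinal ni \in r) ->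
  determined (V K) r (fun w => a K w i).
Proof.
move=> ir w w' h; rewrite /a; case: insubP => // i' ni ii; rewrite h//.
by rewrite (_ : i' = Ordinal ni)//; exact/val_inj.
Qed.

(** After quantization the coordinates take finitely many values, and Phi is
continuous in them. *)
Lemma lip_bm : bm (fun w => Phi (x^~ w)).
Proof.
have [] // := @bm_cvg _ _ _ P (fun K w => Phi (a K w)) (fun w => Phi (x^~ w)) M.
- move=> K; apply: (determined_bm (mV K) (bV K) (r := enum 'I_n)) => w w' h.
  congr Phi; apply/funext => i; apply: det_a h => ni; exact: mem_enum.
- by move=> w; apply: lip_cvg => i ni; exact: a_cvg.
Qed.

Hypothesis indepx : mutually_independent P (fun i : 'I_n => x i).

Let indepV K : mutually_independent P (V K).
Proof.
move=> J A mA; have := indepx J (A := fun i => quantize K @^-1` A i).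
by apply => i; exact: measurable_quantize.
Qed.

(** Fubini for the last of n independent real variables. Quantized variables are
independent and take finitely many values, so that determined_indep applies to
them; both sides pass to the limit. *)
Lemma lip_integrate_out j : n = j.+1 ->
  bm (fun w => Ex P (fun w' => Phi (upd (x^~ w) j (x j w')))) /\
  Ex P (fun w => Phi (x^~ w)) =
  Ex P (fun w => Ex P (fun w' => Phi (upd (x^~ w) j (x j w')))).
Proof.
move=> nj; have jn : (j < n)%N by rewrite nj.
pose r := [seq i <- enum 'I_n | i != Ordinal jn].
have jr : Ordinal jn \notin r by rewrite mem_filter eqxx.
have ir (i : 'I_n) : i != Ordinal jn -> i \in r by rewrite mem_filter mem_enum andbT.
pose F K w z := Phi (upd (a K w) j (z%:~R / K.+1%:R)).
have detF K z : determined (V K) r (F K ^~ z).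
  move=> w w' h; congr Phi; apply/funext => i; rewrite /upd; case: eqP => // ij.
  by apply: det_a h => ni; apply: ir; apply/eqP => -[].
have FV K u w : F K u (V K (Ordinal jn) w) = Phi (upd (a K u) j (a K w j)).
  by rewrite /F {3}/a insubT.
have upda K w : upd (a K w) j (a K w j) = a K w.
  by apply/funext => i; rewrite /upd; case: eqP => [->|].
have key K : Ex P (fun w => Phi (a K w)) =
    Ex P (fun w => Ex P (fun w' => Phi (upd (a K w) j (a K w' j)))).
  have := determined_indep (mV K) (bV K) (@indepV K) (detF K) jr.
  under eq_fun do rewrite FV upda.
  by under [in RHS]eq_fun do under eq_fun do rewrite FV.
have upd_cvg w w' i : (i < n)%N ->
    upd (a K w) j (a K w' j) i @[K --> \oo] --> upd (x^~ w) j (x j w') i.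
  by move=> ni; rewrite /upd; case: eqP => _; exact: a_cvg.
have bma K : bm (fun w => Phi (a K w)).
  apply: (determined_bm (mV K) (bV K) (r := enum 'I_n)) => w w' h.
  congr Phi; apply/funext => i; apply: det_a h => ni; exact: mem_enum.
have bmu K u : bm (fun w' => Phi (upd (a K u) j (a K w' j))).
  apply: (determined_bm (mV K) (bV K) (r := enum 'I_n)) => w w' h.
  congr Phi; apply/funext => i; rewrite /upd; case: eqP => // _.
  by apply: det_a h => ni; exact: mem_enum.
have [_ lhs] : bm (fun w => Phi (x^~ w)) /\
    Ex P (fun w => Phi (a K w)) @[K --> \oo] --> Ex P (fun w => Phi (x^~ w)).
  apply: (@bm_cvg _ _ _ P _ _ M) => // w; apply: lip_cvg => i ni; exact: a_cvg.
have [bmrhs rhs] : bm (fun w => Ex P (fun w' => Phi (upd (x^~ w) j (x j w')))) /\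
    Ex P (fun w => Ex P (fun w' => Phi (upd (a K w) j (a K w' j)))) @[K --> \oo] -->
    Ex P (fun w => Ex P (fun w' => Phi (upd (x^~ w) j (x j w')))).
  apply: (@bm_cvg _ _ _ P _ _ M) => [K|K w|w].
  - apply: (determined_bm (mV K) (bV K) (r := r)) => w w' h.
    congr (Ex P _); apply/funext => u; rewrite -!FV; exact: detF.
  - rewrite -[leRHS](Ex_cst P); apply: Ex_norm => //; [exact: bm_integ|exact: integ_cst].
  - have [] // := @bm_cvg _ _ _ P (fun K w' => Phi (upd (a K w) j (a K w' j)))
      (fun w' => Phi (upd (x^~ w) j (x j w'))) M.
    by move=> w'; apply: lip_cvg => i ni; exact: upd_cvg.
split => //; move: lhs; rewrite (funext key : (fun K => Ex P (fun w => Phi (a K w))) = _).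
by move=> lhs; exact: cvg_unique lhs rhs.
Qed.

End Fixed.
End RealVariables.

(** * Moments of Gaussian variables *)

Section MeanValue.
Context {R : realType}.

Lemma mean_value_bound (f df : R -> R) (a y C : R) :
  (forall z : R, is_derive z 1 f (df z)) ->
  (forall z, `|z - a| <= `|y| -> `|df z| <= C) ->
  `|f (a + y) - f a| <= C * `|y|.
Proof.
move=> fd dC; have cf : continuous f.
  by move=> z; apply/differentiable_continuous/derivable1_diffP; case: (fd z).
have key u v : u <= v -> (forall z, u <= z <= v -> `|df z| <= C) ->
    `|f v - f u| <= C * (v - u).
  move=> uv h; have [|c cuv ->] := MVT_segment uv (fun z _ => fd z).
    exact: continuous_subspaceT.
  rewrite normrM [X in _ * X]ger0_norm ?subr_ge0//.
  by rewrite ler_wpM2r ?subr_ge0// h//; move: cuv; rewrite in_itv.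
have [y0|y0] := leP 0 y.
  have := key a (a + y); rewrite lerDl addrAC subrr add0r (ger0_norm y0); apply => //.
  by move=> z /andP[az zay]; apply: dC; rewrite (ger0_norm y0) ger0_norm ?subr_ge0// lerBlDl.
have := key (a + y) a; rewrite gerDl distrC opprD addrA subrr sub0r.
rewrite (ltr0_norm y0); apply; first exact: ltW.
move=> z /andP[az zay]; apply: dC.
by rewrite (ltr0_norm y0) distrC ger0_norm ?subr_ge0//; lra.
Qed.

Lemma expR_norm_le (z y : R) : `|z| <= `|y| -> expR z <= expR `|y|.
Proof. by move=> h; rewrite ler_expR (le_trans (ler_norm z)). Qed.

Lemma expR_taylor0 (y : R) : `|expR y - 1| <= `|y| * expR `|y|.
Proof.
have := @mean_value_bound expR expR 0 y (expR `|y|).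
rewrite add0r expR0 mulrC; apply=> z.
rewrite subr0 => zy; rewrite ger0_norm ?expR_ge0//; exact: expR_norm_le.
Qed.

Lemma expR_taylor1 (y : R) : `|expR y - 1 - y| <= `|y| ^+ 2 * expR `|y|.
Proof.
have := @mean_value_bound (fun z => expR z - 1 - z) (fun z => expR z - 1) 0 y
  (`|y| * expR `|y|).
rewrite add0r expR0 subrr subr0 => H.
rewrite -[X in `|X|]subr0 expr2 -mulrA mulrC; apply: H => z.
  by apply: is_derive_eq; rewrite subr0.
rewrite subr0 => zy; apply: le_trans (expR_taylor0 z) _.
by rewrite ler_pM// ?expR_ge0// ler_expR.
Qed.

Lemma expR_taylor2 (y : R) :
  `|expR y - 1 - y - y ^+ 2 / 2| <= `|y| ^+ 3 * expR `|y|.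
Proof.
have := @mean_value_bound (fun z => expR z - 1 - z - z ^+ 2 / 2)
  (fun z => expR z - 1 - z) 0 y (`|y| ^+ 2 * expR `|y|).
rewrite add0r expR0 subrr expr0n /= mul0r !subr0 => H.
rewrite (_ : `|y| ^+ 3 * _ = `|y| ^+ 2 * expR `|y| * `|y|); last by rewrite exprSr mulrAC.
apply: H => z.
  by apply: is_derive_eq; rewrite /GRing.scale /=; field.
rewrite subr0 => zy; apply: le_trans (expR_taylor1 z) _.
by rewrite ler_pM// ?expR_ge0// ?ler_expR// ?exprn_ge0// lerXn2r.
Qed.

(** The cube of x <= exp x at x = |y| / 3. *)
Lemma cube_le_expR (y : R) : `|y| ^+ 3 <= 27 * (expR y + expR (- y)).
Proof.
have H : expR `|y| <= expR y + expR (- y).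
  by case: (ger0P y) => _; rewrite ?lerDl ?lerDr expR_ge0.
apply: (@le_trans _ _ (27 * expR `|y|)); last by rewrite ler_wpM2l.
have -> : expR `|y| = expR (`|y| / 3) ^+ 3.
  by rewrite -expRM_natl; congr expR; field.
have h : `|y| / 3 <= expR (`|y| / 3) by apply: le_trans (expR_ge1Dx _); rewrite lerDr.
have := lerXn2r 3 (_ : `|y| / 3 \in Num.nneg) (_ : expR (`|y| / 3) \in Num.nneg) h.
rewrite !nnegrE expR_ge0 divr_ge0// => /(_ isT isT) h3.
by rewrite (_ : `|y| ^+ 3 = 27 * (`|y| / 3) ^+ 3) ?ler_wpM2l//; field.
Qed.

End MeanValue.

Lemma measurable_expR_scale {R : realType} {d : measure_display}
  {S : measurableType d} (f : S -> R) (a : R) :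
  measurable_fun setT f -> measurable_fun setT (fun x => expR (a * f x)).
Proof.
move=> mf; apply: measurableT_comp => //.
exact: (measurable_funM (measurable_cst a) mf).
Qed.

Section NormalMgf.
Context {R : realType}.
Local Notation mu := (@lebesgue_measure R).

(** The Gaussian law is defined by its density; the Radon-Nikodym derivative agrees
with it almost everywhere. *)
Lemma integral_normal_prob (s : R) (f : R -> \bar R) :
  measurable_fun setT f -> (forall x, (0 <= f x)%E) ->
  (\int[normal_prob 0 s]_x f x = \int[mu]_x (f x * (normal_pdf 0 s x)%:E))%E.
Proof.
move=> mf f0.
have dom : normal_prob 0 s `<< mu by exact: normal_prob_dominates.
rewrite -(Radon_Nikodym_SigmaFinite.change_of_variables dom)//.
have int := Radon_Nikodym_SigmaFinite.f_integrable dom.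
apply: ae_eq_integral => //.
- by apply: emeasurable_funM => //; exact: measurable_int int.
- apply: emeasurable_funM => //; apply/measurable_EFinP; exact: measurable_normal_pdf.
- apply: ae_eqe_mul2l; apply: integral_ae_eq => //=.
    by apply/measurable_EFinP; exact: measurable_normal_pdf.
  by move=> E _ mE; rewrite -(Radon_Nikodym_SigmaFinite.f_integral dom).
Qed.

(** Multiplying the centered density by exp (a x) shifts its mean. *)
Lemma normal_mgf (s a : R) : 0 < s ->
  (\int[normal_prob 0 s]_x (expR (a * x))%:E = (expR (a ^+ 2 * s ^+ 2 / 2))%:E)%E.
Proof.
move=> s0; rewrite integral_normal_prob; last 2 first.
- by apply/measurable_EFinP; exact: measurable_expR_scale.
- by move=> x; rewrite lee_fin expR_ge0.
have E x : expR (a * x) * normal_pdf 0 s x =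
    expR (a ^+ 2 * s ^+ 2 / 2) * normal_pdf (a * s ^+ 2) s x.
  rewrite !normal_pdfE ?gt_eqF// /normal_fun mulrCA [RHS]mulrCA -!expRD.
  congr (_ * expR _); rewrite !mulr2n; field.
  by rewrite gt_eqF ?addr_gt0 ?exprn_gt0.
under eq_integral do rewrite -EFinM E EFinM.
rewrite integralZl//; last exact: integrable_normal_pdf.
by rewrite integral_normal_pdf ?mule1// gt_eqF.
Qed.

End NormalMgf.

Section GaussianVariable.
Context {R : realType} {d : measure_display} {Omega : measurableType d}
  (P : probability Omega R) (G : {RV P >-> R}) (s : R).
Hypothesis s0 : 0 < s.
Hypothesis lawG : forall A, measurable A -> pushforward P G A = normal_prob 0 s A.

Let mG : measurable_fun setT (G : Omega -> R).
Proof. exact: measurable_funP. Qed.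

(* The real line carries two convertible copies of the Borel sets, one of them
   the domain of the Gaussian law; the identity map connects them. *)
Let idTR : measurableTypeR R -> R := idfun.

#[local] HB.instance Definition _ :=
  @isMeasurableFun.Build _ _ _ _ idTR (@measurable_id _ _ setT).

Lemma gaussian_mgf a : integ P (fun w => expR (a * G w)) /\
  Ex P (fun w => expR (a * G w)) = expR (a ^+ 2 * s ^+ 2 / 2).
Proof.
have H : (\int[P]_w (expR (a * G w))%:E = (expR (a ^+ 2 * s ^+ 2 / 2))%:E)%E.
  rewrite -normal_mgf//.
  rewrite (_ : (\int[normal_prob 0 s]_x _)%E =
    \int[distribution P G]_x (expR (a * x))%:E)%E; last first.
    rewrite -[LHS](@ge0_integral_pushforward _ _ (measurableTypeR R) R R idTR (@measurable_id _ _ setT) (normal_prob 0 s) setT (fun x => (expR (a * x))%:E))//.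
      by apply: eq_measure_integral => A mA _; exact/esym/lawG.
    by apply/measurable_EFinP; exact: measurable_expR_scale.
  rewrite ge0_integral_distribution//.
  by apply/measurable_EFinP; exact: measurable_expR_scale.
split; last by rewrite /Ex /Rintegral H.
apply/integrableP; split.
  by apply/measurable_EFinP; exact: measurable_expR_scale.
rewrite (_ : integral _ _ _ = (expR (a ^+ 2 * s ^+ 2 / 2))%:E) ?ltry// -H.
by apply: eq_integral => w _; rewrite /= ger0_norm ?expR_ge0.
Qed.

Lemma integ_dom (Z Y : Omega -> R) : measurable_fun setT Z -> integ P Y ->
  (forall w, `|Z w| <= Y w) -> integ P Z.
Proof.
move=> mZ iY h; apply: (le_integrable measurableT _ _ iY).
  exact/measurable_EFinP.
by move=> w _; rewrite /= lee_fin (le_trans (h w))// ler_norm.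
Qed.

Let e k w := expR (k * G w) + expR (- k * G w).

Let ie k : integ P (e k).
Proof. by apply: integD; apply: (gaussian_mgf _).1. Qed.

Let Exe k : Ex P (e k) = 2 * expR (k ^+ 2 * s ^+ 2 / 2).
Proof.
rewrite ExD; [|apply: (gaussian_mgf _).1..].
by rewrite !(gaussian_mgf _).2 sqrrN mulr2n mulrDl mul1r.
Qed.

Let expR_le_e k w : expR `|k * G w| <= e k w.
Proof. by rewrite /e mulNr; case: (ger0P (k * G w)) => _; rewrite ?lerDl ?lerDr expR_ge0. Qed.

(** The exponential moments at 1 / s and - 1 / s bound the third moment with the
right power of s. *)
Lemma gaussian_cube : integ P (fun w => `|G w| ^+ 3) /\
  Ex P (fun w => `|G w| ^+ 3) <= 54 * expR (1 / 2) * s ^+ 3.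
Proof.
have h w : `|G w| ^+ 3 <= 27 * s ^+ 3 * e s^-1 w.
  have := cube_le_expR (s^-1 * G w).
  rewrite normrM exprMn -mulNr -/(e _ _) ger0_norm ?invr_ge0 ?(ltW s0)// => h.
  rewrite mulrAC -ler_pdivrMr ?exprn_gt0// mulrC -exprVn; exact: h.
have i3 : integ P (fun w => `|G w| ^+ 3).
  apply: (integ_dom (Y := fun w => 27 * s ^+ 3 * e s^-1 w)).
  - by apply: measurable_funX; exact: measurableT_comp.
  - exact: integZ.
  - by move=> w; rewrite ger0_norm ?exprn_ge0.
split => //; apply: (@le_trans _ _ (Ex P (fun w => 27 * s ^+ 3 * e s^-1 w))).
  by apply: Ex_le => //; exact: integZ.
rewrite ExZ// Exe exprVn mulVf ?gt_eqF ?exprn_gt0//.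
by rewrite le_eqVlt; apply/orP; left; apply/eqP; ring.
Qed.

Lemma gaussian_integ : integ P G /\ integ P (fun w => G w ^+ 2).
Proof.
have i := (gaussian_cube).1.
have i1 : integ P (fun w => 1 + `|G w| ^+ 3) by apply: integD => //; exact: integ_cst.
have h (x : R) : 0 <= x -> x <= 1 + x ^+ 3 /\ x ^+ 2 <= 1 + x ^+ 3.
  move=> x0; have [x1|x1] := leP x 1.
    have := exprn_ge0 3 x0; have := exprn_ile1 2 x0 x1; lra.
  have h1 : x ^+ 3 = x * x ^+ 2 by rewrite exprS.
  have h2 : x ^+ 2 = x * x by rewrite expr2.
  split; nra.
split; apply: (integ_dom _ i1) => //.
- by move=> w; case: (h _ (normr_ge0 (G w))).
- exact: measurable_funX.
- by move=> w; rewrite normrX; case: (h _ (normr_ge0 (G w))).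
Qed.

(* First and second moments are read off the expansion of the moment generating
   function at 0. *)
Let C := Ex P (fun w => 54 * e 2 w).

Lemma gaussian_mgf_expansion a : 0 < a <= 1 ->
  `|expR (a ^+ 2 * s ^+ 2 / 2) - 1 - a * Ex P G - a ^+ 2 * Ex P (fun w => G w ^+ 2) / 2|
   <= a ^+ 3 * C.
Proof.
move=> /andP[a0 a1]; have [i1 i2] := gaussian_integ.
have -> : expR (a ^+ 2 * s ^+ 2 / 2) - 1 - a * Ex P G - a ^+ 2 * Ex P (fun w => G w ^+ 2) / 2
  = Ex P (fun w => expR (a * G w) - 1 - a * G w - a ^+ 2 / 2 * G w ^+ 2).
  have ie1 := (gaussian_mgf a).1.
  have := integ_cst P 1 => ic.
  have ia := integZ a i1; have ia2 := integZ (a ^+ 2 / 2) i2.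
  have ie2 := integB ie1 ic; have ie3 := integB ie2 ia.
  rewrite (ExB ie3 ia2) (ExB ie2 ia) (ExB ie1 ic) (gaussian_mgf a).2 Ex_cst.
  by rewrite (ExZ _ i1) (ExZ _ i2); field.
have i54 : integ P (fun w => 54 * e 2 w) by exact: integZ.
rewrite -[leRHS](ExZ (a ^+ 3) i54).
apply: Ex_norm.
- apply: integB; last exact: integZ.
  apply: integB; last exact: integZ.
  by apply: integB; [exact: (gaussian_mgf a).1|exact: integ_cst].
- by do 2 apply: integZ.
move=> w; have := expR_taylor2 (a * G w).
rewrite exprMn [a ^+ 2 * _ / 2]mulrAC => /le_trans; apply.
rewrite normrM (ger0_norm (ltW a0)) exprMn -mulrA ler_wpM2l ?exprn_ge0 ?(ltW a0)//.
have h1 : `|G w| ^+ 3 <= 27 * e 1 w.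
  by have := cube_le_expR (G w); rewrite /e mul1r mulN1r.
have h2 : expR (a * `|G w|) <= e 1 w.
  apply: le_trans (expR_le_e 1 w); rewrite ler_expR mul1r; exact: ler_piMl.
apply: (@le_trans _ _ (27 * e 1 w * e 1 w)).
  by rewrite ler_pM ?exprn_ge0 ?expR_ge0.
have -> : e 2 w = expR (G w) ^+ 2 + expR (- G w) ^+ 2.
  by rewrite /e -!expRM_natl mulrN mulNr.
rewrite /e mul1r mulN1r; set x := expR _; set y := expR _.
have := sqr_ge0 (x - y); nra.
Qed.

(** The expansion of the moment generating function at 0 is compared with that of
its closed form: the coefficients of order one and two agree. *)
Lemma gaussian_moments : Ex P G = 0 /\ Ex P (fun w => G w ^+ 2) = s ^+ 2.
Proof.
have C0 : 0 <= C.
  rewrite -(Ex_cst P 0); apply: Ex_le => [||w]; [exact: integ_cst|exact: integZ|].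
  by rewrite mulr_ge0// addr_ge0 ?expR_ge0.
have lim0 (x K : R) : 0 <= K -> (forall a, 0 < a <= 1 -> `|x| <= a * K) -> x = 0.
  move=> K0 h; apply/eqP; rewrite -normr_le0; apply/ler_addgt0Pr => r r0.
  rewrite add0r; pose a := Num.min 1 (r / (K + 1)).
  have a01 : 0 < a <= 1.
    by rewrite /a lt_min ltr01 divr_gt0 ?ltr_wpDl//= ge_min lexx.
  apply: le_trans (h a a01) _; apply: (@le_trans _ _ (a * (K + 1))).
    by rewrite ler_wpM2l ?(ltW (andP a01).1)// lerDl.
  by rewrite -ler_pdivlMr ?ltr_wpDl// /a ge_min lexx orbT.
pose D := expR (s ^+ 2 / 2); have D0 : 0 <= D := expR_ge0 _.
set m1 := Ex P G; set m2 := Ex P _.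
have H a : 0 < a <= 1 ->
    `|a * m1 + a ^+ 2 * (m2 / 2 - s ^+ 2 / 2)| <= a ^+ 3 * (C + s ^+ 4 * D).
  move=> a01; have := gaussian_mgf_expansion a01; rewrite -/m1 -/m2.
  have /andP[a0 a1] := a01.
  have := expR_taylor1 (a ^+ 2 * s ^+ 2 / 2).
  have u0 : 0 <= a ^+ 2 * s ^+ 2 / 2 by rewrite divr_ge0// mulr_ge0 ?sqr_ge0.
  rewrite (ger0_norm u0); set E := expR _.
  have ED : E <= D.
    rewrite ler_expR ler_wpM2r// ler_piMl ?sqr_ge0// exprn_ile1// ltW//.
  have : (a ^+ 2 * s ^+ 2 / 2) ^+ 2 * E <= a ^+ 3 * (s ^+ 4 * D).
    rewrite (_ : (a ^+ 2 * s ^+ 2 / 2) ^+ 2 = a ^+ 3 * (a / 4 * s ^+ 4)); last by field.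
    rewrite -mulrA ler_wpM2l ?exprn_ge0 ?(ltW a0)// -mulrA.
    have s4 : 0 <= s ^+ 4 by rewrite exprn_ge0// ltW.
    apply: (@le_trans _ _ (s ^+ 4 * E)).
      rewrite ler_piMl ?(mulr_ge0 s4 (expR_ge0 _))//; lra.
    by rewrite ler_wpM2l.
  rewrite !ler_norml => h1 /andP[h2 h3] /andP[h4 h5]; apply/andP; split; lra.
have K0 : 0 <= C + s ^+ 4 * D by rewrite addr_ge0// mulr_ge0// exprn_ge0// ltW.
have m10 : m1 = 0.
  apply: (lim0 _ (C + s ^+ 4 * D + `|m2 / 2 - s ^+ 2 / 2|)); first by rewrite addr_ge0.
  move=> a a01; have /andP[a0 a1] := a01.
  rewrite -(ler_pM2l a0) -{1}(ger0_norm (ltW a0)) -normrM.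
  have h := H a a01; set x := m2 / 2 - _ in h *.
  have hx : `|a ^+ 2 * x| = a ^+ 2 * `|x| by rewrite normrM ger0_norm ?sqr_ge0.
  have : `|a * m1| <= `|a * m1 + a ^+ 2 * x| + `|a ^+ 2 * x|.
    by rewrite -{1}(addrK (a ^+ 2 * x) (a * m1)) ler_normB.
  have : a ^+ 3 * (C + s ^+ 4 * D) <= a ^+ 2 * (C + s ^+ 4 * D).
    by rewrite ler_wpM2r// exprS ler_piMl// ?sqr_ge0.
  have -> : a * (a * (C + s ^+ 4 * D + `|x|)) = a ^+ 2 * (C + s ^+ 4 * D) + a ^+ 2 * `|x|.
    by ring.
  rewrite hx; lra.
split => //; apply/eqP; rewrite -subr_eq0; apply/eqP.
suff : m2 / 2 - s ^+ 2 / 2 = 0 by lra.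
apply: (lim0 _ _ K0) => a a01; have /andP[a0 a1] := a01.
have a20 : 0 < a ^+ 2 by rewrite exprn_gt0.
rewrite -(ler_pM2l a20) -{1}(ger0_norm (ltW a20)) -normrM mulrA -exprSr.
by have := H a a01; rewrite m10 mulr0 add0r.
Qed.

End GaussianVariable.

(** * Smoothing by moving averages *)

Section Smoothing.
Context {R : realType}.
Local Notation mu := (@lebesgue_measure R).
Implicit Types f : R -> R.

Definition lipschitz (L : R) f := forall x y, `|f x - f y| <= L * `|x - y|.

Lemma lipschitz_continuous L f : lipschitz L f -> continuous f.
Proof.
move=> lf x; apply/cvgrPdist_lt => e e0.
have L1 : 0 < `|L| + 1 by rewrite ltr_wpDl.
exists (e / (`|L| + 1)) => /=; first by rewrite divr_gt0.
move=> y /=; rewrite ltr_pdivlMr// => h; apply: le_lt_trans (lf x y) _.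
apply: le_lt_trans h; rewrite [leRHS]mulrC ler_wpM2r//.
by rewrite (le_trans (ler_norm _))// lerDl.
Qed.

Definition average (e : R) f (x : R) : R :=
  e^-1 * (\int[mu]_(t in `]x, (x + e)]) f t)%R.

Lemma continuous_integ f a b : continuous f -> mu.-integrable `[a, b] (EFin \o f).
Proof.
move=> cf; apply: continuous_compact_integrable; first exact: segment_compact.
exact: continuous_subspaceT.
Qed.

Lemma average_base e f b x : 0 < e -> continuous f -> b <= x ->
  average e f x = e^-1 * ((\int[mu]_(t in `[b, (x + e)]) f t)%R -
                          (\int[mu]_(t in `[b, x]) f t)%R).
Proof.
move=> e0 cf bx; rewrite /average Rintegral_itvB//.
- exact: continuous_integ.
- by rewrite bnd_simp lerDl ltW.
Qed.

Lemma is_derive_integral f b (x : R) : continuous f -> b < x ->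
  is_derive x 1 (fun y : R => (\int[mu]_(t in `[b, y]) f t)%R) (f x).
Proof.
move=> cf bx; have [dF <-] := @continuous_FTC1_closed R f b x (x + 1)
  (ltr_pwDr ltr01 (lexx x)) (continuous_integ _ _ cf) bx (cf x).
apply: DeriveDef; first exact: dF.
exact/esym/derive1E.
Qed.

Lemma is_derive_translate (g : R -> R) (dg e x : R) :
  is_derive (x + e) 1 g dg -> is_derive x 1 (fun y : R => g (y + e)) dg.
Proof.
move=> dgg; rewrite -(mulr1 dg).
exact: (is_derive1_comp (g := shift e) dgg (is_derive_shift x 1 e)).
Qed.

Lemma average_derive e f (x : R) : 0 < e -> continuous f ->
  is_derive x 1 (average e f) (e^-1 * (f (x + e) - f x)).
Proof.
move=> e0 cf; pose b := x - 1.
pose F (y : R) := (\int[mu]_(t in `[b, y]) f t)%R.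
have bx : b < x by rewrite /b ltrBlDr ltrDl.
have h : is_derive x 1 (fun y => e^-1 * (F (y + e) - F y)) (e^-1 * (f (x + e) - f x)).
  have d1 : is_derive x 1 F (f x) by exact: is_derive_integral.
  have d2 : is_derive (x + e) 1 F (f (x + e)).
    by apply: is_derive_integral => //; rewrite ltr_wpDr// ltW.
  have d3 : is_derive x 1 (fun y : R => F (y + e)) (f (x + e)).
    exact: is_derive_translate.
  by apply: is_derive_eq.
apply: near_eq_is_derive h => //.
near=> y; rewrite (average_base (b := b))//.
near: y; exists 1 => //= y; rewrite /ball /= ltr_norml /b; lra.
Unshelve. all: by end_near. Qed.

(** The mean value theorem for a primitive of f. *)
Lemma average_mean e f x : 0 < e -> continuous f ->
  exists2 c, x <= c <= x + e & average e f x = f c.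
Proof.
move=> e0 cf; pose b := x - 1.
pose F (y : R) := (\int[mu]_(t in `[b, y]) f t)%R.
have xe : x <= x + e by rewrite lerDl ltW.
have bx : b < x by rewrite /b ltrBlDr ltrDl.
have dF z : z \in `[x, x + e] -> is_derive z 1 F (f z).
  rewrite in_itv /= => /andP[xz _]; apply: is_derive_integral => //.
  exact: lt_le_trans xz.
have cF : {within `[x, x + e], continuous F}.
  by apply: derivable_within_continuous => z zx; case: (dF z zx).
have dF' z : z \in `]x, x + e[ -> is_derive z 1 F (f z).
  by move=> zx; apply: dF; apply: subset_itv_oo_cc zx.
have [c cx cE] := MVT_segment xe dF' cF.
exists c; first by move: cx; rewrite in_itv.
rewrite (average_base (b := b))//; last exact: ltW.
by rewrite cE addrAC subrr add0r mulrC mulfK// gt_eqF.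
Qed.

Lemma average_le e f M x : 0 < e -> continuous f -> (forall y, `|f y| <= M) ->
  `|average e f x| <= M.
Proof. by move=> e0 cf h; have [c _ ->] := average_mean x e0 cf. Qed.

Lemma average_near e f L x : 0 < e -> lipschitz L f -> 0 <= L ->
  `|average e f x - f x| <= L * e.
Proof.
move=> e0 lf L0; have [c /andP[xc cx] ->] := average_mean x e0 (lipschitz_continuous lf).
apply: le_trans (lf c x) _; rewrite ler_wpM2l// ger0_norm ?subr_ge0//; lra.
Qed.

Lemma average_lipschitz e f L : 0 < e -> 0 <= L -> lipschitz L f ->
  lipschitz L (average e f).
Proof.
move=> e0 L0 lf x y; have cf := lipschitz_continuous lf.
have := @mean_value_bound R (average e f) (fun z => e^-1 * (f (z + e) - f z)) y (x - y) L
  (fun z => average_derive z e0 cf).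
rewrite [y + _]addrC subrK; apply => z _.
rewrite normrM gtr0_norm ?invr_gt0// mulrC ler_pdivrMr//.
by have := lf (z + e) z; rewrite addrAC subrr add0r (gtr0_norm e0).
Qed.

Definition mollify e f := average e (average e f).

Definition mollify1 e f x := e^-1 * (average e f (x + e) - average e f x).

Definition mollify2 e f x :=
  e^-1 * (e^-1 * (f (x + e + e) - f (x + e)) - e^-1 * (f (x + e) - f x)).

(** The derivative of an average is a difference quotient of f, so each averaging
gains one derivative: after two of them the second derivative, mollify2, is
still Lipschitz, with a constant of order e ^ -2, whereas f has moved by O(e)
only. *)
Lemma smoothing f (L M e : R) : 0 < e -> 0 <= L -> lipschitz L f ->
  (forall x, `|f x| <= M) ->
  [/\ lipschitz L (mollify e f) /\ forall x, `|mollify e f x - f x| <= 2 * L * e,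
      [/\ continuous (mollify e f), continuous (mollify1 e f) & continuous (mollify2 e f)],
      [/\ forall x, `|mollify e f x| <= M, forall x, `|mollify1 e f x| <= L &
          forall x, `|mollify2 e f x| <= 2 * L / e] &
      forall a y, `|mollify e f (a + y) - mollify e f a - mollify1 e f a * y
          - mollify2 e f a * y ^+ 2 / 2| <= 4 * L / e ^+ 2 * `|y| ^+ 3].
Proof.
move=> e0 L0 lf bf; have cf := lipschitz_continuous lf.
have lA := average_lipschitz e0 L0 lf; have cA := lipschitz_continuous lA.
have ei : 0 < e^-1 by rewrite invr_gt0.
pose A := average e f; pose h := mollify e f.
pose h1 := mollify1 e f.
pose D x := e^-1 * (f (x + e) - f x).
pose h2 := mollify2 e f.
have dA (x : R) : is_derive x 1 A (D x) by exact: average_derive.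
have dh (x : R) : is_derive x 1 h (h1 x) by exact: average_derive.
have diff (g dg : R -> R) : (forall x : R, is_derive x 1 g (dg x)) ->
    forall x : R, is_derive x 1 (fun x : R => e^-1 * (g (x + e) - g x)) (e^-1 * (dg (x + e) - dg x)).
  move=> dgg x; have d1 := dgg x; have d3 := is_derive_translate (dgg (x + e)).
  by apply: is_derive_eq.
have dh1 (x : R) : is_derive x 1 h1 (h2 x) by exact: diff.
have lip_diff K g : lipschitz K g -> lipschitz (2 * K / e) (fun x => e^-1 * (g (x + e) - g x)).
  move=> lg x y; rewrite -mulrBr normrM gtr0_norm// (mulrC _ e^-1) -mulrA ler_wpM2l ?(ltW ei)//.
  have := lg (x + e) (y + e); have := lg x y; rewrite opprD addrACA subrr addr0.
  by rewrite !ler_norml; lra.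
have lD : lipschitz (2 * L / e) D by exact: lip_diff.
have lh2 : lipschitz (4 * L / e ^+ 2) h2.
  have := lip_diff _ _ lD; rewrite (_ : 2 * (2 * L / e) / e = 4 * L / e ^+ 2)//.
  by field; rewrite gt_eqF.
have bdiff K g : lipschitz K g -> forall x, `|e^-1 * (g (x + e) - g x)| <= K.
  move=> lg x; rewrite normrM gtr0_norm// mulrC ler_pdivrMr//.
  by have := lg (x + e) x; rewrite addrAC subrr add0r (gtr0_norm e0).
rewrite -/h -/h1 -/h2; split.
- split=> [|x]; first exact: average_lipschitz e0 L0 lA.
  have := average_near x e0 lA L0; have := average_near x e0 lf L0.
  by rewrite -/A -[average e A]/h !ler_norml; lra.
- split; first exact/lipschitz_continuous/(average_lipschitz e0 L0 lA).
    exact: lipschitz_continuous (lip_diff _ _ lA).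
  exact: lipschitz_continuous lh2.
- split; [|exact: bdiff|exact: bdiff].
  by move=> x; apply: average_le => // y; exact: average_le.
move=> a y; set K := 4 * L / _.
have step1 z : `|h1 z - h1 a - h2 a * (z - a)| <= K * `|z - a| ^+ 2.
  have := @mean_value_bound R (fun u => h1 u - h2 a * (u - a))
    (fun u => h2 u - h2 a) a (z - a) (K * `|z - a|).
  rewrite [a + _]addrC subrK subrr mulr0 subr0 expr2 mulrA addrAC; apply.
    by move=> u; apply: is_derive_eq; rewrite /GRing.scale /=; ring.
  move=> u uz; apply: le_trans (lh2 u a) _.
  by rewrite ler_wpM2l// divr_ge0 ?sqr_ge0 ?mulr_ge0.
pose phi u := h u - h1 a * (u - a) - h2 a * (u - a) ^+ 2 / 2.
have := @mean_value_bound R phi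
   (fun u => h1 u - h1 a - h2 a * (u - a)) a y (K * `|y| ^+ 2).
rewrite (_ : phi (a + y) - phi a = h (a + y) - h a - h1 a * y - h2 a * y ^+ 2 / 2).
  rewrite (_ : K * _ * `|y| = K * `|y| ^+ 3); last by ring.
  apply.
  by move=> u; apply: is_derive_eq; rewrite /GRing.scale /=; field.
  move=> z zy; apply: le_trans (step1 z) _.
  by rewrite ler_wpM2l ?lerXn2r// divr_ge0 ?sqr_ge0 ?mulr_ge0.
by rewrite /phi; field.
Qed.

End Smoothing.

(** * Sums of independent centered signs with predictable coefficients *)

Section PredictableSums.
Context {R : realType} {d : measure_display} {Omega : measurableType d}
  (P : probability Omega R) {I : choiceType} (V : I -> Omega -> int).
Hypothesis mV : forall i, measurable_fun setT (V i).
Hypothesis signV : forall i w, V i w = 1 \/ V i w = -1.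
Hypothesis indepV : mutually_independent P V.

(** The history r k is what is known before the variable V (i k) is drawn. *)
Variables (i : nat -> I) (r : nat -> seq I) (e : R).
Hypothesis r_mono : forall k, {subset r k <= r k.+1}.
Hypothesis i_r : forall k, i k \in r k.+1.
Hypothesis i_new : forall k, i k \notin r k.
Hypothesis meanV : forall k, Ex P (fun w => (V (i k) w)%:~R) = e.

Let bV j w : (`|V j w| <= 1)%N.
Proof. by case: (signV j w) => ->. Qed.

Lemma history_mono k l : (k <= l)%N -> {subset r k <= r l}.
Proof.
move=> /subnK <-; elim: (l - k)%N => [|m IH] j; first by rewrite add0n.
by rewrite addSn => /IH/r_mono.
Qed.

Lemma determined_integ s (Z : Omega -> R) : determined V s Z -> integ P Z.
Proof. by move=> dZ; apply: bm_integ; exact: (determined_bm mV bV dZ). Qed.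

Definition noise k w : R := (V (i k) w)%:~R - e.

Lemma mean_bound : `|e| <= 1.
Proof.
rewrite -(meanV 0) -[leRHS](Ex_cst P); apply: Ex_norm.
- apply: (@determined_integ [:: i 0]) => w w' h; by rewrite (h _ (mem_head _ _)).
- exact: integ_cst.
- by move=> w; case: (signV (i 0) w) => ->; rewrite ?normrN normr1.
Qed.

Lemma noise_bound k w : `|noise k w| <= 2.
Proof.
have := mean_bound; rewrite /noise ler_norml => /andP[h1 h2].
by case: (signV (i k) w) => ->; rewrite ?mulrN1z ?mulr1z ler_norml; lra.
Qed.

Lemma determined_noise k l : (k < l)%N -> determined V (r l) (noise k).
Proof. by move=> kl w w' h; rewrite /noise h// (history_mono kl). Qed.

(** A sign has square 1, so the square of the noise is an affine function of the
noise; this makes its conditional variance constant. *)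
Lemma noise_sqr k w : noise k w ^+ 2 = (1 - e ^+ 2) - 2 * e * noise k w.
Proof.
by rewrite /noise; case: (signV (i k) w) => ->; rewrite ?mulrN1z ?mulr1z; ring.
Qed.

(** The martingale property: the noise k is independent of everything that is
determined by the history r k. *)
Lemma noise_mean k Z : determined V (r k) Z -> Ex P (fun w => Z w * noise k w) = 0.
Proof.
move=> dZ.
have := @determined_indep _ _ _ P _ V 1 mV bV indepV (r k) (i k)
  (fun w z => Z w * (z%:~R - e)).
move=> -> //; last by move=> z w w' /dZ ->.
have iv : integ P (fun w => (V (i k) w)%:~R : R).
  apply: (@determined_integ [:: i k]) => w w' h; by rewrite (h _ (mem_head _ _)).
rewrite (_ : (fun w => _) = fun=> 0) ?Ex_cst//; apply/funext => w.
rewrite ExZ; last by apply: integB => //; exact: integ_cst.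
by rewrite ExB ?Ex_cst ?meanV ?subrr ?mulr0//; exact: integ_cst.
Qed.

Lemma noise_variance k Z : determined V (r k) Z ->
  Ex P (fun w => Z w * noise k w ^+ 2) = (1 - e ^+ 2) * Ex P Z.
Proof.
move=> dZ; have iZ := determined_integ dZ.
have iN : integ P (fun w => Z w * noise k w).
  apply: (@determined_integ (r k.+1)) => w w' h.
  rewrite (determined_noise (ltnSn k) h) (dZ w w')// => j /r_mono; exact: h.
under eq_fun do rewrite noise_sqr mulrBr mulrCA [_ * (1 - _)]mulrC.
rewrite ExB; [|exact: integZ|exact: integZ].
by rewrite !ExZ// noise_mean// mulr0 subr0.
Qed.

Section Coefficients.
Variable eta : nat -> Omega -> R.
Hypothesis eta_det : forall k, determined V (r k) (eta k).
Hypothesis eta_bound : forall k w, `|eta k w| <= 1.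

Definition psum n w := \sum_(k < n) noise k w * eta k w.

Lemma psumS n w : psum n.+1 w = psum n w + noise n w * eta n w.
Proof. by rewrite /psum big_ord_recr. Qed.

Lemma determined_psum n : determined V (r n) (psum n).
Proof.
move=> w w' h; apply: eq_bigr => k _; rewrite (determined_noise (ltn_ord k) h).
by rewrite (@eta_det k w w')// => j /(history_mono (ltnW (ltn_ord k))); exact: h.
Qed.

Lemma psum_second_moment n : Ex P (fun w => psum n w ^+ 2) <= 4 * n%:R.
Proof.
elim: n => [|n IH].
  under eq_fun do rewrite /psum big_ord0 expr0n /=.
  by rewrite Ex_cst mulr0.
have dS := @determined_psum n; have de := @eta_det n.
have H1 : Ex P (fun w => 2 * psum n w * eta n w * noise n w) = 0.
  by apply: noise_mean => w w' h; rewrite (dS _ _ h) (de _ _ h).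
have i1 : integ P (fun w => psum n w ^+ 2) by apply/determined_integ/(determined_comp (fun x => x ^+ 2) dS).
have i2 : integ P (fun w => 2 * psum n w * eta n w * noise n w).
  apply: (@determined_integ (r n.+1)) => w w' h; rewrite (determined_noise (ltnSn n) h).
  by rewrite (dS w w') ?(de w w')// => j /r_mono; exact: h.
have i3 : integ P (fun w => (noise n w * eta n w) ^+ 2).
  apply: (@determined_integ (r n.+1)) => w w' h; rewrite (determined_noise (ltnSn n) h).
  by rewrite (de w w')// => j /r_mono; exact: h.
under eq_fun => w.
  rewrite psumS (_ : _ ^+ 2 = psum n w ^+ 2 + 2 * psum n w * eta n w * noise n w +
    (noise n w * eta n w) ^+ 2); last by ring.
  over.
rewrite ExD ?ExD ?H1 ?addr0//; last exact: integD.
rewrite -[n.+1%:R]natr1 mulrDr mulr1 lerD// -[leRHS](Ex_cst P); apply: Ex_le => //.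
  exact: integ_cst.
move=> w; rewrite -real_normK ?num_real// normrM.
have h1 := noise_bound n w; have h2 := eta_bound n w.
have h3 := normr_ge0 (noise n w); have h4 := normr_ge0 (eta n w).
have : `|noise n w| * `|eta n w| <= 2 by nra.
have := mulr_ge0 h3 h4; nra.
Qed.

(** Let s be the sum and z the next term. In the expansion of (s + z) ^ 4 the term
4 s ^ 3 z has mean 0, and the terms of higher order in z are at most
40 s ^ 2 + 32, whose mean grows linearly by psum_second_moment. *)
Lemma psum_fourth_moment n : Ex P (fun w => psum n w ^+ 4) <= 80 * n%:R ^+ 2.
Proof.
elim: n => [|n IH].
  under eq_fun do rewrite /psum big_ord0 expr0n /=.
  by rewrite Ex_cst expr0n mulr0.
have dS := @determined_psum n; have de := @eta_det n.
have H1 : Ex P (fun w => 4 * psum n w ^+ 3 * eta n w * noise n w) = 0.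
  by apply: noise_mean => w w' h; rewrite (dS _ _ h) (de _ _ h).
have i4 : integ P (fun w => psum n w ^+ 4) by apply/determined_integ/(determined_comp (fun x => x ^+ 4) dS).
have i2 : integ P (fun w => psum n w ^+ 2) by apply/determined_integ/(determined_comp (fun x => x ^+ 2) dS).
have i3 : integ P (fun w => 4 * psum n w ^+ 3 * eta n w * noise n w).
  apply: (@determined_integ (r n.+1)) => w w' h; rewrite (determined_noise (ltnSn n) h).
  by rewrite (dS w w') ?(de w w')// => j /r_mono; exact: h.
have iS : integ P (fun w => psum n.+1 w ^+ 4).
  exact/determined_integ/(determined_comp (fun x => x ^+ 4) (@determined_psum n.+1)).
have ib : integ P (fun w => 40 * psum n w ^+ 2 + 32).
  by apply: integD; [exact: integZ|exact: integ_cst].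
apply: (@le_trans _ _ (Ex P (fun w => psum n w ^+ 4 + 4 * psum n w ^+ 3 * eta n w * noise n w +
    (40 * psum n w ^+ 2 + 32)))).
  apply: Ex_le => //; first by apply: integD => //; exact: integD.
  move=> w; rewrite psumS; set s := psum n w; set z := noise n w * eta n w.
  have h1 := noise_bound n w; have h2 := eta_bound n w.
  have h3 := normr_ge0 (noise n w); have h4 := normr_ge0 (eta n w).
  have z2 : `|z| <= 2 by rewrite /z normrM; nra.
  have -> : (s + z) ^+ 4 = s ^+ 4 + 4 * s ^+ 3 * z + (6 * s ^+ 2 * z ^+ 2 +
     4 * s * z ^+ 3 + z ^+ 4) by ring.
  rewrite (_ : 4 * s ^+ 3 * eta n w * noise n w = 4 * s ^+ 3 * z); last by rewrite /z; ring.
  rewrite lerD2l.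
  have zz : z ^+ 2 <= 4.
    by move: z2; rewrite ler_norml => /andP[a b]; nra.
  have z0 := sqr_ge0 z; have s0 := sqr_ge0 s.
  have e1 : z ^+ 4 = z ^+ 2 * z ^+ 2 by ring.
  have e2 : 4 * s * z ^+ 3 <= z ^+ 2 * (4 * s ^+ 2 + z ^+ 2).
    have := sqr_ge0 (2 * s - z).
    rewrite (_ : 4 * s * z ^+ 3 = z ^+ 2 * (4 * s * z)); last by ring.
    move=> h; apply: ler_wpM2l => //; nra.
  have e3 : z ^+ 2 * s ^+ 2 <= 4 * s ^+ 2 by apply: ler_wpM2r.
  have e4 : z ^+ 2 * z ^+ 2 <= 16 by nra.
  rewrite e1; nra.
rewrite ExD//; last exact: integD.
rewrite ExD// H1 addr0 ExD ?ExZ ?Ex_cst//; [|exact: integZ|exact: integ_cst].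
have := psum_second_moment n; rewrite -[n.+1%:R]natr1.
have := ler0n R n; nra.
Qed.

End Coefficients.

(** Replacing the coefficients by 0 once the sum has left an interval gives
again predictable coefficients, and turns a bound on the last partial sum into
a bound on all partial sums. *)
Section Maximal.
Variable eta : nat -> Omega -> R.
Hypothesis eta_det : forall k, determined V (r k) (eta k).
Hypothesis eta_bound : forall k w, `|eta k w| <= 1.
Variable a : R.

Definition exceeds n w := [exists k : 'I_n.+1, a <= `|psum eta k w|].

Definition stopped k w := if exceeds k w then 0 else eta k w.

Lemma determined_exceeds n : determined V (r n) (exceeds n).
Proof.
move=> w w' h; apply: eq_existsb => k.
rewrite (@determined_psum eta eta_det k w w')// => j jk; apply: h.
by apply: history_mono jk; rewrite -ltnS.
Qed.

Lemma exceedsS n w : exceeds n.+1 w = exceeds n w || (a <= `|psum eta n.+1 w|).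
Proof.
apply/existsP/orP => [[k ak]|[/existsP[k ak]|an]].
- have [kn|nk] := ltnP k n.+1; first by left; apply/existsP; exists (Ordinal kn).
  by right; rewrite (_ : n.+1 = k)//; apply/eqP; rewrite eqn_leq nk -ltnS ltn_ord.
- by exists (widen_ord (leqnSn n.+1) k).
- by exists ord_max.
Qed.

Lemma stopped_psum n w :
  (~~ exceeds n w -> psum stopped n w = psum eta n w) /\
  (exceeds n w -> a <= `|psum stopped n w|).
Proof.
elim: n => [|n [IH1 IH2]].
  split=> [_|/existsP[k ak]]; first by rewrite /psum !big_ord0.
  by move: ak; rewrite (ord1 k) /psum !big_ord0.
rewrite exceedsS negb_or !psumS /stopped; case: (boolP (exceeds n w)) => ex /=.
  by split => // _; rewrite mulr0 addr0; exact: IH2.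
by rewrite IH1.
Qed.

Lemma maximal_inequality n : 0 < a ->
  Ex P (fun w => (exceeds n w)%:R) <= 80 * n%:R ^+ 2 / a ^+ 4.
Proof.
move=> a0.
have ds k : determined V (r k) (stopped k).
  by move=> w w' h; rewrite /stopped (determined_exceeds h) (eta_det h).
have bs k w : `|stopped k w| <= 1.
  by rewrite /stopped; case: ifP => _; rewrite ?normr0.
rewrite ler_pdivlMr ?exprn_gt0//.
apply: le_trans (psum_fourth_moment ds bs n).
have iE : integ P (fun w => (exceeds n w)%:R : R).
  exact/determined_integ/(determined_comp (fun b : bool => b%:R) (@determined_exceeds n)).
rewrite mulrC -ExZ//; apply: Ex_le.
- exact: integZ.
- exact/determined_integ/(determined_comp (fun x => x ^+ 4) (determined_psum ds (n := n))).
move=> w; have [_] := stopped_psum n w; case: exceeds => [/(_ isT) h|_].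
  have h4 : 0 <= psum stopped n w ^+ 4 by rewrite (exprM _ 2 2) sqr_ge0.
  rewrite mulr1 -(ger0_norm h4) normrX lerXn2r// nnegrE ?normr_ge0//.
  exact: ltW.
by rewrite mulr0 (exprM _ 2 2) sqr_ge0.
Qed.

End Maximal.
End PredictableSums.

(** * Averages over Brownian increments *)

Section BrownianIncrements.
Context {R : realType} {d : measure_display} {Omega : measurableType d}
  (Q : probability Omega R) (B : R -> {RV Q >-> R}).
Hypothesis hB : brownian_motion B.

Definition incr (s t : R) (w : Omega) : R := B t w - B s w.

(** The ratio of the bound in gaussian_cube to s ^ 3. *)
Definition cube_const : R := 54 * expR (1 / 2).

Lemma incr_moments s t : 0 <= s -> s < t ->
  [/\ integ Q (incr s t), integ Q (fun w => incr s t w ^+ 2),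
      integ Q (fun w => `|incr s t w| ^+ 3) &
   [/\ Ex Q (incr s t) = 0, Ex Q (fun w => incr s t w ^+ 2) = t - s &
      Ex Q (fun w => `|incr s t w| ^+ 3) <= cube_const * Num.sqrt (t - s) ^+ 3]].
Proof.
move=> s0 st; case: hB => _ _ _ law.
have lawG A : measurable A -> pushforward Q (B t \- B s) A = normal_prob 0 (Num.sqrt (t - s)) A.
  by move=> mA; exact: law.
have sd0 : 0 < Num.sqrt (t - s) by rewrite sqrtr_gt0 subr_gt0.
have [i3 c3] := gaussian_cube (G := (B t \- B s)%R) sd0 lawG.
have [i1 i2] := gaussian_integ (G := (B t \- B s)%R) sd0 lawG.
have [m1 m2] := gaussian_moments (G := (B t \- B s)%R) sd0 lawG.
split => //; split => //; rewrite m2 sqr_sqrtr// subr_ge0 ltW//.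
Qed.

Lemma measurable_incr s t : measurable_fun setT (incr s t).
Proof. by apply: measurable_funB; exact: measurable_funP. Qed.

Lemma incr_refl t w : incr t t w = 0.
Proof. by rewrite /incr subrr. Qed.

(** The transition operator of sigma B from time s to time t. *)
Definition smear (f : R -> R) (sigma s t x : R) : R :=
  Ex Q (fun w => f (x + sigma * incr s t w)).

Lemma smear_refl (f : R -> R) sigma t x : smear f sigma t t x = f x.
Proof.
by rewrite /smear; under eq_fun do rewrite incr_refl mulr0 addr0; rewrite Ex_cst.
Qed.

Lemma smear_bm (f : R -> R) sigma s t x M : continuous f -> (forall y, `|f y| <= M) ->
  bm (fun w => f (x + sigma * incr s t w)).
Proof.
move=> cf bf; split; last by exists M.
apply: (@measurableT_comp _ _ _ _ _ _ f); first exact: continuous_measurable_fun.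
apply: measurable_funD => //; apply: measurable_funM => //.
exact: measurable_incr.
Qed.

Lemma smear_le (f : R -> R) sigma s t x M : continuous f -> (forall y, `|f y| <= M) ->
  `|smear f sigma s t x| <= M.
Proof.
move=> cf bf; rewrite -[leRHS](Ex_cst Q); apply: Ex_norm => //.
- exact/bm_integ/(smear_bm _ _ _ _ cf bf).
- exact: integ_cst.
Qed.

Lemma smear_taylor (f f1 f2 : R -> R) sigma s t M L1 L2 K :
  continuous f -> continuous f1 -> continuous f2 ->
  (forall y, `|f y| <= M) -> (forall y, `|f1 y| <= L1) -> (forall y, `|f2 y| <= L2) ->
  (forall a y, `|f (a + y) - f a - f1 a * y - f2 a * y ^+ 2 / 2| <= K * `|y| ^+ 3) ->
  forall a y, `|smear f sigma s t (a + y) - smear f sigma s t a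
    - smear f1 sigma s t a * y - smear f2 sigma s t a * y ^+ 2 / 2| <= K * `|y| ^+ 3.
Proof.
move=> cf cf1 cf2 bf bf1 bf2 tf a y; rewrite /smear.
have b0 x := bm_integ Q (smear_bm sigma s t x cf bf).
have b1 := bm_integ Q (smear_bm sigma s t a cf1 bf1).
have b2 := bm_integ Q (smear_bm sigma s t a cf2 bf2).
rewrite [X in `|X|](_ : _ = Ex Q (fun w => f (a + y + sigma * incr s t w) - f (a + sigma * incr s t w)
   - y * f1 (a + sigma * incr s t w) - y ^+ 2 / 2 * f2 (a + sigma * incr s t w))).
  rewrite -[leRHS](Ex_cst Q); apply: Ex_norm.
  - apply: integB; last exact: integZ.
    by apply: integB; [exact: integB|exact: integZ].
  - exact: integ_cst.
  - move=> w; rewrite (addrAC a y); apply: le_trans (tf _ y).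
    by rewrite le_eqVlt; apply/orP; left; apply/eqP; congr Num.norm; ring.
have e1 := integB (b0 (a + y)) (b0 a).
have e2 := integZ y b1; have e3 := integZ (y ^+ 2 / 2) b2.
rewrite (ExB (integB e1 e2) e3) (ExB e1 e2) (ExB (b0 _) (b0 _)) (ExZ _ b1) (ExZ _ b2).
by ring.
Qed.

(** The mean of the increment is 0, its variance is t - s, and its third absolute
moment bounds the remainder. *)
Lemma smear_step (f f1 f2 : R -> R) sigma s t M K a : 0 <= s -> s < t -> 0 <= sigma ->
  0 <= K -> continuous f -> (forall y, `|f y| <= M) ->
  (forall a y, `|f (a + y) - f a - f1 a * y - f2 a * y ^+ 2 / 2| <= K * `|y| ^+ 3) ->
  `|smear f sigma s t a - f a - f2 a * sigma ^+ 2 * (t - s) / 2|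
    <= K * sigma ^+ 3 * (cube_const * Num.sqrt (t - s) ^+ 3).
Proof.
move=> s0 st sg0 K0 cf bf tf; have [i1 i2 i3 [m1 m2 m3]] := incr_moments s0 st.
have b0 := bm_integ Q (smear_bm sigma s t a cf bf).
have e0 := integ_cst Q (f a).
have e1 := integZ (f1 a * sigma) i1; have e2 := integZ (f2 a * sigma ^+ 2 / 2) i2.
have -> : smear f sigma s t a - f a - f2 a * sigma ^+ 2 * (t - s) / 2 =
    Ex Q (fun w => f (a + sigma * incr s t w) - f a - f1 a * sigma * incr s t w
      - f2 a * sigma ^+ 2 / 2 * incr s t w ^+ 2).
  rewrite (ExB (integB (integB b0 e0) e1) e2) (ExB (integB b0 e0) e1) (ExB b0 e0).
  by rewrite (ExZ _ i1) (ExZ _ i2) m1 m2 Ex_cst /smear; field.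
apply: (@le_trans _ _ (Ex Q (fun w => K * sigma ^+ 3 * `|incr s t w| ^+ 3))).
  apply: Ex_norm.
  - by apply: integB => //; apply: integB => //; exact: integB.
  - exact: integZ.
  - move=> w; have := tf a (sigma * incr s t w).
    rewrite normrM (ger0_norm sg0) [in leRHS]exprMn [leRHS]mulrA.
    apply: le_trans; rewrite le_eqVlt; apply/orP; left; apply/eqP; congr Num.norm.
    by field.
by rewrite ExZ// ler_wpM2l// mulr_ge0// exprn_ge0.
Qed.

(** The semigroup property: successive increments are independent, and the second
one is integrated out first. *)
Lemma smear_split (f : R -> R) sigma s r t x L M : 0 <= s -> s <= r -> r <= t ->
  0 <= sigma -> 0 <= L -> lipschitz L f -> (forall y, `|f y| <= M) ->
  smear f sigma s t x = smear (smear f sigma r t) sigma s r x.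
Proof.
move=> s0 sr rt sg0 L0 lf bf.
pose tt (i : nat) : R := if i is 0 then s else if i is 1 then r else t.
pose X (i : nat) w := incr (tt i) (tt i.+1) w.
pose Phi (u : nat -> R) := f (x + sigma * (u 0%N + u 1%N)).
have ind : mutually_independent Q (fun i : 'I_2 => X i).
  case: hB => _ _ indB _; apply: (indB 2 tt) => //.
  by move=> [|[|i]] [|[|j]] //= _; rewrite ?lexx// (le_trans sr).
have lip : lip_on 2 (L * sigma * 2) Phi.
  move=> u v e _ h; apply: le_trans (lf _ _) _.
  rewrite opprD addrACA subrr add0r -mulrBr normrM (ger0_norm sg0) -!mulrA.
  rewrite ler_wpM2l// ler_wpM2l// mulr_natl mulr2n opprD addrACA.
  by apply: le_trans (ler_normD _ _) _; rewrite lerD ?h.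
have [_] := @lip_integrate_out _ _ _ Q 2 X Phi _ M (fun i _ => measurable_incr _ _)
  lip (fun u => bf _) ind 1 erefl.
rewrite /Phi /upd /= /X /= => H.
rewrite {1}/smear; under eq_fun => w.
  rewrite (_ : incr s t w = incr s r w + incr r t w); last first.
    by rewrite /incr; ring.
  over.
rewrite H /smear; congr (Ex Q _); apply/funext => w; congr (Ex Q _); apply/funext => w'.
by rewrite mulrDr addrA.
Qed.

Lemma smear_lipschitz (f : R -> R) sigma s t L M : lipschitz L f -> (forall y, `|f y| <= M) ->
  lipschitz L (smear f sigma s t).
Proof.
move=> lf bf x y; have cf := lipschitz_continuous lf.
apply: Ex_dist; [exact/bm_integ/(smear_bm _ _ _ _ cf bf)..|].
by move=> w; apply: le_trans (lf _ _) _; rewrite opprD addrACA subrr addr0.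
Qed.

End BrownianIncrements.

(** * Replacing one block of the walk by a Brownian increment *)

Lemma telescope_bound {R : realType} (D : nat -> R) (C : R) l :
  (forall k, (k < l)%N -> `|D k.+1 - D k| <= C) -> `|D l - D 0%N| <= l%:R * C.
Proof.
elim: l => [_|l IH h]; first by rewrite subrr normr0 mul0r.
have h1 : `|D l.+1 - D l| <= C by exact: h.
have h2 : `|D l - D 0%N| <= l%:R * C by apply: IH => k kl; apply/h/leqW.
by move: h1 h2; rewrite -natr1 mulrDl mul1r !ler_norml; lra.
Qed.

Lemma dist_chain {R : realType} (x0 xl y z a b : R) :
  `|x0 - y| <= a -> `|xl - z| <= a -> `|xl - x0| <= b -> `|z - y| <= 2 * a + b.
Proof. by rewrite !ler_norml; lra. Qed.

Section Block.
Context {R : realType} {d : measure_display} {Omega : measurableType d}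
  (P : probability Omega R) {I : choiceType} (V : I -> Omega -> int).
Hypothesis mV : forall i, measurable_fun setT (V i).
Hypothesis signV : forall i w, V i w = 1 \/ V i w = -1.
Hypothesis indepV : mutually_independent P V.
Variables (i : nat -> I) (r : nat -> seq I) (e : R).
Hypothesis r_mono : forall k, {subset r k <= r k.+1}.
Hypothesis i_r : forall k, i k \in r k.+1.
Hypothesis i_new : forall k, i k \notin r k.
Hypothesis meanV : forall k, Ex P (fun w => (V (i k) w)%:~R) = e.
Variable eta : nat -> Omega -> R.
Hypothesis eta_det : forall k, determined V (r k) (eta k).
Hypothesis eta_sign : forall k w, eta k w ^+ 2 = 1.

Context {d' : measure_display} {Omega' : measurableType d'}
  (Q : probability Omega' R) (B : R -> {RV Q >-> R}).
Hypothesis hB : brownian_motion B.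

Local Notation noise := (noise V i e).
Local Notation psum := (psum V i e eta).

Lemma eta_norm k w : `|eta k w| = 1.
Proof.
apply/eqP; rewrite -(@eqrXn2 _ 2)// -normrX eta_sign normr1 expr1n//.
Qed.

(** The counterpart of smear_step for one step of the martingale: its coefficient
is known before the sign is drawn and has square 1, so the conditional variance
of the step is tau ^ 2 (1 - e ^ 2). *)
Lemma walk_step k (g g1 g2 : Omega -> R -> R) tau K : 0 <= tau -> 0 <= K ->
  determined V (r k) g -> determined V (r k) g1 -> determined V (r k) g2 ->
  (forall w a y, `|g w (a + y) - g w a - g1 w a * y - g2 w a * y ^+ 2 / 2|
     <= K * `|y| ^+ 3) ->
  `|Ex P (fun w => g w (tau * psum k.+1 w)) - Ex P (fun w => g w (tau * psum k w))
    - tau ^+ 2 * (1 - e ^+ 2) / 2 * Ex P (fun w => g2 w (tau * psum k w))|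
    <= K * (8 * tau ^+ 3).
Proof.
move=> t0 K0 dg dg1 dg2 tg.
have dS := determined_psum e r_mono i_r eta_det (n := k).
have dS' := determined_psum e r_mono i_r eta_det (n := k.+1).
have ext (f : Omega -> R -> R) : determined V (r k) f -> determined V (r k) (fun w => f w (tau * psum k w)).
  by move=> df w w' h; rewrite (df _ _ h) (dS _ _ h).
have up (U : Type) (Z : Omega -> U) : determined V (r k) Z -> determined V (r k.+1) Z.
  by apply: determined_sub.
have ig := determined_integ P mV signV (ext g dg).
have ig' : integ P (fun w => g w (tau * psum k.+1 w)).
  apply: (determined_integ P mV signV (s := r k.+1)) => w w' h.
  by rewrite (up _ _ dg _ _ h) (dS' _ _ h).
have d1 : determined V (r k) (fun w => g1 w (tau * psum k w) * (tau * eta k w)).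
  by move=> w w' h; rewrite (dg1 _ _ h) (dS _ _ h) (eta_det h).
have d2 : determined V (r k) (fun w => tau ^+ 2 / 2 * g2 w (tau * psum k w)).
  by move=> w w' h; rewrite (dg2 _ _ h) (dS _ _ h).
have dn : determined V (r k.+1) (noise k) by exact: determined_noise.
have i1 : integ P (fun w => g1 w (tau * psum k w) * (tau * eta k w) * noise k w).
  apply: (determined_integ P mV signV (s := r k.+1)) => w w' h.
  by rewrite (up _ _ d1 _ _ h) (dn _ _ h).
have i2 : integ P (fun w => tau ^+ 2 / 2 * g2 w (tau * psum k w) * noise k w ^+ 2).
  apply: (determined_integ P mV signV (s := r k.+1)) => w w' h.
  by rewrite (up _ _ d2 _ _ h) (dn _ _ h).
have E1 := noise_mean mV signV indepV i_new meanV d1.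
have E2 := noise_variance mV signV indepV r_mono i_r i_new meanV d2.
rewrite (_ : _ - _ - _ = Ex P (fun w => g w (tau * psum k.+1 w) - g w (tau * psum k w)
   - g1 w (tau * psum k w) * (tau * eta k w) * noise k w
   - tau ^+ 2 / 2 * g2 w (tau * psum k w) * noise k w ^+ 2)); last first.
  rewrite (ExB (integB (integB ig' ig) i1) i2) (ExB (integB ig' ig) i1) (ExB ig' ig).
  rewrite E1 E2 (ExZ _ (determined_integ P mV signV (ext g2 dg2))); by field.
rewrite -[leRHS](Ex_cst P); apply: Ex_norm.
- by apply: integB => //; apply: integB => //; exact: integB.
- exact: integ_cst.
move=> w; have := tg w (tau * psum k w) (tau * (noise k w * eta k w)).
rewrite psumS mulrDr.
have nb : `|tau * (noise k w * eta k w)| <= 2 * tau.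
  rewrite !normrM eta_norm mulr1 (ger0_norm t0) mulrC ler_wpM2r//.
  exact: (noise_bound mV signV meanV).
have -> : (tau * (noise k w * eta k w)) ^+ 2 = tau ^+ 2 * noise k w ^+ 2.
  by rewrite !exprMn eta_sign mulr1.
move=> h; apply: (le_trans _ (le_trans h _)).
  by rewrite le_eqVlt; apply/orP; left; apply/eqP; congr Num.norm; field.
rewrite ler_wpM2l// (_ : 8 * tau ^+ 3 = (2 * tau) ^+ 3); last by ring.
by rewrite lerXn2r// nnegrE mulr_ge0.
Qed.

(** The method of Lindeberg. Divide [s, t] into l intervals of length h and let the
martingale make its first k steps, then let sigma B run over the remaining l - k
intervals. Going from k to k + 1 exchanges one step for one short increment; by
walk_step and smear_step this costs the difference of the two variances and two
third moments. Smoothing f at scale eps costs 4 L eps. The test function f may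
depend on what is known before the block starts. *)
Lemma block_replacement (f : Omega -> R -> R) (L M eps tau sigma s t h K : R) l :
  h = (t - s) / l%:R -> K = 4 * L / eps ^+ 2 ->
  (0 < l)%N -> 0 < eps -> 0 <= L -> 0 <= tau -> 0 <= sigma -> 0 <= s -> s < t ->
  determined V (r 0) f -> (forall w, lipschitz L (f w)) -> (forall w y, `|f w y| <= M) ->
  `|Ex P (fun w => f w (tau * psum l w)) - Ex P (fun w => smear B (f w) sigma s t 0)|
  <= 4 * L * eps + l%:R * (L / eps * `|tau ^+ 2 * (1 - e ^+ 2) - sigma ^+ 2 * h|
      + K * (8 * tau ^+ 3) + K * sigma ^+ 3 * (cube_const * Num.sqrt h ^+ 3)).
Proof.
move=> hE KE l0 eps0 L0 t0 sg0 s0 st df lf bf.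
have lR : 0 < l%:R :> R by rewrite ltr0n.
have h0 : 0 < h by rewrite hE divr_gt0// subr_gt0.
have K0 : 0 <= K by rewrite KE divr_ge0 ?sqr_ge0 ?mulr_ge0.
pose g w := mollify eps (f w).
pose s_ k := s + k%:R * h.
have s_l : s_ l = t by rewrite /s_ hE mulrC divfK ?gt_eqF// addrC subrK.
have s_S k : s_ k.+1 = s_ k + h by rewrite /s_ -natr1 mulrDl mul1r addrA.
have s_ge0 k : 0 <= s_ k by rewrite addr_ge0// mulr_ge0// ltW.
have s_lt k : s_ k < s_ k.+1 by rewrite s_S ltrDl.
have s_le k : (k <= l)%N -> s_ k <= t.
  by move=> kl; rewrite -s_l lerD2l ler_wpM2r ?(ltW h0)// ler_nat.
have sm w := smoothing eps0 L0 (lf w) (bf w).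
pose U k w := smear B (g w) sigma (s_ k) t.
pose U1 k w := smear B (mollify1 eps (f w)) sigma (s_ k) t.
pose U2 k w := smear B (mollify2 eps (f w)) sigma (s_ k) t.
have sub0 k : {subset r 0 <= r k} by apply: (history_mono r_mono).
have dU k : determined V (r k) (U k) by apply: determined_sub (sub0 k) _ => w w' e'; rewrite /U /g (df _ _ e').
have dU' k : determined V (r k) (U k.+1) by apply: determined_sub (sub0 k) _ => w w' e'; rewrite /U /g (df _ _ e').
have dU1 k : determined V (r k) (U1 k.+1) by apply: determined_sub (sub0 k) _ => w w' e'; rewrite /U1 (df _ _ e').
have dU2 k : determined V (r k) (U2 k.+1) by apply: determined_sub (sub0 k) _ => w w' e'; rewrite /U2 (df _ _ e').
have dS k : determined V (r k) (psum k) by exact: determined_psum.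
have dUS k : determined V (r k) (fun w => U k w (tau * psum k w)).
  by move=> w w' e'; rewrite (dU k _ _ e') (dS k _ _ e').
have dUS' k : determined V (r k) (fun w => U k.+1 w (tau * psum k w)).
  by move=> w w' e'; rewrite (dU' k _ _ e') (dS k _ _ e').
have dU2S k : determined V (r k) (fun w => U2 k.+1 w (tau * psum k w)).
  by move=> w w' e'; rewrite (dU2 k _ _ e') (dS k _ _ e').
have tU k w a y : `|U k w (a + y) - U k w a - U1 k w a * y - U2 k w a * y ^+ 2 / 2|
    <= K * `|y| ^+ 3.
  have [_ [c0 c1 c2] [b0 b1 b2] tf] := sm w.
  by move: tf; rewrite -KE => tf; exact: (smear_taylor B sigma (s_ k) t c0 c1 c2 b0 b1 b2 tf).
have bU2 k w y : `|U2 k w y| <= 2 * L / eps.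
  by have [_ [_ _ c2] [_ _ b2] _] := sm w; apply: smear_le.
(* U k is f smoothed and averaged over the increment of sigma B from s_ k to t:
   D k mixes k steps of the martingale and the last l - k intervals of B. *)
pose D k := Ex P (fun w => U k w (tau * psum k w)).
have alg (x1 x0 x2 x3 p q : R) :
    x1 - x0 = (x1 - x2 - p / 2 * x3) - (x0 - x2 - q / 2 * x3) + (p - q) / 2 * x3.
  by field.
have stepD k : (k < l)%N -> `|D k.+1 - D k| <=
    L / eps * `|tau ^+ 2 * (1 - e ^+ 2) - sigma ^+ 2 * h|
      + K * (8 * tau ^+ 3) + K * sigma ^+ 3 * (cube_const * Num.sqrt h ^+ 3).
  move=> kl.
  pose a1 := Ex P (fun w => U k.+1 w (tau * psum k.+1 w)).
  pose a2 := Ex P (fun w => U k.+1 w (tau * psum k w)).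
  pose a3 := Ex P (fun w => U2 k.+1 w (tau * psum k w)).
  have H1 : `|a1 - a2 - tau ^+ 2 * (1 - e ^+ 2) / 2 * a3| <= K * (8 * tau ^+ 3).
    exact: (walk_step t0 K0 (dU' k) (dU1 k) (dU2 k) (tU k.+1)).
  have iU := determined_integ P mV signV (dUS k).
  have iU' := determined_integ P mV signV (dUS' k).
  have iU2 := determined_integ P mV signV (dU2S k).
  have H2 : `|D k - a2 - sigma ^+ 2 * h / 2 * a3| <=
      K * sigma ^+ 3 * (cube_const * Num.sqrt h ^+ 3).
    rewrite /D /a2 /a3 -(ExZ _ iU2) -(ExB iU iU') -(ExB (integB iU iU') (integZ _ iU2)).
    rewrite -[leRHS](Ex_cst P); apply: Ex_norm.
    - by apply: integB; [exact: integB|exact: integZ].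
    - exact: integ_cst.
    move=> w; have [[lg _] [c0 c1 c2] [b0 b1 b2] tf] := sm w.
    have -> : U k w (tau * psum k w) = smear B (U k.+1 w) sigma (s_ k) (s_ k.+1) (tau * psum k w).
      by apply: (smear_split hB _ _ _ _ _ _ lg b0) => //; rewrite ?(ltW (s_lt k)) ?s_le.
    have cU : continuous (U k.+1 w).
      exact: (lipschitz_continuous (smear_lipschitz B sigma _ _ lg b0)).
    have bU y : `|U k.+1 w y| <= M by exact: smear_le.
    have := smear_step hB (tau * psum k w) (s_ge0 k) (s_lt k) sg0 K0 cU bU (tU k.+1 w).
    rewrite (_ : s_ k.+1 - s_ k = h); last by rewrite s_S addrC addKr.
    apply: le_trans.
    by rewrite le_eqVlt; apply/orP; left; apply/eqP; congr Num.norm; field.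
  have H3 : `|a3| <= 2 * L / eps.
    by rewrite -[leRHS](Ex_cst P); apply: Ex_norm => //; exact: integ_cst.
  rewrite (alg (D k.+1) (D k) a2 a3 (tau ^+ 2 * (1 - e ^+ 2)) (sigma ^+ 2 * h)).
  apply: le_trans (ler_normD _ _) _.
  apply: (@le_trans _ _ (K * (8 * tau ^+ 3) + K * sigma ^+ 3 * (cube_const * Num.sqrt h ^+ 3) +
    L / eps * `|tau ^+ 2 * (1 - e ^+ 2) - sigma ^+ 2 * h|)); last first.
    by rewrite le_eqVlt; apply/orP; left; apply/eqP; ring.
  apply: lerD; first by apply: le_trans (ler_normB _ _) _; exact: lerD.
  rewrite !normrM (ger0_norm (_ : 0 <= 2^-1)) ?invr_ge0//.
  rewrite -mulrA mulrC ler_wpM2r// mulrC ler_pdivrMr// (le_trans H3)//.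
  by rewrite le_eqVlt; apply/orP; left; apply/eqP; ring.
have near_f w y : `|g w y - f w y| <= 2 * L * eps by have [[_ ->]] := sm w.
have E0 : `|D 0%N - Ex P (fun w => smear B (f w) sigma s t 0)| <= 2 * L * eps.
  apply: Ex_dist.
  - exact: (determined_integ P mV signV (dUS 0%N)).
  - apply: (determined_integ P mV signV (s := r 0)) => w w' e'; by rewrite (df _ _ e').
  move=> w; rewrite /U /s_ mul0r addr0 /psum big_ord0 mulr0.
  have [_ [c0 _ _] [b0 _ _] _] := sm w.
  apply: Ex_dist; last by move=> w'; exact: near_f.
    exact: (bm_integ _ (smear_bm B _ _ _ _ c0 b0)).
  exact: (bm_integ _ (smear_bm B _ _ _ _ (lipschitz_continuous (lf w)) (bf w))).
have El : `|D l - Ex P (fun w => f w (tau * psum l w))| <= 2 * L * eps.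
  apply: Ex_dist.
  - exact: (determined_integ P mV signV (dUS l)).
  - apply: (determined_integ P mV signV (s := r l)) => w w' e'.
    rewrite (dS l _ _ e') (df w w')// => j /(sub0 l); exact: e'.
  by move=> w; rewrite /U s_l smear_refl; exact: near_f.
have := dist_chain E0 El (telescope_bound stepD).
by rewrite (_ : 2 * (2 * L * eps) = 4 * L * eps)//; ring.
Qed.

End Block.

(** * Convergence of finitely many increments *)

Section Increments.
Context {R : realType} {d : measure_display} {Omega : measurableType d}
  (P : probability Omega R) {I : choiceType} (V : I -> Omega -> int).
Hypothesis mV : forall i, measurable_fun setT (V i).
Hypothesis signV : forall i w, V i w = 1 \/ V i w = -1.
Hypothesis indepV : mutually_independent P V.
Variables (i : nat -> I) (r : nat -> seq I) (e : R).
Hypothesis r_mono : forall k, {subset r k <= r k.+1}.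
Hypothesis i_r : forall k, i k \in r k.+1.
Hypothesis i_new : forall k, i k \notin r k.
Hypothesis meanV : forall k, Ex P (fun w => (V (i k) w)%:~R) = e.
Variable eta : nat -> Omega -> R.
Hypothesis eta_det : forall k, determined V (r k) (eta k).
Hypothesis eta_sign : forall k w, eta k w ^+ 2 = 1.

Context {d' : measure_display} {Omega' : measurableType d'}
  (Q : probability Omega' R) (B : R -> {RV Q >-> R}).
Hypothesis hB : brownian_motion B.

Variables (c delta : R).
Hypothesis c0 : 0 <= c.
Hypothesis delta0 : 0 < delta.

Local Notation msum := (psum V i e eta).

(** The first step of the j-th mesh interval, when the walk makes n steps per unit
of time. *)
Definition node (n j : nat) : nat := Num.truncn (n%:R * (j%:R * delta)).

Definition walk_incr (n : nat) (w : Omega) (j : nat) : R :=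
  c / Num.sqrt n%:R * (msum (node n j.+1) w - msum (node n j) w).

Definition sigma : R := c * Num.sqrt (1 - e ^+ 2).

Definition brownian_incr (w : Omega') (j : nat) : R :=
  sigma * incr B (j%:R * delta) (j.+1%:R * delta) w.

Lemma node_mono n j : (node n j <= node n j.+1)%N.
Proof.
apply: Num.Theory.le_truncn; rewrite ler_wpM2l// ler_wpM2r ?(ltW delta0)//.
by rewrite ler_nat.
Qed.

Lemma node_mono_le n j k : (j <= k)%N -> (node n j <= node n k)%N.
Proof.
move=> /subnK <-; elim: (k - j)%N => // m IH.
by rewrite addSn; apply: leq_trans IH (node_mono _ _).
Qed.

Lemma node_length n j :
  `|(node n j.+1 - node n j)%:R - n%:R * delta| <= 1 :> R.
Proof.
rewrite natrB ?node_mono//.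
have b k : 0 <= n%:R * (k%:R * delta) by rewrite !mulr_ge0// ltW.
have := truncn_itv (b j); have := truncn_itv (b j.+1).
rewrite -/(node n j) -/(node n j.+1) -!natr1 !mulrDl mulrDr mul1r ler_norml.
by move=> /andP[h1 h2] /andP[h3 h4]; apply/andP; split; lra.
Qed.

Lemma psum_shift N l w :
  msum (N + l) w - msum N w = psum V (fun k => i (N + k)%N) e (fun k => eta (N + k)%N) l w.
Proof.
elim: l => [|l IH]; first by rewrite addn0 subrr /psum big_ord0.
by rewrite addnS psumS addrAC IH psumS.
Qed.

Lemma upd_lip j L (psi : (nat -> R) -> R) u : lip_on j.+1 L psi ->
  0 <= L -> lipschitz L (fun y => psi (upd u j y)).
Proof.
move=> lpsi L0 x y; apply: lpsi => // k _; rewrite /upd.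
by case: eqP => // _; rewrite subrr normr0.
Qed.

(** The j-th block has about n delta steps of size c / sqrt n. In the estimate of
block_replacement all terms but 4 L eps are then O(1 / sqrt n) for fixed eps. *)
Lemma increment_replacement j L M (psi : (nat -> R) -> R) :
  0 <= L -> lip_on j.+1 L psi -> (forall u, `|psi u| <= M) ->
  Ex P (fun w => psi (walk_incr n w)) -
  Ex P (fun w => Ex Q (fun w' => psi (upd (walk_incr n w) j (brownian_incr w' j))))
    @[n --> \oo] --> 0.
Proof.
move=> L0 lpsi bpsi; apply/cvgrPdist_le => x x0.
have e1 : `|e| <= 1 := mean_bound mV signV meanV.
have v0 : 0 <= 1 - e ^+ 2.
  by move: e1; rewrite ler_norml subr_ge0 => /andP[? ?]; nra.
have sg0 : 0 <= sigma by rewrite mulr_ge0// sqrtr_ge0.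
pose eps := x / (8 * (L + 1)).
have eps0 : 0 < eps by rewrite divr_gt0// mulr_gt0// ltr_wpDl.
pose K := 4 * L / eps ^+ 2.
have K0 : 0 <= K by rewrite divr_ge0 ?sqr_ge0 ?mulr_ge0.
pose A := L / eps * sigma ^+ 2 + K * 8 * (2 * delta * c ^+ 3) +
   K * sigma ^+ 3 * cube_const * (2 * delta).
have cc0 : 0 <= cube_const :> R by rewrite mulr_ge0 ?expR_ge0.
have A0 : 0 <= A.
  by rewrite !addr_ge0// ?mulr_ge0 ?invr_ge0 ?sqr_ge0 ?exprn_ge0 ?(ltW eps0) ?(ltW delta0).
near=> n.
have n1 : (1 <= n)%N by near: n; exact: nbhs_infty_ge.
have n0 : 0 < n%:R :> R by rewrite ltr0n.
have nd : 2 <= n%:R * delta.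
  by rewrite -ler_pdivrMr//; near: n; exact: nbhs_infty_ger.
have nA : (2 * A / x) ^+ 2 <= n%:R by near: n; exact: nbhs_infty_ger.
pose q := Num.sqrt n%:R : R.
have q0 : 0 < q by rewrite sqrtr_gt0.
have q2 : q ^+ 2 = n%:R by rewrite sqr_sqrtr// ltW.
have q1 : 1 <= q by rewrite -[1]sqrtr1 ler_sqrt// ler1n.
pose N := node n j; pose l := (node n j.+1 - N)%N.
have Nl : (N + l)%N = node n j.+1 by rewrite subnKC// node_mono.
have := node_length n j; rewrite -/N -/l ler_norml => /andP[l1 l2].
have lR0 : 0 < l%:R :> R by lra.
have l0 : (0 < l)%N by move: lR0; rewrite ltr0n.
pose tau := c / q; have tau0 : 0 <= tau by rewrite divr_ge0// ltW.
pose s := j%:R * delta; pose t := j.+1%:R * delta.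
have s0 : 0 <= s by rewrite mulr_ge0// ltW.
have ts : t - s = delta by rewrite /t /s -natr1 mulrDl mul1r addrC addKr.
have st : s < t by rewrite -subr_gt0 ts.
pose f (w : Omega) y := psi (upd (walk_incr n w) j y).
have df : determined V (r (N + 0)%N) f.
  move=> w w' h; apply/funext => y; apply/eqP; rewrite -subr_eq0 -normr_le0.
  rewrite -[leRHS](mulr0 L); apply: lpsi => // k; rewrite ltnS leq_eqVlt /upd.
  case: eqP => [_ _|_ /= kj]; first by rewrite subrr normr0.
  rewrite /walk_incr; have dS a : (a <= N)%N -> msum a w = msum a w'.
    move=> aN; apply: (determined_psum e r_mono i_r eta_det) => z za; apply: h.
    by rewrite addn0; exact: (history_mono r_mono aN).
  by rewrite !dS ?subrr ?normr0//; apply: node_mono_le => //; exact: ltnW.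
have lf w : lipschitz L (f w) by exact: upd_lip.
have bf w y : `|f w y| <= M by exact: bpsi.
pose h := (t - s) / l%:R.
have := @block_replacement R d Omega P I V mV signV indepV
  (fun k => i (N + k)%N) (fun k => r (N + k)%N) e
  _ _ _ _ (fun k => eta (N + k)%N) _ _ d' Omega' Q B hB f L M eps tau sigma s t h K l
  erefl erefl l0 eps0 L0 tau0 sg0 s0 st df lf bf.
have E1 : (fun w => f w (tau * psum V (fun k => i (N + k)%N) e (fun k => eta (N + k)%N) l w))
   = (fun w => psi (walk_incr n w)).
  apply/funext => w; rewrite /f -psum_shift Nl; congr psi; apply/funext => k.
  by rewrite /upd; case: eqP => [->|].
have E2 : (fun w => smear B (f w) sigma s t 0) =
    (fun w => Ex Q (fun w' => psi (upd (walk_incr n w) j (brownian_incr w' j)))).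
  apply/funext => w; congr (Ex Q _); apply/funext => w'.
  by rewrite /f add0r.
rewrite E1 E2 => H.
rewrite sub0r normrN; apply: le_trans (H _ _ _ _ _ _) _.
- by move=> k; rewrite addnS; exact: r_mono.
- by move=> k; rewrite addnS; exact: i_r.
- by move=> k; exact: i_new.
- by move=> k; exact: meanV.
- by move=> k; exact: eta_det.
- by move=> k w; exact: eta_sign.
have h0 : 0 < h by rewrite divr_gt0 ?ts.
have hl : l%:R * h = delta by rewrite /h ts mulrC divfK// gt_eqF.
pose u := Num.sqrt h.
have u0 : 0 <= u by rewrite sqrtr_ge0.
have u2 : u ^+ 2 = h by rewrite sqr_sqrtr// ltW.
have uq : u * q <= 2.
  rewrite -(@ler_pXn2r _ 2)// ?nnegrE ?mulr_ge0// ?(ltW q0)//.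
  rewrite exprMn u2 q2 /h ts mulrAC ler_pdivrMr//; nra.
have sg2 : sigma ^+ 2 = c ^+ 2 * (1 - e ^+ 2) by rewrite exprMn sqr_sqrtr.
have T1 : l%:R * `|tau ^+ 2 * (1 - e ^+ 2) - sigma ^+ 2 * h| <= sigma ^+ 2 / q.
  have -> : tau ^+ 2 * (1 - e ^+ 2) - sigma ^+ 2 * h = sigma ^+ 2 * (1 / n%:R - h).
    by rewrite sg2 /tau -q2; field; rewrite gt_eqF.
  rewrite normrM ger0_norm ?sqr_ge0// mulrCA ler_wpM2l ?sqr_ge0//.
  rewrite -{1}(ger0_norm (ltW lR0)) -normrM mulrBr hl.
  have -> : l%:R * (1 / n%:R) - delta = (l%:R - n%:R * delta) / n%:R.
    by field; rewrite gt_eqF.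
  rewrite normrM (ger0_norm (_ : 0 <= n%:R^-1)) ?invr_ge0 ?(ltW n0)//.
  apply: (@le_trans _ _ (1 / n%:R)).
    by rewrite ler_wpM2r ?invr_ge0 ?(ltW n0)// ler_norml l1 l2.
  rewrite mul1r lef_pV2 ?posrE// -q2; nra.
have T2 : l%:R * tau ^+ 3 <= 2 * delta * c ^+ 3 / q.
  have -> : l%:R * tau ^+ 3 = (l%:R / q ^+ 2) * (c ^+ 3 / q).
    by rewrite /tau; field; rewrite gt_eqF.
  rewrite -[leRHS]mulrA ler_wpM2r ?divr_ge0 ?exprn_ge0 ?(ltW q0)//.
  rewrite q2 ler_pdivrMr//; lra.
have T3 : l%:R * u ^+ 3 <= 2 * delta / q.
  have -> : l%:R * u ^+ 3 = delta * u by rewrite -hl -u2; ring.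
  rewrite -mulrA [leRHS]mulrCA ler_wpM2l ?(ltW delta0)//.
  by rewrite ler_pdivlMr.
have Tq : A / q <= x / 2.
  have hq : 2 * A / x <= q.
    rewrite -(@ler_pXn2r _ 2)// ?nnegrE ?(ltW q0)//; first by rewrite q2.
    by rewrite divr_ge0 ?mulr_ge0// ltW.
  rewrite ler_pdivrMr// (_ : A = x / 2 * (2 * A / x)); last by field; rewrite gt_eqF.
  by rewrite ler_wpM2l// divr_ge0// ltW.
have H4 : 4 * L * eps <= x / 2.
  rewrite /eps mulrA ler_pdivrMr ?mulr_gt0 ?ltr_wpDl//.
  have : 0 <= L * x by rewrite mulr_ge0// ltW.
  nra.
rewrite -/u (splitr x) lerD// (le_trans _ Tq)//.
have -> : l%:R * (L / eps * `|tau ^+ 2 * (1 - e ^+ 2) - sigma ^+ 2 * h| + K * (8 * tau ^+ 3) +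
   K * sigma ^+ 3 * (cube_const * u ^+ 3)) =
   L / eps * (l%:R * `|tau ^+ 2 * (1 - e ^+ 2) - sigma ^+ 2 * h|) + K * 8 * (l%:R * tau ^+ 3)
   + K * sigma ^+ 3 * cube_const * (l%:R * u ^+ 3) by ring.
have -> : A / q = L / eps * (sigma ^+ 2 / q) + K * 8 * (2 * delta * c ^+ 3 / q) +
   K * sigma ^+ 3 * cube_const * (2 * delta / q) by rewrite /A; ring.
have p1 : 0 <= L / eps by rewrite divr_ge0// ltW.
have p2 : 0 <= K * 8 by rewrite mulr_ge0.
have p3 : 0 <= K * sigma ^+ 3 * cube_const.
  apply: mulr_ge0 => //; apply: mulr_ge0 => //; exact: exprn_ge0.
by apply: lerD; [apply: lerD|]; exact: ler_wpM2l.
Unshelve. all: by end_near. Qed.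

(** Induction on the number of increments: the last one is replaced by its Brownian
counterpart and integrated out, which leaves a Lipschitz function of the
others. *)
Lemma increments_cvg j L M (psi : (nat -> R) -> R) :
  0 <= L -> lip_on j L psi -> (forall u, `|psi u| <= M) ->
  Ex P (fun w => psi (walk_incr n w)) @[n --> \oo] -->
  Ex Q (fun w => psi (brownian_incr w)).
Proof.
move=> L0; have sg0 : 0 <= sigma by rewrite mulr_ge0// sqrtr_ge0.
elim: j psi => [|j IH] psi lpsi bpsi.
  have E u v : psi u = psi v.
    by apply/eqP; rewrite -subr_eq0 -normr_le0 -[leRHS](mulr0 L); apply: lpsi.
  have -> : (fun w => psi (brownian_incr w)) = fun=> psi (fun=> 0) by exact/funext.
  rewrite Ex_cst (_ : (fun n => Ex P _) = fun=> psi (fun=> 0)); first exact: cvg_cst.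
  apply/funext => n; rewrite (_ : (fun w => _) = fun=> psi (fun=> 0)) ?Ex_cst//.
  exact/funext.
pose g u := Ex Q (fun w' => psi (upd u j (brownian_incr w' j))).
have mbm k : measurable_fun setT (fun w => brownian_incr w k).
  by apply: measurable_funM => //; exact: measurable_incr.
have bmpsi u : bm (fun w' => psi (upd u j (brownian_incr w' j))).
  have := @lip_bm _ _ _ Q 1 (fun _ w => brownian_incr w j) (fun v => psi (upd u j (v 0%N))) L M.
  apply=> //; move=> a b x x0 h; apply: lpsi => // k _; rewrite /upd.
  by case: eqP => _; [exact: h|rewrite subrr normr0].
have lg : lip_on j L g.
  move=> a b x x0 h; apply: Ex_dist; [exact: bm_integ..|] => w; apply: lpsi => // k.
  rewrite ltnS leq_eqVlt /upd; case: eqP => [_ _|_ /= kj]; last exact: h.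
  by rewrite subrr normr0.
have bg u : `|g u| <= M.
  by rewrite -[leRHS](Ex_cst Q); apply: Ex_norm; [exact: bm_integ|exact: integ_cst|].
have -> : Ex Q (fun w => psi (brownian_incr w)) = Ex Q (fun w => g (brownian_incr w)).
  pose X k (w : Omega') := incr B (k%:R * delta) (k.+1%:R * delta) w.
  pose scale (u : nat -> R) k := sigma * u k.
  have ind : mutually_independent Q (fun k : 'I_j.+1 => X k).
    case: hB => _ _ indB _; apply: (indB j.+1 (fun k => k%:R * delta)).
      by rewrite mul0r.
    by move=> a b ab; rewrite ler_wpM2r ?(ltW delta0)// ler_nat.
  have lip : lip_on j.+1 (L * sigma) (fun u => psi (scale u)).
    move=> a b x x0 h; rewrite -mulrA; apply: lpsi; first exact: mulr_ge0.
    by move=> k kj; rewrite -mulrBr normrM (ger0_norm sg0) ler_wpM2l// h.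
  have [_] := lip_integrate_out (P := Q) (x := X) (fun k _ => measurable_incr B _ _) lip
    (fun u => bpsi _) ind erefl.
  move=> ->; congr (Ex Q _); apply/funext => w; congr (Ex Q _); apply/funext => w'.
  by congr psi; apply/funext => k; rewrite /scale /upd; case: eqP.
have H1 := increment_replacement L0 lpsi bpsi.
have H2 := IH g lg bg.
rewrite -[X in _ --> X]add0r (_ : (fun n => Ex P (fun w => psi (walk_incr n w))) =
  fun n => (Ex P (fun w => psi (walk_incr n w)) - Ex P (fun w => g (walk_incr n w))) +
           Ex P (fun w => g (walk_incr n w))); first exact: cvgD H1 H2.
by apply/funext => n; rewrite subrK.
Qed.

End Increments.

(** * The trajectory of the rotor walk *)

Section Trajectory.
Variables (rho0 : int -> int) (b : nat -> int).
Hypothesis rho0_sign : forall x, rho0 x = 1 \/ rho0 x = -1.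
Hypothesis rho0_left : forall x, x < 0 -> rho0 x = 1.
Hypothesis b_sign : forall n, b n = 1 \/ b n = -1.

Definition pos n := rotor_walk rho0 b n.
Definition rotors n := (rotor_chain rho0 b n).2.

(** The rotor that the walker meets, before it is multiplied by the sign. *)
Definition rotor_at n := rotors n (pos n).

(** The running maximum of the walk; as steps have size 1, it grows by one level
at a time. *)
Fixpoint top n : nat :=
  if n is m.+1 then (if pos n == (top m)%:Z + 1 then (top m).+1 else top m) else 0%N.

Lemma posS n : pos n.+1 = pos n + b n * rotor_at n.
Proof.
rewrite /rotor_at /rotors /pos /rotor_walk /=; case: (rotor_chain rho0 b n) => x rho /=.
by rewrite eqxx.
Qed.

Lemma rotorsS n y : rotors n.+1 y = if y == pos n then b n * rotor_at n else rotors n y.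
Proof.
by rewrite /rotor_at /pos /rotors /rotor_walk /=; case: (rotor_chain rho0 b n).
Qed.

Lemma rotors_sign n y : rotors n y = 1 \/ rotors n y = -1.
Proof.
elim: n y => [|n IH] y; first exact: rho0_sign.
rewrite rotorsS; case: ifP => _ //; rewrite /rotor_at.
by case: (b_sign n) => ->; case: (IH (pos n)) => ->; [left|right|right|left].
Qed.

Lemma rotor_at_sign n : rotor_at n = 1 \/ rotor_at n = -1.
Proof. exact: rotors_sign. Qed.

Lemma pos_step n : pos n.+1 = pos n + 1 \/ pos n.+1 = pos n - 1.
Proof.
by rewrite posS; case: (b_sign n) => ->; case: (rotor_at_sign n) => ->; lia.
Qed.

(** A walker leaves every site along its rotor, so the rotors that it has used
point towards it; on the left this is the initial state as well. *)
Lemma rotors_invariant n :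
  [/\ pos n <= (top n)%:Z, forall y, y < pos n -> rotors n y = 1,
      forall y, pos n < y -> y <= (top n)%:Z -> rotors n y = -1 &
      forall y, (top n)%:Z < y -> rotors n y = rho0 y].
Proof.
elim: n => [|n [I1 I2 I3 I4]].
  split=> // y; last by rewrite /pos /rotor_walk /=; lia.
have S1 := posS n; set z := b n * rotor_at n in S1.
have z1 : z = 1 \/ z = -1.
  by rewrite /z; case: (b_sign n) => ->; case: (rotor_at_sign n) => ->;
    [left|right|right|left].
have topE : (top n.+1 = if pos n.+1 == (top n)%:Z + 1 then (top n).+1 else top n) by [].
have rS y : rotors n.+1 y = if y == pos n then z else rotors n y by exact: rotorsS.
case: z1 => zE; rewrite zE in S1 rS.
- split.
  + by rewrite topE; case: eqP => h; lia.
  + move=> y yp; rewrite rS; case: eqP => // yn; apply: I2; lia.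
  + move=> y yp yt; rewrite rS; case: eqP => [yn|yn]; first by lia.
    by apply: I3; [lia|move: yt; rewrite topE; case: eqP => h; lia].
  + move=> y yt; rewrite rS; have [h1 h2] : pos n < y /\ (top n)%:Z < y.
      by move: yt; rewrite topE; case: eqP => h; lia.
    by case: eqP => [|_]; [lia|exact: I4].
- have tE : top n.+1 = top n by rewrite topE; case: eqP => // h; lia.
  split.
  + by rewrite tE; lia.
  + move=> y yp; rewrite rS; case: eqP => yn; first by lia.
    by apply: I2; lia.
  + move=> y yp; rewrite tE rS => yt; case: eqP => // yn; apply: I3 => //; lia.
  + move=> y; rewrite tE rS => yt; case: eqP => [|_]; [lia|exact: I4].
Qed.

Lemma pos_le_top n : pos n <= (top n)%:Z.
Proof. by case: (rotors_invariant n). Qed.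

Lemma topS_ge n : (top n <= top n.+1)%N.
Proof. by rewrite /=; case: ifP => _; lia. Qed.

Lemma top_mono m n : (m <= n)%N -> (top m <= top n)%N.
Proof.
move=> /subnK <-; elim: (n - m)%N => // k IH.
by rewrite addSn; apply: leq_trans IH (topS_ge _).
Qed.

Lemma top_attained n : exists2 k, (k <= n)%N & pos k = (top n)%:Z /\ top k = top n.
Proof.
elim: n => [|n [k kn kE]]; first by exists 0%N.
have [h|h] := eqVneq (pos n.+1) ((top n)%:Z + 1).
  exists n.+1 => //; split => //; rewrite h /= h eqxx; lia.
exists k; first exact: leqW.
by rewrite /= (negbTE h).
Qed.

(** By the invariant the walker steps onto a rotor that points back, except when
it reaches a new level, where it finds the initial rotor. *)
Lemma rotor_at_next n : rotor_at n.+1 = pos n - pos n.+1 +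
  (if top n.+1 == top n then 0 else 1 + rho0 ((top n)%:Z + 1)).
Proof.
have [I1 I2 I3 I4] := rotors_invariant n.
rewrite /rotor_at rotorsS.
have -> : (pos n.+1 == pos n) = false by case: (pos_step n) => ->; lia.
case: (pos_step n) => pE; last first.
  rewrite I2; last by lia.
  have -> : top n.+1 = top n by rewrite /=; case: eqP => // h; lia.
  by rewrite eqxx; lia.
have [h|h] := eqVneq (pos n.+1) ((top n)%:Z + 1).
  have -> : (top n.+1 == top n) = false by rewrite /= h eqxx; lia.
  rewrite h I4; last by lia.
  by move: h pE; lia.
have -> : top n.+1 = top n by rewrite /= (negbTE h).
by rewrite eqxx I3; lia.
Qed.

(** In the sum of rotor_at_next over time the steps telescope and every level
contributes once, when it is reached. *)
Lemma sum_rotor_at n : \sum_(k < n.+1) rotor_at k =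
  rho0 0 - pos n + \sum_(x < top n) (1 + rho0 (x%:Z + 1)).
Proof.
elim: n => [|n IH]; first by rewrite big_ord1 big_ord0 addr0 subr0.
rewrite big_ord_recr IH /= rotor_at_next.
have [h|h] := eqVneq (pos n.+1) ((top n)%:Z + 1).
  have -> : top n.+1 = (top n).+1 by rewrite /= h eqxx.
  rewrite big_ord_recr (_ : ((top n).+1 == top n) = false); last by lia.
  by rewrite [in RHS]/=; ring.
have -> : top n.+1 = top n by rewrite /= (negbTE h).
by rewrite eqxx; ring.
Qed.

Lemma sum_steps n : pos n = \sum_(k < n) b k * rotor_at k.
Proof. by elim: n => [|n IH]; rewrite ?big_ord0// big_ord_recr posS IH. Qed.

End Trajectory.

(** * The walk as a perturbed martingale *)

Section Perturbation.
Context {R : realType}.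
Variables (rho0 : int -> int) (b : nat -> int).
Hypothesis rho0_sign : forall x, rho0 x = 1 \/ rho0 x = -1.
Hypothesis rho0_left : forall x, x < 0 -> rho0 x = 1.
Hypothesis b_sign : forall n, b n = 1 \/ b n = -1.
Variables (p alpha : R).
Hypothesis hp : 0 < p < 1.
Hypothesis halpha : 0 <= alpha <= 1.

Local Notation pos := (pos rho0 b).
Local Notation top := (top rho0 b).
Local Notation rotor_at := (rotor_at rho0 b).

Definition drift : R := 2 * p - 1.

Definition mart (k : nat) : R :=
  \sum_(j < k) ((b j)%:~R - drift) * (rotor_at j)%:~R.

(** Fluctuation of the initial rotors on the first m positive sites. *)
Definition dev (m : nat) : R :=
  \sum_(x < m) ((rho0 (x%:Z + 1))%:~R - (2 * alpha - 1)).

Lemma drift_bound : `|drift| < 1.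
Proof. by case/andP: hp => p0 p1; rewrite /drift ltr_norml; lra. Qed.

Lemma posE k : (pos k)%:~R = mart k + drift * \sum_(j < k) (rotor_at j)%:~R.
Proof.
rewrite sum_steps// mulr_sumr -big_split /= rmorph_sum /=; apply: eq_bigr => j _.
by rewrite intrM; ring.
Qed.

Lemma sum_rotor_atR k : \sum_(j < k.+1) (rotor_at j)%:~R =
  (rho0 0)%:~R - (pos k)%:~R + (2 * alpha * (top k)%:R + dev (top k)) :> R.
Proof.
rewrite -rmorph_sum /= sum_rotor_at// rmorphD rmorphB /= rmorph_sum /=.
congr (_ + _); rewrite /dev; elim: (top k) => [|m IH].
  by rewrite !big_ord0 mulr0 addr0.
by rewrite !big_ord_recr /= IH -[m.+1%:R]natr1 intrD; ring.
Qed.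

Lemma signR (z : int) : z = 1 \/ z = -1 -> `|z%:~R| = 1 :> R.
Proof. by case=> ->; rewrite ?mulrN1z ?normrN normr1. Qed.

Lemma initial_sum_bound m :
  0 <= ((\sum_(x < m) (1 + rho0 (x%:Z + 1)))%:~R : R) <= 2 * m%:R.
Proof.
elim: m => [|m]; first by rewrite big_ord0 mulr0 lexx.
rewrite big_ord_recr /= -[m.+1%:R]natr1 rmorphD /=.
by case: (rho0_sign (m%:Z + 1)) => ->; rewrite ?mulrN1z ?mulr1z; lra.
Qed.

(** When the walk attains its maximum t, the sum of the rotors that it has met is
between - t and t + 2 by sum_rotor_at, so drift times that sum accounts for
at most the fraction |drift| < 1 of t; the rest comes from the martingale. *)
Lemma top_bound n a : (forall k, (k <= n)%N -> mart k <= a) -> 0 <= a ->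
  (1 - `|drift|) * (top n)%:R <= a + 2.
Proof.
move=> ha a0; have [k kn [kE tE]] := top_attained rho0 b n.
have db := drift_bound; case: k kn kE tE => [|k] kn kE tE.
  by rewrite -tE mulr0 addr_ge0.
have H := posE k.+1; rewrite -rmorph_sum /= sum_rotor_at// rmorphD rmorphB /= in H.
have sgn := signR (rho0_sign 0); have d1 := initial_sum_bound (top k).
have kt : (pos k)%:~R <= (top k)%:R :> R.
  by rewrite -[(top k)%:R]/((top k)%:Z%:~R) ler_int; exact: pos_le_top.
have ktn : (top k)%:R <= (top n)%:R :> R by rewrite ler_nat top_mono// ltnW.
have t0 := ler0n R (top n); have := ha _ kn.
have {kE} kE : (pos k.+1)%:~R = (top n)%:R :> R by rewrite kE.
have step : (pos k)%:~R = (top n)%:R - 1 :> R.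
  have [h|h] : (pos k.+1)%:~R = (pos k)%:~R + 1 :> R \/ (pos k.+1)%:~R = (pos k)%:~R - 1 :> R.
  - by case: (pos_step rho0_sign b_sign k) => ->; rewrite ?intrB ?intrD; [left|right].
  - by move: h; rewrite kE; lra.
  - by move: h; rewrite kE; lra.
move: H; rewrite kE step; move: sgn d1 db ktn.
set r0 := (rho0 0)%:~R; set z := (\sum_(_ < _) _)%:~R; set tk := (top k)%:R; set t := (top n)%:R.
move: t0; rewrite -/t; move: r0 z tk t drift (mart k.+1) => r0 z tk t dd mm t0 sgn /andP[z0 z1] db kt' E hm.
have r01 : -1 <= r0 <= 1 by rewrite -ler_norml sgn.
case: (ger0P dd) db => d0 d1.
  have : dd * (r0 - (t - 1) + z) <= dd * (2 + t) by rewrite ler_wpM2l//; lra.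
  lra.
have : - dd * (t - 1 - r0 - z) <= - dd * t by rewrite ler_wpM2l//; lra.
lra.
Qed.

(** The sum of the rotors is eliminated between posE and sum_rotor_atR. The error
collects one step of the walk, one step of its maximum, the initial rotor at 0,
and the fluctuation of the rotors on the visited sites. *)
Lemma decomposition n A : (forall m, (m <= top n)%N -> `|dev m| <= A) ->
  forall k, (k <= n)%N ->
  `|2 * p * (pos k)%:~R - 2 * alpha * drift * (top k)%:R - mart k| <= 4 + A.
Proof.
move=> hA; have A0 : 0 <= A by apply: le_trans (hA 0%N _).
have /ltW db := drift_bound; case/andP: halpha => al0 al1.
case=> [_|k kn].
  by rewrite /mart big_ord0 /= !mulr0 !subr0 normr0 addr_ge0.
have H := posE k.+1; rewrite sum_rotor_atR in H.
have dk : `|dev (top k)| <= A by apply/hA/top_mono => //; exact: ltnW.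
have [tk1 tk2] : (top k)%:R <= (top k.+1)%:R :> R /\ (top k.+1)%:R <= (top k)%:R + 1 :> R.
  have [->|->] : top k.+1 = top k \/ top k.+1 = (top k).+1.
    by rewrite /=; case: ifP => _; [right|left].
  - by split; lra.
  - by rewrite -[(top k).+1%:R]natr1; split; lra.
have sgn := signR (rho0_sign 0).
have st : `|(pos k.+1)%:~R - (pos k)%:~R| = 1 :> R.
  rewrite -intrB; apply: signR.
  by case: (pos_step rho0_sign b_sign k) => ->; [left|right]; ring.
have E : 2 * p * (pos k.+1)%:~R - 2 * alpha * drift * (top k.+1)%:R - mart k.+1 =
  drift * (((pos k.+1)%:~R - (pos k)%:~R) + (rho0 0)%:~R
    - 2 * (alpha * ((top k.+1)%:R - (top k)%:R)) + dev (top k)).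
  have -> : 2 * p = 1 + drift by rewrite /drift; ring.
  by rewrite mulrDl mul1r {1}H; ring.
rewrite E normrM.
have at1 : `|alpha * ((top k.+1)%:R - (top k)%:R)| <= 1.
  by rewrite normrM mulr_ile1// ler_norml; lra.
set z := _ + dev _.
have z4 : `|z| <= 4 + A.
  move: sgn st dk at1; rewrite /z => sgn st.
  have := lexx `|(rho0 0)%:~R : R|; rewrite {2}sgn.
  have := lexx `|(pos k.+1)%:~R - (pos k)%:~R : R|; rewrite {2}st.
  by rewrite !ler_norml; lra.
have := normr_ge0 z; have := normr_ge0 drift; nra.
Qed.

End Perturbation.

Section PathEstimate.
Context {R : realType}.
Variables (rho0 : int -> int) (b : nat -> int).
Hypothesis rho0_sign : forall x, rho0 x = 1 \/ rho0 x = -1.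
Hypothesis rho0_left : forall x, x < 0 -> rho0 x = 1.
Hypothesis b_sign : forall n, b n = 1 \/ b n = -1.
Variables (p alpha : R).
Hypothesis hp : 0 < p < 1.
Hypothesis halpha : 0 <= alpha <= 1.

Local Notation pos := (pos rho0 b).
Local Notation top := (top rho0 b).
Local Notation mart := (mart rho0 b p).
Local Notation dev := (dev rho0 alpha).

(** The coefficient of the running supremum in the limit. *)
Definition rotor_lambda : R :=
  alpha * (2 * p - 1) / (alpha * (1 - p) + p * (1 - alpha)).

Definition mart_path (n : nat) (t : R) : R :=
  (2 * p)^-1 * mart (Num.truncn (n%:R * t)) / Num.sqrt n%:R.

Definition rescaled_walk (n : nat) (t : R) : R :=
  interpolation (fun k => (pos k)%:~R) (n%:R * t) / Num.sqrt n%:R.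

Lemma truncn_nat_div (n j : nat) : (0 < n)%N -> Num.truncn (n%:R * (j%:R / n%:R) : R) = j.
Proof.
by move=> n0; rewrite mulrC divfK ?pnatr_eq0 ?gt_eqF// natrK.
Qed.

Lemma mart_path_bounded n T : 0 <= T -> bounded_on T (mart_path n).
Proof.
move=> T0; pose K := (Num.truncn (n%:R * T)).+1.
exists (\sum_(j < K) `|(2 * p)^-1 * mart j / Num.sqrt n%:R|) => t /andP[t0 tT].
have kK : (Num.truncn (n%:R * t) < K)%N.
  by rewrite ltnS; apply: Num.Theory.le_truncn; rewrite ler_wpM2l.
rewrite (bigD1 (Ordinal kK))//= lerDl; exact: sumr_ge0.
Qed.

Lemma interpolation_near (y : nat -> R) c e t : 0 <= t ->
  `|y (Num.truncn t) - c| <= e -> `|y (Num.truncn t).+1 - c| <= e ->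
  `|interpolation y t - c| <= e.
Proof.
move=> t0; have := truncn_itv t0; rewrite /interpolation; set k := Num.truncn t.
rewrite -[k.+1%:R]natr1 !ler_norml => /andP[k1 k2] /andP[h1 h2] /andP[h3 h4].
by apply/andP; split; nra.
Qed.

(** The decomposition says that pos - kappa top is close to the martingale W. Since
pos <= top, with equality at the time when the maximum is attained, the maximum
of W up to time t is close to (1 - kappa) top. Substituting top and using
rotor_lambda (1 - kappa) = kappa gives the claim. *)
Lemma walk_near_perturb n T A : (0 < n)%N -> 0 <= T ->
  (forall m, (m <= top (Num.truncn (n%:R * T)))%N -> `|dev m| <= A) ->
  forall t, 0 <= t <= T ->
  `|rescaled_walk n t - perturb rotor_lambda (mart_path n) t|
    <= (1 + (1 + `|rotor_lambda|) * ((4 + A) / (2 * p))) / Num.sqrt n%:R.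
Proof.
move=> n0 T0 hA t /andP[t0 tT].
have /andP[p0 p1] := hp; have /andP[al0 al1] := halpha.
pose q := Num.sqrt n%:R : R; pose K := Num.truncn (n%:R * T).
pose k := Num.truncn (n%:R * t).
have nR : 0 < n%:R :> R by rewrite ltr0n.
have q0 : 0 < q by rewrite sqrtr_gt0.
have kK : (k <= K)%N by apply: Num.Theory.le_truncn; rewrite ler_wpM2l.
pose kappa := alpha * drift p / p; pose eps := (4 + A) / (2 * p).
have D0 : 0 < alpha * (1 - p) + p * (1 - alpha).
  have [->|a0] := eqVneq alpha 0; first by rewrite mul0r add0r subr0 mulr1.
  have a0' : 0 < alpha by rewrite lt_def a0.
  by rewrite ltr_pwDl ?mulr_gt0 ?mulr_ge0 ?subr_gt0 ?subr_ge0// ltW.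
have k1 : 1 - kappa = (alpha * (1 - p) + p * (1 - alpha)) / p.
  by rewrite /kappa /drift; field; rewrite gt_eqF.
have k10 : 0 < 1 - kappa by rewrite k1 divr_gt0.
have lamE : rotor_lambda * (1 - kappa) = kappa.
  by rewrite k1 /rotor_lambda /kappa /drift; field; rewrite !gt_eqF.
have dec j : (j <= K)%N -> `|(pos j)%:~R - kappa * (top j)%:R - (2 * p)^-1 * mart j| <= eps.
  move=> jK; have := decomposition rho0_sign rho0_left b_sign hp halpha hA jK.
  rewrite -/K -(@ler_pM2l _ (2 * p)^-1) ?invr_gt0 ?mulr_gt0//.
  rewrite -{1}(@ger0_norm _ (2 * p)^-1) ?invr_ge0 ?mulr_ge0 ?(ltW p0)// -normrM.
  rewrite [_ * (4 + A)]mulrC; apply: le_trans.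
  rewrite le_eqVlt; apply/orP; left; apply/eqP; congr Num.norm.
  by rewrite /kappa; field; rewrite gt_eqF.
have nt0 : 0 <= n%:R * t by rewrite mulr_ge0.
have bw := mart_path_bounded n T0.
have Hsup : `|(1 - kappa) * (top k)%:R / q - rsup (mart_path n) t| <= eps / q.
  rewrite ler_distlC; apply/andP; split; last first.
    apply: rsup_le => // s /andP[s0 st]; rewrite /mart_path -/q -mulrDl ler_wpM2r ?invr_ge0 ?(ltW q0)//.
    set j := Num.truncn _.
    have jk : (j <= k)%N by apply: Num.Theory.le_truncn; rewrite ler_wpM2l.
    have := dec j (leq_trans jk kK); rewrite ler_norml => /andP[h1 _].
    have h2 : (pos j)%:~R <= (top j)%:R :> R.
      by rewrite -[(top j)%:R]/((top j)%:Z%:~R) ler_int; exact: pos_le_top.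
    have h3 : (top j)%:R <= (top k)%:R :> R by rewrite ler_nat top_mono.
    have : (1 - kappa) * (top j)%:R <= (1 - kappa) * (top k)%:R by rewrite ler_wpM2l// ltW.
    lra.
  have [j jk [jE tE]] := top_attained rho0 b k.
  have st : 0 <= (j%:R / n%:R : R) <= t.
    apply/andP; split; first by rewrite divr_ge0.
    rewrite ler_pdivrMr// mulrC.
    by have /andP[h _] := truncn_itv nt0; apply: le_trans h; rewrite ler_nat.
  have := rsup_ub bw tT st; apply: le_trans.
  rewrite /mart_path truncn_nat_div// -/q -mulrBl ler_wpM2r ?invr_ge0 ?(ltW q0)//.
  have := dec j (leq_trans jk kK); rewrite jE tE ler_norml.
  rewrite -[((top k)%:Z)%:~R]/((top k)%:R : R) => /andP[_ h2]; lra.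
have near_pos : `|interpolation (fun k => (pos k)%:~R) (n%:R * t) - (pos k)%:~R| <= 1 :> R.
  apply: interpolation_near => //; first by rewrite subrr normr0.
  rewrite -intrB signR//.
  by case: (pos_step rho0_sign b_sign (Num.truncn (n%:R * t))) => ->; [left|right]; ring.
have := dec k kK.
have E : rescaled_walk n t - perturb rotor_lambda (mart_path n) t =
  (interpolation (fun k => (pos k)%:~R) (n%:R * t) - (pos k)%:~R) / q +
  (((pos k)%:~R - kappa * (top k)%:R - (2 * p)^-1 * mart k) / q +
   rotor_lambda * ((1 - kappa) * (top k)%:R / q - rsup (mart_path n) t)).
  rewrite /rescaled_walk /perturb {1}/mart_path -/q -/k mulrBr.
  rewrite (_ : rotor_lambda * ((1 - kappa) * (top k)%:R / q) =
    rotor_lambda * (1 - kappa) * (top k)%:R / q); last by ring.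
  by rewrite lamE; ring.
move=> dk; rewrite E [leRHS]mulrDl; apply: le_trans (ler_normD _ _) _; apply: lerD.
  rewrite normrM (ger0_norm (_ : 0 <= q^-1)) ?invr_ge0 ?(ltW q0)//.
  by rewrite ler_wpM2r ?invr_ge0 ?(ltW q0).
rewrite [_ * ((4 + A) / _)]mulrDl mul1r [leRHS]mulrDl; apply: le_trans (ler_normD _ _) _; apply: lerD.
  rewrite normrM (ger0_norm (_ : 0 <= q^-1)) ?invr_ge0 ?(ltW q0)//.
  by rewrite ler_wpM2r ?invr_ge0 ?(ltW q0).
by rewrite normrM -[leRHS]mulrA ler_wpM2l.
Qed.

End PathEstimate.

Section MeshEstimate.
Context {R : realType}.
Variables (rho0 : int -> int) (b : nat -> int) (p : R).
Hypothesis p0 : 0 < p.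

Lemma mart_path_mesh n m T a : (0 < n)%N -> (0 < m)%N -> 0 < T ->
  (forall i k, (i < m)%N -> (node (T / m%:R) n i <= k <= node (T / m%:R) n i.+1)%N ->
     `|mart rho0 b p k - mart rho0 b p (node (T / m%:R) n i)| <= a) ->
  forall t, 0 <= t <= T ->
  `|mart_path rho0 b p n t - mesh_path T m (fun j => (2 * p)^-1 / Num.sqrt n%:R *
      (mart rho0 b p (node (T / m%:R) n j.+1) - mart rho0 b p (node (T / m%:R) n j))) t|
    <= 2 * ((2 * p)^-1 * a / Num.sqrt n%:R).
Proof.
move=> n0 m0 T0 h t tT; set q := Num.sqrt n%:R; set c := (2 * p)^-1.
have q0 : 0 < q by rewrite sqrtr_gt0 ltr0n.
have c0 : 0 < c by rewrite invr_gt0 mulr_gt0.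
have nodeE i : Num.truncn (n%:R * (i%:R * T / m%:R)) = node (T / m%:R) n i.
  by rewrite /node -[i%:R * T / _]mulrA.
have E : (fun j => c / q * (mart rho0 b p (node (T / m%:R) n j.+1)
     - mart rho0 b p (node (T / m%:R) n j))) =
   (fun j => mart_path rho0 b p n (j.+1%:R * T / m%:R) - mart_path rho0 b p n (j%:R * T / m%:R)).
  by apply/funext => j; rewrite /mart_path !nodeE -/c -/q; ring.
rewrite E; apply: mesh_path_approx => //.
  by rewrite /mart_path mulr0 truncn0 /mart big_ord0 mulr0 mul0r.
move=> i s im /andP[si si'].
rewrite /mart_path nodeE -/c -/q -mulrBl -mulrBr normrM normrM.
rewrite (ger0_norm (ltW c0)) (ger0_norm (_ : 0 <= q^-1)) ?invr_ge0 ?(ltW q0)//.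
rewrite ler_wpM2r ?invr_ge0 ?(ltW q0)// ler_wpM2l ?(ltW c0)//; apply: h => //.
rewrite -!nodeE; apply/andP; split; apply: Num.Theory.le_truncn; exact: ler_wpM2l.
Qed.

End MeshEstimate.

(** * The random signs driving the walk *)

(** In N steps the walker meets rotors at distance at most N only. *)
Lemma rotor_local (rho0 rho1 : int -> int) (b b' : nat -> int) N :
  (forall n, b n = 1 \/ b n = -1) -> (forall x, rho0 x = 1 \/ rho0 x = -1) ->
  (forall x, (`|x| <= N)%N -> rho0 x = rho1 x) ->
  (forall k, (k < N)%N -> b k = b' k) ->
  forall n, (n <= N)%N ->
  [/\ pos rho0 b n = pos rho1 b' n, (`|pos rho0 b n| <= n)%N &
      forall x, (`|x| <= N)%N -> rotors rho0 b n x = rotors rho1 b' n x].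
Proof.
move=> bs rs hr hb; elim => [|n IH] nN; first by split => //.
have [I1 I2 I3] := IH (ltnW nN).
have E : b n * rotor_at rho0 b n = b' n * rotor_at rho1 b' n.
  by rewrite hb// /rotor_at -I1 I3//; apply: leq_trans I2 (ltnW nN).
split.
- by rewrite !posS -I1 E.
- by case: (pos_step rs bs n) => ->; lia.
- by move=> x xN; rewrite !rotorsS -I1 E I3.
Qed.

Section Signs.
Context {R : realType} {d : measure_display} {Omega : measurableType d}
  (P : probability Omega R).
Variables (rho0 : int -> {RV P >-> int}) (b : nat -> {RV P >-> int}).
Variables (p alpha : R).
Hypothesis hrho : alpha_0_random_configuration alpha rho0.
Hypothesis hb : iid_signs p b.
Hypothesis hind : independent_families P (fun x => rho0 x : Omega -> int)
                               (fun n => b n : Omega -> int).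

(** All the randomness of the walk as one family of independent signs. *)
Definition signs (s : int + nat) : Omega -> int :=
  match s with inl x => rho0 x | inr k => b k end.

Lemma measurable_signs s : measurable_fun setT (signs s).
Proof. by case: s => s; exact: measurable_funP. Qed.

Lemma rho0_signs x w : rho0 x w = 1 \/ rho0 x w = -1.
Proof.
case: hrho => _ h1 h2 h3; have [x0|x0|->] := ltgtP x 0.
- by case: (h1 x x0).
- by case: (h3 x x0).
- by case: h2.
Qed.

Lemma b_signs k w : b k w = 1 \/ b k w = -1.
Proof. by case: hb => _ h; case: (h k). Qed.

Lemma signs_pm1 s w : signs s w = 1 \/ signs s w = -1.
Proof. by case: s => s; [exact: rho0_signs|exact: b_signs]. Qed.

Lemma sigma_generated_bigcap {I : choiceType} (X : I -> Omega -> int) (J : {fset I}) (A : I -> set int) :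
  sigma_generated X (\bigcap_(i in [set` J]) (X i @^-1` A i)).
Proof.
pose G := \bigcup_i preimage_set_system setT (X i) measurable.
have : @measurable _ (g_sigma_algebraType G) (\bigcap_(i in [set` J]) (X i @^-1` A i)).
  apply: fin_bigcap_measurable; first exact: finite_fset.
  move=> i _; apply: sub_sigma_algebra; exists i => //.
  by exists (A i) => //; rewrite setTI.
by [].
Qed.

Lemma signs_independent : mutually_independent P signs.
Proof.
case: hrho => indr _ _ _; case: hb => indb _ J A mA.
pose JL := [fset x in pmap (fun s : int + nat => if s is inl x then Some x else None) J]%fset.
pose JR := [fset x in pmap (fun s : int + nat => if s is inr x then Some x else None) J]%fset.
have memL x : (x \in JL) = (inl x \in J).
  rewrite !inE mem_pmap; apply/mapP/idP => [[[y|y]//= yJ [->]]//|xJ].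
  by exists (inl x).
have memR x : (x \in JR) = (inr x \in J).
  rewrite !inE mem_pmap; apply/mapP/idP => [[[y|y]//= yJ [->]]//|xJ].
  by exists (inr x).
have perm : perm_eq J (map inl JL ++ map inr JR).
  apply: uniq_perm; first exact: fset_uniq.
    rewrite cat_uniq !map_inj_uniq ?fset_uniq//=; try by move=> x y [].
    by rewrite andbT; apply/hasPn => _ /mapP[y _ ->]; apply/mapP => -[].
  move=> [x|x]; rewrite mem_cat.
    rewrite mem_map; last by move=> ? ? [].
    rewrite memL; case: (inl x \in J) => //=; apply/esym/mapP => -[] //.
  rewrite orbC mem_map; last by move=> ? ? [].
  by rewrite memR; case: (inr x \in J) => //=; apply/esym/mapP => -[].
rewrite (perm_big _ perm) big_cat !big_map /=.
have -> : \bigcap_(i in [set` J]) (signs i @^-1` A i) =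
   (\bigcap_(x in [set` JL]) (rho0 x @^-1` A (inl x))) `&`
   (\bigcap_(x in [set` JR]) (b x @^-1` A (inr x))).
  apply/seteqP; split => w /= h.
    split=> x /=; first by rewrite memL => /h.
    by rewrite memR => /h.
  case: h => h1 h2 [x|x] xJ; first by apply: h1; rewrite /= memL.
  by apply: h2; rewrite /= memR.
rewrite hind; [|exact: sigma_generated_bigcap|exact: sigma_generated_bigcap].
by rewrite (indr JL (fun x => A (inl x)))// (indb JR (fun x => A (inr x))).
Qed.

Lemma sign_law_mean q (X : {RV P >-> int}) : sign_law q X ->
  Ex P (fun w => (X w)%:~R) = 2 * q - 1.
Proof.
move=> [h1 h2 h3].
have mfX : measurable_fun setT (X : Omega -> int) by exact: measurable_funP.
have mX z : measurable [set w | X w = z].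
  by rewrite -[X in measurable X]setTI; exact: (mfX measurableT [set z]).
have E : (fun w => (X w)%:~R : R) = (fun w => \1_[set w | X w = 1] w - \1_[set w | X w = -1] w).
  apply/funext => w; rewrite !indicE; case: (h1 w) => Xw.
    rewrite mem_set// memNset ?Xw ?subr0//=; first by rewrite Xw.
  rewrite memNset; last by rewrite /= Xw.
  by rewrite mem_set//= Xw sub0r mulrN1z.
have bI z : bm (\1_[set w | X w = z] : Omega -> R).
  split; first exact/measurable_indic.
  by exists 1 => w; rewrite indicE ger0_norm// lern1 leq_b1.
rewrite E ExB; [|exact/bm_integ..].
rewrite !Ex_indic// h2 h3 /=; ring.
Qed.

Lemma mean_b k : Ex P (fun w => (signs (inr k) w)%:~R) = 2 * p - 1.
Proof. by case: hb => _ h; exact: sign_law_mean. Qed.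

Lemma mean_rho0 x : 0 < x -> Ex P (fun w => (signs (inl x) w)%:~R) = 2 * alpha - 1.
Proof. by move=> x0; case: hrho => _ _ _ h; exact/sign_law_mean/h. Qed.

(** All initial rotors within distance k and the first k signs. *)
Definition history (k : nat) : seq (int + nat) :=
  [seq inl (z%:Z - k%:Z) | z <- iota 0 k.*2.+1] ++ [seq inr j | j <- iota 0 k].

Lemma mem_history_l k (x : int) : (inl x \in history k) = (`|x| <= k)%N.
Proof.
rewrite mem_cat [X in _ || X](_ : _ = false); last by apply/mapP => -[].
rewrite orbF; apply/mapP/idP => [[z]|xk].
  by rewrite mem_iota => zk [->]; lia.
exists (`|(x + k%:Z)%R|%N); first by rewrite mem_iota; lia.
by congr inl; lia.
Qed.

Lemma mem_history_r k j : (inr j \in history k) = (j < k)%N.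
Proof.
rewrite mem_cat [X in X || _](_ : _ = false); last by apply/mapP => -[].
by rewrite mem_map ?mem_iota// => ? ? [].
Qed.

Lemma history_step k : {subset history k <= history k.+1}.
Proof.
by move=> [x|j]; rewrite ?mem_history_l ?mem_history_r; [exact: leqW|exact: ltnW].
Qed.

Lemma history_next k : inr k \in history k.+1.
Proof. by rewrite mem_history_r. Qed.

Lemma history_new k : inr k \notin history k.
Proof. by rewrite mem_history_r ltnn. Qed.

(** The initial rotors to the left of the origin equal 1 almost surely; setting
them to 1 makes the deterministic estimates hold everywhere and changes the
configuration on a null set. *)
Definition config (w : Omega) (x : int) : int := if x < 0 then 1 else rho0 x w.

Lemma config_sign w x : config w x = 1 \/ config w x = -1.
Proof. by rewrite /config; case: ifP => _; [left|exact: rho0_signs]. Qed.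

Lemma config_left w x : x < 0 -> config w x = 1.
Proof. by rewrite /config => ->. Qed.

Local Notation bs w := (fun k => b k w).

Lemma history_rotor N w w' : {in history N, forall s, signs s w = signs s w'} ->
  forall n, (n <= N)%N -> pos (config w) (bs w) n = pos (config w') (bs w') n /\
    rotor_at (config w) (bs w) n = rotor_at (config w') (bs w') n.
Proof.
move=> h n nN.
have [|||| h1 h2 h3] := @rotor_local (config w) (config w') (bs w) (bs w') N _ _ _ _ n nN.
- by move=> k; exact: b_signs.
- exact: config_sign.
- move=> x xN; rewrite /config; case: ifP => // _.
  by apply: (h (inl x)); rewrite mem_history_l.
- by move=> k kN; apply: (h (inr k)); rewrite mem_history_r.
split => //; rewrite /rotor_at -h1 h3//; exact: leq_trans h2 nN.
Qed.

Lemma history_pos N w w' : {in history N, forall s, signs s w = signs s w'} ->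
  forall n, (n <= N)%N ->
  pos (fun x => rho0 x w) (bs w) n = pos (fun x => rho0 x w') (bs w') n.
Proof.
move=> h n nN.
have [|||| h1 _ _] := @rotor_local (fun x => rho0 x w) (fun x => rho0 x w')
  (bs w) (bs w') N _ _ _ _ n nN => //.
- by move=> k; exact: b_signs.
- by move=> x; exact: rho0_signs.
- by move=> x xN; apply: (h (inl x)); rewrite mem_history_l.
- by move=> k kN; apply: (h (inr k)); rewrite mem_history_r.
Qed.

Lemma determined_rotor_at n : determined signs (history n) (fun w => (rotor_at (config w) (bs w) n)%:~R : R).
Proof. by move=> w w' /history_rotor/(_ n (leqnn n))[_ ->]. Qed.

Lemma rotor_at_sqr n w : ((rotor_at (config w) (bs w) n)%:~R : R) ^+ 2 = 1.
Proof.
by case: (rotor_at_sign (config_sign w) (fun k => b_signs k w) n) => ->;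
  rewrite ?mulrN1z ?sqrrN expr1n.
Qed.

Lemma config_ae : {ae P, forall w, config w = (fun x => rho0 x w)}.
Proof.
pose F (x : nat) := [set w | rho0 (- (x.+1%:Z)) w = 1].
have mF x : measurable (F x).
  have mf : measurable_fun setT (rho0 (- (x.+1%:Z)) : Omega -> int) by exact: measurable_funP.
  by rewrite -[X in measurable X]setTI; exact: (mf measurableT [set 1]).
have : {ae P, forall w, forall x : nat, rho0 (- (x.+1%:Z)) w = 1}.
  apply/ae_foralln => x.
  exists (~` F x); split => //; first exact: measurableC.
  rewrite [LHS](probability_setC P)//; case: hrho => _ h1 _ _.
  have [|_ -> _] := h1 (- (x.+1%:Z)); first by lia.
  by rewrite subee.
apply: filterS => w h; apply/funext => x; rewrite /config; case: ltP => // x0.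
by rewrite -(h `|x|.-1); congr (rho0 _ _); lia.
Qed.

End Signs.

(** * Approximation of the walk along a mesh *)

Section WalkApproximation.
Context {R : realType} {d : measure_display} {Omega : measurableType d}
  (P : probability Omega R).
Variables (rho0 : int -> {RV P >-> int}) (b : nat -> {RV P >-> int}).
Variables (p alpha : R).
Hypothesis hp : 0 < p < 1.
Hypothesis halpha : 0 <= alpha <= 1.
Hypothesis hrho : alpha_0_random_configuration alpha rho0.
Hypothesis hb : iid_signs p b.
Hypothesis hind : independent_families P (fun x => rho0 x : Omega -> int)
                               (fun n => b n : Omega -> int).
Variable (T : R).
Hypothesis T0 : 0 < T.

Local Notation bs w := (fun k => b k w).
Local Notation V := (signs rho0 b).
Local Notation e := (2 * p - 1).
Local Notation lam := (rotor_lambda p alpha).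

Definition coef n w : R := (rotor_at (config rho0 w) (bs w) n)%:~R.

Definition walk n w (t : R) : R := rescaled_walk (config rho0 w) (bs w) n t.

Lemma mart_psum k w : mart (config rho0 w) (bs w) p k = psum V inr e coef k w.
Proof. by []. Qed.

(* The initial rotors to the right of the origin, as a sequence of signs. *)
Let site (x : nat) : int + nat := inl (x%:Z + 1).
Let sites (x : nat) : seq (int + nat) := [seq site z | z <- iota 0 x].

Let site_inj : injective site.
Proof. by move=> x y [h]; lia. Qed.

(** The fluctuation of the initial rotors is a sum of independent centered signs with
coefficients 1, so the maximal inequality applies to it too. *)
Lemma dev_psum m w : dev (config rho0 w) alpha m =
  psum V site (2 * alpha - 1) (fun _ _ => 1) m w.
Proof.
apply: eq_bigr => x _; rewrite mulr1 /noise /= /config.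
by case: ltP => //; lia.
Qed.

Let mV := measurable_signs rho0 b.
Let signV := signs_pm1 hrho hb.
Let indepV := signs_independent hrho hb hind.

Lemma coef_norm k w : `|coef k w| <= 1.
Proof.
rewrite /coef signR//; apply: rotor_at_sign; first exact: config_sign hrho w.
by move=> j; exact: b_signs hb j w.
Qed.

Lemma determined_coef k : determined V (history k) (coef k).
Proof. exact: determined_rotor_at hrho hb k. Qed.

Lemma deviation_probability m a : 0 < a ->
  bm (fun w => (exceeds V site (2 * alpha - 1) (fun _ _ => 1) a m w)%:R : R) /\
  Ex P (fun w => (exceeds V site (2 * alpha - 1) (fun _ _ => 1) a m w)%:R)
    <= 80 * m%:R ^+ 2 / a ^+ 4.
Proof.
move=> a0.
have sm k : {subset sites k <= sites k.+1}.
  by move=> s /mapP[z]; rewrite mem_iota => zk ->; apply: map_f; rewrite mem_iota; lia.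
have si k : site k \in sites k.+1 by apply: map_f; rewrite mem_iota; lia.
have sn k : site k \notin sites k by rewrite mem_map// mem_iota; lia.
have me k : Ex P (fun w => (V (site k) w)%:~R) = 2 * alpha - 1.
  by apply: mean_rho0 hrho _ _; lia.
have dc k : determined V (sites k) (fun _ : Omega => 1 : R) by [].
split; last first.
  apply: (maximal_inequality mV signV indepV sm si sn me dc) => //.
  by move=> k w; rewrite normr1.
have bV s w : (`|V s w| <= 1)%N by case: (signV s w) => ->.
apply: (determined_bm mV bV (r := sites m)).
by move=> w w' h; rewrite (determined_exceeds (2 * alpha - 1) sm si dc a h).
Qed.

Section Block.
Variables (N : nat).

(** The martingale moves by a or more within the l steps after time N. *)
Definition escapes (a : R) l w : bool :=
  exceeds V (fun k => inr (N + k)%N) e (fun k => coef (N + k)%N) a l w.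

Lemma escape_probability l a : 0 < a ->
  bm (fun w => (escapes a l w)%:R : R) /\
  Ex P (fun w => (escapes a l w)%:R) <= 80 * l%:R ^+ 2 / a ^+ 4.
Proof.
move=> a0; rewrite /escapes.
have sm k : {subset history (N + k)%N <= history (N + k.+1)%N}.
  by rewrite addnS; exact: history_step.
have si k : (inr (N + k)%N : int + nat) \in history (N + k.+1)%N.
  by rewrite addnS; exact: history_next.
have sn k : (inr (N + k)%N : int + nat) \notin history (N + k)%N by exact: history_new.
have me k : Ex P (fun w => (V (inr (N + k)%N) w)%:~R) = e by exact: mean_b.
have dc k : determined V (history (N + k)%N) (coef (N + k)%N) by exact: determined_coef.
split; last first.
  apply: (maximal_inequality mV signV indepV sm si sn me dc) => //.
  by move=> k w; exact: coef_norm.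
have bV s w : (`|V s w| <= 1)%N by case: (signV s w) => ->.
apply: (determined_bm mV bV (r := history (N + l)%N)).
by move=> w w' h; rewrite (determined_exceeds e sm si dc a h).
Qed.

Lemma not_escapes a l w k : ~~ escapes a l w -> (k <= l)%N ->
  `|mart (config rho0 w) (bs w) p (N + k) - mart (config rho0 w) (bs w) p N| < a.
Proof.
rewrite negb_exists => /forallP h kl.
have := h (Ordinal (kl : (k < l.+1)%N)); rewrite -ltNge /= -psum_shift.
by rewrite !mart_psum.
Qed.

End Block.

Variables (L M : R) (Psi : (R -> R) -> R).
Hypothesis L0 : 0 <= L.
Hypothesis lipPsi : bounded_lip T M L Psi.

Definition mesh_functional (m : nat) (x : nat -> R) := Psi (perturb lam (mesh_path T m x)).

Lemma mesh_path_bounded m x : bounded_on T (mesh_path T m x).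
Proof. by apply: ucont_bounded; [exact: ltW|apply/mesh_path_ucont/ltW]. Qed.

Lemma mesh_functional_lip m :
  lip_on m (L * ((1 + `|lam|) * m%:R)) (mesh_functional m).
Proof.
move=> u v a a0 h; case: lipPsi => _ lip.
have uc x : ucont T (perturb lam (mesh_path T m x)).
  by apply: perturb_ucont; [exact: ltW|apply/mesh_path_ucont/ltW].
rewrite -mulrA; apply: lip => // t tT; rewrite -mulrA.
apply: (perturb_lip (T := T)) => // [||s /andP[s0 sT]]; [exact: mesh_path_bounded..|].
exact: mesh_path_lip.
Qed.

Lemma mesh_functional_bound m x : `|mesh_functional m x| <= M.
Proof.
case: lipPsi => h _; apply/h/perturb_ucont; first exact: ltW.
by apply/mesh_path_ucont/ltW.
Qed.

Lemma rescaled_walk_ucont rho s n : ucont T (@rescaled_walk R rho s n).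
Proof.
rewrite /rescaled_walk; under eq_fun do rewrite mulrC.
by apply/ucontZ/interpolation_ucont => //; exact: ltW.
Qed.

Definition walk_mesh m n w := walk_incr V inr e coef (2 * p)^-1 (T / m%:R) n w.

(** The walk is first compared with the perturbed martingale, and then the
martingale with its interpolation along the mesh. *)
Lemma walk_near_mesh m n w A a : (0 < n)%N -> (0 < m)%N ->
  (forall m', (m' <= top (config rho0 w) (bs w) (Num.truncn (n%:R * T)))%N ->
     `|dev (config rho0 w) alpha m'| <= A) ->
  (forall i, (i < m)%N -> ~~ escapes (node (T / m%:R) n i) a
     (node (T / m%:R) n i.+1 - node (T / m%:R) n i) w) ->
  `|Psi (walk n w) - mesh_functional m (walk_mesh m n w)| <=
  L * ((1 + (1 + `|lam|) * ((4 + A) / (2 * p))) / Num.sqrt n%:R +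
       (1 + `|lam|) * (2 * ((2 * p)^-1 * a / Num.sqrt n%:R))).
Proof.
move=> n0 m0 hA hosc; have p0 : 0 < p by case/andP: hp.
case: lipPsi => _ lip; apply: lip.
- exact: rescaled_walk_ucont.
- by apply: perturb_ucont; [exact: ltW|apply/mesh_path_ucont/ltW].
move=> t tT.
have rs := config_sign hrho w.
have bsg k : b k w = 1 \/ b k w = -1 by exact: b_signs hb k w.
rewrite -(subrKA (perturb lam (mart_path (config rho0 w) (bs w) p n) t)).
apply: le_trans (ler_normD _ _) _; apply: lerD.
  exact: (walk_near_perturb rs (config_left rho0 w) bsg hp halpha n0 (ltW T0) hA tT).
apply: (perturb_lip (T := T)) => //.
- exact/mart_path_bounded/ltW.
- exact: mesh_path_bounded.
move=> s sT; apply: (mart_path_mesh p0) => // i k im /andP[ik ki].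
have [j kE] : exists j, k = (node (T / m%:R) n i + j)%N.
  by exists (k - node (T / m%:R) n i)%N; rewrite subnKC.
rewrite kE; apply/ltW/(not_escapes (hosc i im)).
by rewrite kE in ki; rewrite leq_subRL// node_mono// divr_gt0// ltr0n.
Qed.

(** Up to time T the rescaled walk is determined by finitely many signs. *)
Lemma rescaled_walk_bm (conf : Omega -> int -> int) n Phi :
  (forall N w w', {in history N, forall s, V s w = V s w'} ->
     forall k, (k <= N)%N -> pos (conf w) (bs w) k = pos (conf w') (bs w') k) ->
  (forall f g, ucont T f -> ucont T g -> close T 0 f g -> Phi f = Phi g) ->
  bm (fun w => Phi (rescaled_walk (conf w) (bs w) n) : R).
Proof.
move=> hconf invPhi; have bV s w : (`|V s w| <= 1)%N by case: (signV s w) => ->.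
apply: (determined_bm mV bV (r := history (Num.truncn (n%:R * T)).+1)) => w w' h.
apply: invPhi => [||t /andP[t0 tT]]; [exact: rescaled_walk_ucont..|].
have kK : (Num.truncn (n%:R * t) <= Num.truncn (n%:R * T))%N.
  by apply: Num.Theory.le_truncn; rewrite ler_wpM2l.
rewrite /rescaled_walk /interpolation !(hconf _ _ _ h) ?ltnS ?(leqW kK)//.
by rewrite subrr normr0.
Qed.

Lemma walk_bm n Phi :
  (forall f g, ucont T f -> ucont T g -> close T 0 f g -> Phi f = Phi g) ->
  bm (fun w => Phi (walk n w) : R).
Proof.
move=> invPhi; apply: rescaled_walk_bm => // N w w' h k kN.
by case: (history_rotor hrho hb h kN).
Qed.

(** Three events are bad: the martingale exceeds th0 sqrt n before time n T; the
initial rotors on the sites visited by then fluctuate by more than th sqrt n;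
the martingale moves by more than th sqrt n within one of the m blocks. Outside
them walk_near_mesh applies, and on them the difference is at most 2 M. Their
probabilities are bounded by the maximal inequality. *)
Lemma walk_error m n th th0 : (0 < n)%N -> (0 < m)%N -> 1 <= n%:R * (T / m%:R) ->
  0 < th -> 0 < th0 ->
  `|Ex P (fun w => Psi (walk n w)) - Ex P (fun w => mesh_functional m (walk_mesh m n w))|
  <= L * ((1 + `|lam|) * (3 * th / (2 * p))) +
     L * ((1 + (1 + `|lam|) * (4 / (2 * p))) / Num.sqrt n%:R) +
     2 * M * (80 * T ^+ 2 / th0 ^+ 4 +
       80 * ((th0 + 2) / (1 - `|drift p|)) ^+ 2 / th ^+ 4 / Num.sqrt n%:R +
       320 * T ^+ 2 / (m%:R * th ^+ 4)).
Proof.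
move=> n0 m0 nTm th_0 th0_0; have p0 : 0 < p by case/andP: hp.
pose q := Num.sqrt n%:R : R.
have nR : 0 < n%:R :> R by rewrite ltr0n.
have mR : 0 < m%:R :> R by rewrite ltr0n.
have q0 : 0 < q by rewrite sqrtr_gt0.
have q2 : q ^+ 2 = n%:R by rewrite sqr_sqrtr// ltW.
have q1 : 1 <= q by rewrite -[1]sqrtr1 ler_sqrt// ler1n.
have M0 : 0 <= M by apply: le_trans (normr_ge0 _) (mesh_functional_bound 0 (fun=> 0)).
have D0 : 0 < 1 - `|drift p| by rewrite subr_gt0 drift_bound.
pose delta := T / m%:R; have delta0 : 0 < delta by rewrite divr_gt0.
pose a := th * q; pose a0 := th0 * q.
have a_0 : 0 < a by rewrite mulr_gt0.
have a0_0 : 0 < a0 by rewrite mulr_gt0.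
pose K := Num.truncn (n%:R * T).
(* The walk stays below level H unless the martingale exceeds a0 (top_bound). *)
pose H := Num.truncn ((a0 + 2) / (1 - `|drift p|)).
pose l i := (node delta n i.+1 - node delta n i)%N.
pose Btop w : R := (escapes 0 a0 K w)%:R.
pose Bdev w : R := (exceeds V site (2 * alpha - 1) (fun _ _ => 1) a H w)%:R.
pose Bosc i w : R := (escapes (node delta n i) a (l i) w)%:R.
have [bt Et] := escape_probability 0 K a0_0.
have [bd Ed] := deviation_probability H a_0.
have bo i : bm (Bosc i) by case: (escape_probability (node delta n i) (l i) a_0).
have Eo i : Ex P (Bosc i) <= 80 * (l i)%:R ^+ 2 / a ^+ 4.
  by case: (escape_probability (node delta n i) (l i) a_0).
pose bnd := L * ((1 + (1 + `|lam|) * ((4 + a) / (2 * p))) / q +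
       (1 + `|lam|) * (2 * ((2 * p)^-1 * a / q))).
pose bad w := Btop w + Bdev w + \sum_(i < m) Bosc i w.
have bbad : bm bad.
  by apply: bmD; [exact: bmD|apply: bm_sum].
have bnd0 : 0 <= bnd.
  have x1 : 0 <= (4 + a) / (2 * p) by apply: divr_ge0; lra.
  have x2 : 0 <= (2 * p)^-1 * a / q.
    by apply: divr_ge0; [apply: mulr_ge0; [rewrite invr_ge0; lra|lra]|lra].
  have x3 : 0 <= 1 + `|lam| by rewrite addr_ge0.
  apply: mulr_ge0 => //; apply: addr_ge0; last by apply: mulr_ge0 => //; apply: mulr_ge0.
  by apply: divr_ge0; [apply: addr_ge0 => //; exact: mulr_ge0|exact: ltW].
have B0 (x : bool) : 0 <= x%:R :> R by [].
have point w : `|Psi (walk n w) - mesh_functional m (walk_mesh m n w)| <= bnd + 2 * M * bad w.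
  have s0 : 0 <= \sum_(i < m) Bosc i w by apply: sumr_ge0.
  have big : 1 <= bad w ->
      `|Psi (walk n w) - mesh_functional m (walk_mesh m n w)| <= bnd + 2 * M * bad w.
    move=> b1; apply: (@le_trans _ _ (2 * M)).
      apply: le_trans (ler_normB _ _) _; rewrite mulr2n mulrDl mul1r.
      by rewrite lerD ?mesh_functional_bound//; case: lipPsi => h _; exact/h/rescaled_walk_ucont.
    have : 2 * M * 1 <= 2 * M * bad w by rewrite ler_wpM2l ?mulr_ge0.
    lra.
  have [et|nt] := boolP (escapes 0 a0 K w).
    by apply: big; rewrite /bad /Btop et -addrA lerDl addr_ge0.
  have [ed|nd] := boolP (exceeds V site (2 * alpha - 1) (fun _ _ => 1) a H w).
    by apply: big; rewrite /bad /Bdev ed addrAC lerDr addr_ge0.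
  have [/existsP[i ei]|no] := boolP [exists i : 'I_m, escapes (node delta n i) a (l i) w].
    apply: big; have -> : bad w = 1 + (Btop w + Bdev w + \sum_(j < m | j != i) Bosc j w).
      by rewrite /bad (bigD1 i)//= addrCA /Bosc ei.
    by rewrite lerDl; apply: addr_ge0; [exact: addr_ge0|exact: sumr_ge0].
  apply: (@le_trans _ _ bnd); last first.
    by rewrite lerDl mulr_ge0 ?mulr_ge0// /bad !addr_ge0.
  apply: walk_near_mesh => // [m' m'H|i im]; last first.
    by move: no; rewrite negb_exists => /forallP/(_ (Ordinal im)).
  have tH : (top (config rho0 w) (bs w) K <= H)%N.
    rewrite -[X in (X <= _)%N](@natrK R); apply: Num.Theory.le_truncn.
    rewrite ler_pdivlMr// mulrC.
    apply: (top_bound (config_sign hrho w) (config_left rho0 w)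
      (fun k => b_signs hb k w) hp) => [k kK|]; last exact: ltW.
    have := not_escapes nt kK; rewrite add0n [X in _ - X]/mart big_ord0 subr0.
    by move=> /ltW; apply: le_trans; exact: ler_norm.
  have m'H' : (m' < H.+1)%N by rewrite ltnS (leq_trans m'H).
  move: nd; rewrite negb_exists => /forallP/(_ (Ordinal m'H')).
  by rewrite -ltNge /= -dev_psum => /ltW.
have bW : bm (fun w => mesh_functional m (walk_mesh m n w)).
  suff mx j : measurable_fun setT (fun w => walk_mesh m n w j).
    exact: (lip_bm P (x := fun j w => walk_mesh m n w j) (fun j _ => mx j)
      (mesh_functional_lip (m := m)) (mesh_functional_bound m)).
  have bV s w : (`|V s w| <= 1)%N by case: (signV s w) => ->.
  suff dW : determined V (history (node delta n j.+1)) (fun w => walk_mesh m n w j).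
    by have [] := determined_bm mV bV dW.
  move=> w w' h.
  rewrite /walk_mesh /walk_incr -/delta; congr (_ * (_ - _)).
    exact: (determined_psum e (@history_step) (@history_next) determined_coef h).
  apply: (determined_psum e (@history_step) (@history_next) determined_coef (n := node delta n j)) => s sj.
  by apply: h; apply: (history_mono (@history_step)) sj; exact: node_mono.
have bY : bm (fun w => Psi (walk n w)).
  apply: walk_bm.
  by move=> f g uf ug fg; exact: bounded_lip_invariant lipPsi uf ug fg.
have iBt := bm_integ P bt; have iBd := bm_integ P bd.
have iBs : integ P (fun w => \sum_(i < m) Bosc i w) by apply/bm_integ/bm_sum.
rewrite -(ExB (bm_integ P bY) (bm_integ P bW)).
apply: (@le_trans _ _ (Ex P (fun w => bnd + 2 * M * bad w))).
  apply: Ex_norm => //; first by apply/bm_integ/bmB.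
  by apply: integD; [exact: integ_cst|apply/integZ/bm_integ].
have i1 : integ P (fun w => 2 * M * bad w) by apply/integZ/bm_integ.
rewrite (ExD (integ_cst P bnd) i1) Ex_cst (ExZ _ (bm_integ P bbad)).
rewrite (ExD (integD iBt iBd) iBs) (ExD iBt iBd).
rewrite (Ex_sum P (F := Bosc))//.
have K1 : K%:R <= n%:R * T :> R.
  by have /andP[] := truncn_itv (mulr_ge0 (ltW nR) (ltW T0)).
have sq (x y : R) : 0 <= x -> x <= y -> x ^+ 2 <= y ^+ 2.
  by move=> x0 xy; rewrite lerXn2r// nnegrE// (le_trans x0).
have aq4 : a ^+ 4 = th ^+ 4 * n%:R ^+ 2 by rewrite exprMn -q2; ring.
have a0q4 : a0 ^+ 4 = th0 ^+ 4 * n%:R ^+ 2 by rewrite exprMn -q2; ring.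
have b1 : Ex P Btop <= 80 * T ^+ 2 / th0 ^+ 4.
  apply: le_trans Et _; rewrite a0q4 ler_pdivrMr ?mulr_gt0 ?exprn_gt0//.
  rewrite (_ : 80 * T ^+ 2 / th0 ^+ 4 * (th0 ^+ 4 * n%:R ^+ 2) = 80 * (n%:R * T) ^+ 2).
    by rewrite ler_wpM2l//; apply: sq.
  by field; rewrite gt_eqF.
have b2 : Ex P Bdev <= 80 * ((th0 + 2) / (1 - `|drift p|)) ^+ 2 / th ^+ 4 / q.
  apply: le_trans Ed _.
  have H1 : H%:R <= (th0 + 2) / (1 - `|drift p|) * q.
    have x0 : 0 <= (a0 + 2) / (1 - `|drift p|) by apply: divr_ge0; lra.
    have /andP[h _] := truncn_itv x0; apply: le_trans h _.
    rewrite ler_pdivrMr// mulrAC mulfVK ?gt_eqF// /a0; nra.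
  rewrite aq4 ler_pdivrMr ?mulr_gt0 ?exprn_gt0//.
  set g := (th0 + 2) / _ in H1 *.
  have g0 : 0 <= g by apply: divr_ge0; lra.
  have -> : 80 * g ^+ 2 / th ^+ 4 / q * (th ^+ 4 * n%:R ^+ 2) = 80 * ((g * q) ^+ 2 * q).
    by rewrite -q2; field; rewrite !gt_eqF.
  rewrite ler_wpM2l//; apply: (@le_trans _ _ ((g * q) ^+ 2)).
    exact: sq.
  by rewrite ler_peMr// sqr_ge0.
have b3 : \sum_(i < m) Ex P (Bosc i) <= 320 * T ^+ 2 / (m%:R * th ^+ 4).
  apply: (@le_trans _ _ (\sum_(i < m) (320 * delta ^+ 2 / th ^+ 4))).
    apply: ler_sum => i _; apply: le_trans (Eo i) _.
    (* A block has at most n delta + 1 steps, and 1 <= n delta. *)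
    have l1 : (l i)%:R <= 2 * (n%:R * delta).
      have := node_length delta0 n i; rewrite ler_norml -/(l i) => /andP[_ h].
      by move: nTm h; rewrite -/delta; lra.
    rewrite aq4 ler_pdivrMr ?mulr_gt0 ?exprn_gt0//.
    have -> : 320 * delta ^+ 2 / th ^+ 4 * (th ^+ 4 * n%:R ^+ 2) = 80 * (2 * (n%:R * delta)) ^+ 2.
      by field; rewrite gt_eqF.
    by rewrite ler_wpM2l//; apply: sq.
  rewrite sumr_const card_ord -mulr_natl le_eqVlt; apply/orP; left; apply/eqP.
  by rewrite /delta; field; rewrite !gt_eqF.
have bE : bnd = L * ((1 + `|lam|) * (3 * th / (2 * p))) +
     L * ((1 + (1 + `|lam|) * (4 / (2 * p))) / q).
  by rewrite /bnd /a; field; rewrite !gt_eqF.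
rewrite bE lerD2l ler_wpM2l ?mulr_ge0//; apply: lerD => //; exact: lerD.
Qed.

End WalkApproximation.

(** * Approximation of the limit along a mesh *)

Section BrownianApproximation.
Context {R : realType} {d : measure_display} {Omega : measurableType d}
  (Q : probability Omega R) (B : R -> {RV Q >-> R}).
Hypothesis hB : brownian_motion B.
Variables (T : R) (p alpha : R).
Hypothesis T0 : 0 < T.

Local Notation lam := (rotor_lambda p alpha).

Definition scaled_brownian (sg : R) (w : Omega) (t : R) : R := sg * B t w.

Lemma brownian_ucont w : ucont T (fun t => B t w).
Proof.
apply/C0T_ucont; case: hB => _ cB _ _.
apply: continuous_subspaceW (cB w) => t /=.
by rewrite !in_itv /= => /andP[-> _].
Qed.

Lemma scaled_brownian_ucont sg w : ucont T (scaled_brownian sg w).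
Proof. exact/ucontZ/brownian_ucont. Qed.

Lemma perturb_scaled sg w t : 0 <= sg -> 0 <= t <= T ->
  perturb lam (scaled_brownian sg w) t = sg * (B t w + lam * running_sup B t w).
Proof.
move=> sg0 tT; rewrite /perturb [rsup _ _](rsupZ (T := T)) ?mulrDr//; last first.
  by apply: ucont_bounded (brownian_ucont w); exact: ltW.
by congr (_ + _); rewrite mulrCA.
Qed.

Lemma brownian_incrE e c m w j :
  brownian_incr e B c (T / m%:R) w j =
  scaled_brownian (sigma e c) w (j.+1%:R * T / m%:R) - scaled_brownian (sigma e c) w (j%:R * T / m%:R).
Proof. by rewrite /brownian_incr /incr /scaled_brownian mulrBr !mulrA. Qed.

(** Every Brownian path is uniformly continuous on [0, T], so its interpolations
converge to it uniformly. *)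
Lemma brownian_mesh_cvg e c L M Psi : 0 <= L -> bounded_lip T M L Psi ->
  bm (fun w => Psi (perturb lam (scaled_brownian (sigma e c) w))) /\
  Ex Q (fun w => mesh_functional p alpha T Psi m (brownian_incr e B c (T / m%:R) w))
    @[m --> \oo] -->
  Ex Q (fun w => Psi (perturb lam (scaled_brownian (sigma e c) w))).
Proof.
move=> L0 lipPsi; have [_ lip] := lipPsi; set sg := sigma e c.
apply: (@bm_cvg _ _ _ _ (fun m w =>
    mesh_functional p alpha T Psi m (brownian_incr e B c (T / m%:R) w)) _ M).
- move=> m.
  apply: (lip_bm Q (x := fun j w => brownian_incr e B c (T / m%:R) w j) _
      (mesh_functional_lip p alpha T0 lipPsi (m := m))
      (mesh_functional_bound p alpha T0 lipPsi m)) => j _.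
  by apply: measurable_funM => //; exact: measurable_incr.
- by move=> m w; exact: (mesh_functional_bound p alpha T0 lipPsi).
move=> w; apply/cvgrPdist_le => x x0.
have uw := scaled_brownian_ucont sg w.
have K0 : 0 < L * (1 + `|lam|) + 1 by rewrite ltr_wpDl// mulr_ge0// addr_ge0.
have w0 : scaled_brownian sg w 0 = 0 by case: hB => h _ _ _; rewrite /scaled_brownian h mulr0.
have [m0 h] := mesh_path_cvg T0 w0 uw (divr_gt0 x0 K0).
near=> m; have mm0 : (m0 <= m)%N by near: m; exact: nbhs_infty_ge.
apply: (@le_trans _ _ (L * ((1 + `|lam|) * (x / (L * (1 + `|lam|) + 1))))).
  apply: lip => [||t tT]; [exact/perturb_ucont/uw/ltW|by apply: perturb_ucont; [exact: ltW|apply/mesh_path_ucont/ltW]|].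
  apply: (perturb_lip (T := T)) => // [||s sT].
  - by apply: ucont_bounded uw; exact: ltW.
  - exact: mesh_path_bounded.
  have := h m mm0 s sT; congr (`|_ - _| <= _); congr mesh_path.
  by apply/funext => j; rewrite brownian_incrE.
by rewrite mulrA mulrA ler_pdivrMr// mulrC ler_pM2l// lerDl.
Unshelve. all: by end_near. Qed.

End BrownianApproximation.

(** * Convergence of the rescaled walk *)

Section Convergence.
Context {R : realType} {d : measure_display} {Omega : measurableType d}
  (P : probability Omega R).
Variables (rho0 : int -> {RV P >-> int}) (b : nat -> {RV P >-> int}).
Variables (p alpha : R).
Hypothesis hp : 0 < p < 1.
Hypothesis halpha : 0 <= alpha <= 1.
Hypothesis hrho : alpha_0_random_configuration alpha rho0.
Hypothesis hb : iid_signs p b.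
Hypothesis hind : independent_families P (fun x => rho0 x : Omega -> int)
                               (fun n => b n : Omega -> int).
Context {d' : measure_display} {Omega' : measurableType d'}
  (Q : probability Omega' R) (B : R -> {RV Q >-> R}).
Hypothesis hB : brownian_motion B.
Variable (T : R).
Hypothesis T0 : 0 < T.

Local Notation lam := (rotor_lambda p alpha).
Local Notation sg := (sigma (2 * p - 1) (2 * p)^-1).
Local Notation walk := (walk rho0 b).

Lemma walk_mesh_cvg m L M Psi : 0 <= L -> bounded_lip T M L Psi -> (0 < m)%N ->
  Ex P (fun w => mesh_functional p alpha T Psi m (walk_mesh rho0 b p T m n w))
    @[n --> \oo] -->
  Ex Q (fun w => mesh_functional p alpha T Psi m
    (brownian_incr (2 * p - 1) B (2 * p)^-1 (T / m%:R) w)).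
Proof.
move=> L0 lipPsi m0; have p0 : 0 < p by case/andP: hp.
apply: (increments_cvg (measurable_signs rho0 b) (signs_pm1 hrho hb)
  (signs_independent hrho hb hind) (@history_step) (@history_next) (@history_new)
  (mean_b rho0 hb) (determined_coef hrho hb) _ hB _ _ (j := m) (L := L * ((1 + `|lam|) * m%:R))
  (M := M)).
- by move=> k w; exact: rotor_at_sqr hrho hb k w.
- by rewrite invr_ge0; lra.
- by rewrite divr_gt0// ltr0n.
- by apply: mulr_ge0 => //; apply: mulr_ge0 => //; exact: addr_ge0.
- exact: (mesh_functional_lip p alpha T0 lipPsi (m := m)).
- exact: (mesh_functional_bound p alpha T0 lipPsi).
Qed.

Lemma near_divn (C x : R) : 0 <= C -> 0 < x -> \forall n \near \oo, C / n%:R <= x.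
Proof.
move=> C0 x0; near=> n; have n0 : (0 < n)%N by near: n; exact: nbhs_infty_gt.
rewrite ler_pdivrMr ?ltr0n// mulrC -ler_pdivrMr//.
by near: n; exact: nbhs_infty_ger.
Unshelve. all: by end_near. Qed.

Lemma near_div_sqrtn (C x : R) : 0 <= C -> 0 < x ->
  \forall n \near \oo, C / Num.sqrt n%:R <= x.
Proof.
move=> C0 x0; near=> n; have n0 : (0 < n)%N by near: n; exact: nbhs_infty_gt.
have q0 : 0 < Num.sqrt n%:R :> R by rewrite sqrtr_gt0 ltr0n.
rewrite ler_pdivrMr// mulrC -ler_pdivrMr// -(@ler_pXn2r _ 2)// ?nnegrE ?divr_ge0 ?(ltW q0) ?(ltW x0)//.
rewrite sqr_sqrtr//; near: n; exact: nbhs_infty_ger.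
Unshelve. all: by end_near. Qed.

(** The parameters of walk_error are chosen one after the other: th and th0, then the
mesh m, then n, so that each of the five error terms is small. *)
Lemma walk_functional_cvg L M Psi : bounded_lip T M L Psi ->
  bm (fun w => Psi (perturb lam (scaled_brownian B sg w))) /\
  Ex P (fun w => Psi (walk n w)) @[n --> \oo] -->
  Ex Q (fun w => Psi (perturb lam (scaled_brownian B sg w))).
Proof.
have p0 : 0 < p by case/andP: hp.
wlog L0 : L / 0 <= L => [H [bPsi lip]|lipPsi].
  apply: (H `|L|) => //; split => // f g a uf ug fg.
  apply: le_trans (lip f g a uf ug fg) _.
  by rewrite ler_wpM2r ?ler_norm//; exact: close_ge0 fg.
have [bZ cZ] := brownian_mesh_cvg hB p alpha T0 (2 * p - 1) (2 * p)^-1 L0 lipPsi.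
split => //; apply/cvgrPdist_le => x x0.
have M0 : 0 <= M by apply: le_trans (normr_ge0 _) (mesh_functional_bound p alpha T0 lipPsi 0 (fun=> 0)).
have D0 : 0 < 1 - `|drift p| by rewrite subr_gt0 drift_bound.
have l0 : 0 <= 1 + `|lam| by exact: addr_ge0.
have x8 : 0 < x / 8 by rewrite divr_gt0.
pose C1 := L * ((1 + `|lam|) * (3 / (2 * p))).
have C1_0 : 0 <= C1 by apply: mulr_ge0 => //; apply: mulr_ge0 => //; apply: divr_ge0; lra.
pose th := x / 8 / (C1 + 1); have th_0 : 0 < th by rewrite divr_gt0// ltr_wpDl.
pose C2 := 2 * M * (80 * T ^+ 2).
have C2_0 : 0 <= C2 by apply: mulr_ge0; apply: mulr_ge0 => //; exact: sqr_ge0.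
(* As th0 >= 1, also th0 ^ 4 >= C2 / (x / 8). *)
pose th0 := 1 + C2 / (x / 8).
have th0_1 : 1 <= th0 by rewrite lerDl divr_ge0// ltW.
have th0_0 : 0 < th0 by apply: lt_le_trans th0_1.
pose C3 := 2 * M * (320 * T ^+ 2) / th ^+ 4.
have C3_0 : 0 <= C3.
  apply: divr_ge0; last exact/exprn_ge0/ltW.
  by apply: mulr_ge0; apply: mulr_ge0 => //; exact: sqr_ge0.
have [m [m0 m3 mZ]] : exists m, [/\ (0 < m)%N, C3 / m%:R <= x / 8 &
    `|Ex Q (fun w => Psi (perturb lam (scaled_brownian B sg w))) -
      Ex Q (fun w => mesh_functional p alpha T Psi m
        (brownian_incr (2 * p - 1) B (2 * p)^-1 (T / m%:R) w))| <= x / 8].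
  near \oo => m; exists m; split.
  - by near: m; exact: nbhs_infty_gt.
  - by near: m; exact: near_divn.
  - by near: m; move/cvgrPdist_le : cZ; exact.
pose C4 := L * (1 + (1 + `|lam|) * (4 / (2 * p))).
pose C5 := 2 * M * (80 * ((th0 + 2) / (1 - `|drift p|)) ^+ 2 / th ^+ 4).
have C4_0 : 0 <= C4.
  by apply: mulr_ge0 => //; apply: addr_ge0 => //; apply: mulr_ge0 => //; apply: divr_ge0; lra.
have C5_0 : 0 <= C5.
  apply: mulr_ge0; first exact: mulr_ge0.
  by apply: divr_ge0; [apply: mulr_ge0 => //; exact: sqr_ge0|exact/exprn_ge0/ltW].
have cW := walk_mesh_cvg L0 lipPsi m0.
near=> n.
have n0 : (0 < n)%N by near: n; exact: nbhs_infty_gt.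
have nTm : 1 <= n%:R * (T / m%:R).
  by rewrite -ler_pdivrMr ?divr_gt0 ?ltr0n//; near: n; exact: nbhs_infty_ger.
have h4 : C4 / Num.sqrt n%:R <= x / 8 by near: n; exact: near_div_sqrtn.
have h5 : C5 / Num.sqrt n%:R <= x / 8 by near: n; exact: near_div_sqrtn.
have hW : `|Ex Q (fun w => mesh_functional p alpha T Psi m
        (brownian_incr (2 * p - 1) B (2 * p)^-1 (T / m%:R) w)) -
    Ex P (fun w => mesh_functional p alpha T Psi m (walk_mesh rho0 b p T m n w))| <= x / 8.
  by near: n; move/cvgrPdist_le : cW; exact.
have := walk_error hp halpha hrho hb hind T0 L0 lipPsi n0 m0 nTm th_0 th0_0.
have h1 : C1 * th <= x / 8.
  rewrite /th mulrA ler_pdivrMr ?ltr_wpDl// mulrC ler_pM2l// lerDl.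
  exact: ler01.
have h2 : C2 / th0 ^+ 4 <= x / 8.
  rewrite ler_pdivrMr ?exprn_gt0// mulrC -ler_pdivrMr//.
  apply: (@le_trans _ _ th0); first by rewrite /th0 lerDr.
  by rewrite -[leLHS]expr1 ler_weXn2l.
set er := (X in _ <= X -> _).
have -> : er = C1 * th + C4 / Num.sqrt n%:R + C2 / th0 ^+ 4 + C5 / Num.sqrt n%:R + C3 / m%:R.
  rewrite /er /C1 /C2 /C3 /C4 /C5; field.
  by rewrite !gt_eqF ?subr_gt0 ?drift_bound ?sqrtr_gt0 ?ltr0n.
have chain (z m' k y c1 c2 c3 c4 c5 : R) : `|z - m'| <= x / 8 -> `|m' - k| <= x / 8 ->
    `|y - k| <= c1 + c2 + c3 + c4 + c5 -> c1 <= x / 8 -> c2 <= x / 8 -> c3 <= x / 8 ->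
    c4 <= x / 8 -> c5 <= x / 8 -> `|z - y| <= x.
  by rewrite !ler_norml => /andP[? ?] /andP[? ?] /andP[? ?] *; apply/andP; split; lra.
by move=> hE; exact: chain mZ hW hE h1 h4 h2 h5 m3.
Unshelve. all: by end_near. Qed.

End Convergence.

Lemma sigma_rotor {R : realType} (p : R) : 0 < p < 1 ->
  sigma (2 * p - 1) (2 * p)^-1 = Num.sqrt ((1 - p) / p).
Proof.
move=> /andP[p0 p1]; have q0 : 0 <= (2 * p)^-1 by rewrite invr_ge0; lra.
rewrite /sigma -{1}(ger0_norm q0) -sqrtr_sqr -sqrtrM ?sqr_ge0//.
by congr Num.sqrt; field; rewrite gt_eqF.
Qed.

Theorem corollary1p3 (R : realType)
  (d : measure_display) (Omega : measurableType d) (P : probability Omega R)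
  (d' : measure_display) (Omega' : measurableType d') (Q : probability Omega' R)
  (p alpha : R) (hp : 0 < p < 1) (halpha : 0 <= alpha <= 1)
  (X : nat -> Omega -> int) (hX : is_rotor_walk P p alpha X)
  (B : R -> {RV Q >-> R}) (hB : brownian_motion B) :
  let lambda :=
    alpha * (2 * p - 1) / (alpha * (1 - p) + p * (1 - alpha)) in
  weak_cvg_C0oo P Q
    (fun n t w =>
       interpolation (fun k => (X k w)%:~R) (n%:R * t) / Num.sqrt n%:R)
    (fun t w =>
       Num.sqrt ((1 - p) / p) *
       (B t w + lambda * running_sup (fun s => B s : Omega' -> R) t w)).
Proof.
move=> lambda T T0; case: hX => rho0 [b [hrho hb hind ->]].
pose sg : R := sigma (2 * p - 1) (2 * p)^-1.
have sg0 : 0 <= sg by rewrite /sg sigma_rotor// sqrtr_ge0.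
have pertE w t : 0 <= t <= T -> Num.sqrt ((1 - p) / p) * (B t w + lambda * running_sup B t w) =
    perturb (rotor_lambda p alpha) (scaled_brownian B sg w) t.
  by move=> tT; rewrite (perturb_scaled hB _ _ T0 _ sg0 tT) /sg sigma_rotor.
have uS w : ucont T (perturb (rotor_lambda p alpha) (scaled_brownian B sg w)).
  by apply: perturb_ucont; [exact: ltW|exact: scaled_brownian_ucont].
have uZ w : ucont T (fun t => Num.sqrt ((1 - p) / p) * (B t w + lambda * running_sup B t w)).
  move=> e e0; have [h h0 H] := uS w e e0; exists h => // s t sT tT st.
  by rewrite !pertE//; exact: H.
have wcvg : weak_cvg_C0T P Q T (fun n t w => walk rho0 b n w t)
    (fun t w => Num.sqrt ((1 - p) / p) * (B t w + lambda * running_sup B t w)).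
  apply: (portmanteau T0) => //.
  - by move=> n w; exact: rescaled_walk_ucont.
  - by move=> n Phi _ inv; exact: (walk_bm hrho hb T0 n inv).
  move=> M L Psi lipPsi.
  have E : (fun w => Psi (fun t => Num.sqrt ((1 - p) / p) *
        (B t w + lambda * running_sup B t w))) =
      (fun w => Psi (perturb (rotor_lambda p alpha) (scaled_brownian B sg w))).
    apply/funext => w; apply: (bounded_lip_invariant lipPsi) => // t tT.
    by rewrite pertE// subrr normr0.
  by rewrite E; exact: (walk_functional_cvg hp halpha hrho hb hind hB T0 lipPsi).
move=> Phi bc; have := wcvg Phi bc.
have inv f g : ucont T f -> ucont T g -> close T 0 f g -> Phi f = Phi g.
  by apply: continuous_invariant => h uh e e0; exact: bounded_continuousP.
pose Y n w t : R := interpolation (fun k => (rotor_walk_process rho0 b k w)%:~R) (n%:R * t) /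
  Num.sqrt n%:R.
suff E n : ('E_P[fun w => Phi (Y n w)] = 'E_P[fun w => Phi (walk rho0 b n w)])%E.
  by under eq_cvg do rewrite -E.
(* The two walks agree outside a null set. *)
rewrite unlock; apply: ae_eq_integral => //.
- have [mY _] := rescaled_walk_bm hrho hb T0 n
    (conf := fun w x => rho0 x w) (history_pos hrho hb) inv.
  exact/measurable_EFinP.
- by have [mY _] := walk_bm hrho hb T0 n inv; exact/measurable_EFinP.
apply: filterS (config_ae hrho) => w cw _; by rewrite /walk cw.
Qed.
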